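(* Let $k\ge1$, and let $x$ be a $0$-dominant affine permutation, associated to the $k$-bounded partition $\lambda$ with column heights given by $\lambda'=(\lambda_1',\dots,\lambda_k')$, some of which may be zero. Then the $k$-code $\mathrm{RD}(x)$ equals $(\lambda_1',\dots,\lambda_k',0)$. Furthermore, if $\nu$ is the $k$-conjugate of $\lambda$, with column heights $(\nu_1',\dots,\nu_k')$, then $\mathrm{RI}(x)=(\nu_1',\dots,\nu_k',0)$.
   Context: Fix $k\ge1$, $I=\mathbb Z/(k+1)\mathbb Z$. The affine nil-Coxeter algebra $\mathbb A_k$ is generated by $a_i$ ($i\in I$) with relations $a_i^2=0$, $a_ia_j=a_ja_i$ for $j\notin\{i-1,i,i+1\}$, and (for $k\ge2$) $a_ia_{i+1}a_i=a_{i+1}a_ia_{i+1}$; its nonzero monomials form a basis and are identified with affine permutations in the affine symmetric group $\tilde S_{k+1}$ via reduced words. For $A\subsetneq I$, $d_A$ (resp. $u_A$) is the product of the $a_i$, $i\in A$, each once, with $a_j$ to the left (resp. right) of $a_{j-1}$ whenever $j,j-1\in A$. An affine permutation $x$ is $0$-dominant (Grassmannian) if its right descent set $\{p\in I: xa_p=0\}$ is contained in $\{0\}$. A $k$-code is a function $\alpha:I\to\mathbb Z_{\ge0}$ with at least one value $0$, written as the vector $(\alpha_0,\alpha_1,\dots,\alpha_k)$. Each affine permutation $x$ has a unique decomposition $x=d_{A_n}\cdots d_{A_1}$ (nonempty $A_j\subsetneq I$) with $(|A_1|,\dots,|A_n|)$ lexicographically maximal, and a unique decomposition $x=u_{B_m}\cdots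 u_{B_1}$ (nonempty $B_j\subsetneq I$) with $(|B_1|,\dots,|B_m|)$ lexicographically maximal. The $k$-code $\mathrm{RD}(x)$ records the column heights of the diagram on a cylinder with $k+1$ columns $0,1,\dots,k$ whose $j$-th row from the bottom contains the residues in $A_j$, the box in column $i$ and row $j$ having residue $i-(j-1)$; that is, $\mathrm{RD}(x)_i=\#\{j\ge1: i-(j-1)\in A_j\}$. Similarly, the $k$-code $\mathrm{RI}(x)$ records the row lengths of the diagram on a cylinder with $k+1$ rows $0,1,\dots,k$, listed from bottom to top starting with the row whose first box has residue $0$, whose $j$-th column from the left contains the residues in $B_j$, the box in row $r$ and column $j$ having residue $(j-1)-r$ (as in the usual filling of a partition diagram by residues); that is, $\mathrm{RI}(x)_r=\#\{j\ge1: (j-1)-r\in B_j\}$. A $k$-bounded partition has all parts $\le k$. A $(k+1)$-core is a partition with no hook of length $k+1$. For a $(k+1)$-core $\mu$, let $\mathfrak p(\mu)$ be the $k$-bounded partition whose $i$-th part is the number of boxes in row $i$ of $\mu$ with hook length $\le k$; $\mathfrak p$ is a bijection from $(k+1)$-cores to $k$-bounded partitions, with inverse $\mathfrak c$. The $k$-conjugate of $\lambda$ is $\lambda^{(k)}=\mathfrak p(\mathfrak c(\lambda)^t)$, where $t$ denotes the usual transpose of a partition. Let $h_l=\sum_{|A|=l}d_A\in\mathbb A_k$ for $1\le l\le k$; these commute. The $k$-Schur functions $s_\lambda^{(k)}$ ($\lambda$ $k$-bounded) are the elements of the algebra generated by $h_1,\dots,h_k$ determined by $s_\emptyset^{(k)}=1$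 and $h_ls_\mu^{(k)}=\sum_\kappa s_\kappa^{(k)}$, the sum being over $k$-bounded $\kappa\supset\mu$ with $|\kappa|=|\mu|+l$, $\kappa\setminus\mu$ a horizontal strip (at most one box per column) and $\kappa^{(k)}\setminus\mu^{(k)}$ a vertical strip (at most one box per row). The expansion of $s_\lambda^{(k)}$ in $\mathbb A_k$ contains a unique $0$-dominant summand $w_\lambda$, and $\lambda\mapsto w_\lambda$ is the bijection between $k$-bounded partitions and $0$-dominant affine permutations; ''$x$ is associated to $\lambda$'' means $x=w_\lambda$. *)

(* Defs.v *)
From HB Require Import structures.
From mathcomp Require Import all_boot all_order all_algebra.
From mathcomp Require Import boolp classical_sets.
From mathcomp Require Import monalg.

Set Implicit Arguments.
Unset Strict Implicit.
Unset Printing Implicit Defensive.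

Import Order.TTheory GRing.Theory.

Local Open Scope ring_scope.
Local Open Scope quotient_scope.

(* Partitions are weakly decreasing lists of positive integers; rows and
   columns of diagrams are numbered from 0. *)
Section Partitions.
Local Open Scope nat_scope.

Definition is_partition (p : seq nat) : bool := sorted geq p && (0 \notin p).

Definition kbounded (k : nat) (p : seq nat) : bool :=
  is_partition p && all (fun r => r <= k) p.

Definition col_height (p : seq nat) (c : nat) : nat := count (fun r => c < r) p.

Definition transpose (p : seq nat) : seq nat :=
  mkseq (col_height p) (head 0 p).

(* Arm plus leg plus one; meaningful for the boxes, i.e. for c < p_r. *)
Definition hook (p : seq nat) (r c : nat) : nat :=
  (nth 0 p r - c.+1) + (col_height p c - r.+1) + 1.

Definition is_core (n : nat) (p : seq nat) : bool :=
  is_partition p &&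
  all (fun r => all (fun c => hook p r c != n) (iota 0 (nth 0 p r)))
      (iota 0 (size p)).

Definition core_to_bounded (k : nat) (p : seq nat) : seq nat :=
  mkseq (fun r => count (fun c => hook p r c <= k) (iota 0 (nth 0 p r)))
        (size p).

(* The inverse of core_to_bounded k : (k+1)-cores -> k-bounded partitions,
   which is a bijection. *)
Definition bounded_to_core (k : nat) (lam : seq nat) : seq nat :=
  xget [::] [set p | is_core k.+1 p /\ core_to_bounded k p = lam]%classic.

Definition kconj (k : nat) (lam : seq nat) : seq nat :=
  core_to_bounded k (transpose (bounded_to_core k lam)).

Definition subpart (mu kap : seq nat) : bool :=
  all (fun r => nth 0 mu r <= nth 0 kap r) (iota 0 (size mu)).

Definition horizontal_strip (kap mu : seq nat) : bool :=
  subpart mu kap &&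
  all (fun c => col_height kap c - col_height mu c <= 1) (iota 0 (head 0 kap)).

Definition vertical_strip (kap mu : seq nat) : bool :=
  subpart mu kap &&
  all (fun r => nth 0 kap r - nth 0 mu r <= 1) (iota 0 (size kap)).

(* The partitions of n with parts at most m; f is fuel, f >= n suffices. *)
Fixpoint parts_rec (f m n : nat) : seq (seq nat) :=
  if n is 0 then [:: [::]] else
  if f is f'.+1 then
    [seq p :: q | p <- iota 1 (minn m n), q <- parts_rec f' p (n - p)]
  else [::].

Definition kbparts (k n : nat) : seq (seq nat) := parts_rec n k n.

Lemma is_partition_cons a q :
  is_partition (a :: q) = [&& 0 < a, all (fun r => r <= a) q & is_partition q].
Proof.
rewrite /is_partition /= inE negb_or eq_sym -lt0n.
have tr : transitive geq by move=> y x z /= yx zy; exact: leq_trans zy yx.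
rewrite (path_sortedE tr).
by case: (0 < a); case: (all _ _); case: (sorted _ _); case: (0 \notin q).
Qed.

Lemma mem_parts_rec f m n lam : n <= f ->
  (lam \in parts_rec f m n) = kbounded m lam && (sumn lam == n).
Proof.
elim: f m n lam => [|f IHf] m n lam le_nf.
  move: le_nf; rewrite leqn0 => /eqP -> /=; rewrite inE /kbounded.
  case: lam => [|a q] //; rewrite is_partition_cons /=.
  by case: a => [|a] //=; rewrite ?andbF.
case: n le_nf => [|n] le_nf /=.
  rewrite inE /kbounded; case: lam => [|a q] //; rewrite is_partition_cons /=.
  by case: a => [|a] //=; rewrite ?andbF.
apply/allpairsPdep/idP.
  case=> p [q []]; rewrite mem_iota add1n ltnS => /andP[p0 lep].
  have [lepm lepn] : p <= m /\ p <= n.+1.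
    by split; [apply: leq_trans lep (geq_minl _ _)|
               apply: leq_trans lep (geq_minr _ _)].
  rewrite IHf; last by rewrite leq_subLR; apply: leq_trans le_nf _;
    rewrite -add1n leq_add2r.
  case/andP=> /andP[pq qp] /eqP sq ->.
  rewrite /kbounded is_partition_cons p0 qp pq /= lepm sq subnKC // eqxx andbT.
  by apply/allP => r /(allP qp) rp; exact: leq_trans rp lepm.
case: lam => [|a q] //.
rewrite /kbounded is_partition_cons /= => /andP[/andP[/and3P[a0 qa pq]]].
case/andP=> am _ /eqP sq.
have an : a <= n.+1 by rewrite -sq leq_addr.
exists a, q; split=> //; first by rewrite mem_iota a0 add1n ltnS leq_min am an.
rewrite IHf; first by rewrite /kbounded pq qa -sq addKn eqxx.
by rewrite leq_subLR; apply: leq_trans le_nf _; rewrite -add1n leq_add2r.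
Qed.

Lemma mem_kbparts k n lam :
  (lam \in kbparts k n) = kbounded k lam && (sumn lam == n).
Proof. exact: mem_parts_rec. Qed.

Lemma uniq_kbparts k n : uniq (kbparts k n).
Proof.
rewrite /kbparts; move: {1}n => f; elim: f k n => [|f IHf] k [|n] //=.
apply: allpairs_uniq_dep; first exact: iota_uniq.
  by move=> p _; exact: IHf.
by move=> [p q] [p' q'] _ _ /= [-> ->].
Qed.

End Partitions.

Fact nilcox_key : unit. Proof. exact: tt. Qed.

(* The affine nil-Coxeter algebra over a commutative ring R, as the quotient
   of the free associative algebra by the two-sided ideal of the relations.
   The index set Z/(k+1)Z is 'Z_k.+1, which is correct for k >= 1. *)
Section NilCoxeter.
Variables (k : nat) (R : comNzRingType).

Definition free_alg : Type := {malg R[{fmonom 'Z_k.+1}]}.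
HB.instance Definition _ := GRing.Lmodule.on free_alg.

(* Multiplications are locked, since comparing unfolded products of malg
   elements makes unification impractically slow. *)
Definition free_mul : free_alg -> free_alg -> free_alg :=
  locked_with nilcox_key (fun x y : {malg R[{fmonom 'Z_k.+1}]} => x * y).

Lemma free_mulE (x y : {malg R[{fmonom 'Z_k.+1}]}) : free_mul x y = x * y.
Proof. by rewrite /free_mul unlock. Qed.

Lemma free_mulA : associative free_mul.
Proof. by move=> x y z; rewrite !free_mulE mulrA. Qed.
Lemma free_mul1l : left_id (1 : {malg R[{fmonom 'Z_k.+1}]}) free_mul.
Proof. by move=> x; rewrite free_mulE mul1r. Qed.
Lemma free_mul1r : right_id (1 : {malg R[{fmonom 'Z_k.+1}]}) free_mul.
Proof. by move=> x; rewrite free_mulE mulr1. Qed.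
Lemma free_mulDl : left_distributive free_mul +%R.
Proof. by move=> x y z; rewrite !free_mulE mulrDl. Qed.
Lemma free_mulDr : right_distributive free_mul +%R.
Proof. by move=> x y z; rewrite !free_mulE mulrDr. Qed.
Lemma free_one_neq0 : (1 : {malg R[{fmonom 'Z_k.+1}]}) != 0.
Proof. exact: oner_neq0. Qed.

HB.instance Definition _ := GRing.Zmodule_isNzRing.Build free_alg
  free_mulA free_mul1l free_mul1r free_mulDl free_mulDr free_one_neq0.

Lemma free_scaleAl (a : R) (u v : free_alg) :
  a *: free_mul u v = free_mul (a *: u) v.
Proof. by rewrite !free_mulE; exact: scalerAl. Qed.

HB.instance Definition _ := GRing.Lmodule_isLalgebra.Build R free_alg
  free_scaleAl.

Lemma free_scaleAr (a : R) (u v : free_alg) :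
  a *: free_mul u v = free_mul u (a *: v).
Proof.
rewrite !free_mulE; apply/malgP => m.
have uu := finmap.fsubset_refl (msupp u).
have vv := finmap.fsubset_refl (msupp v).
rewrite mcoeffZ (mcoeffMlw m uu vv) (mcoeffMlw m uu (msuppZ_le a v)).
rewrite mulr_sumr; apply: eq_bigr => k1 _; rewrite mulr_sumr.
by apply: eq_bigr => k2 _; rewrite mcoeffZ mulrnAr mulrCA.
Qed.

HB.instance Definition _ := GRing.Lalgebra_isAlgebra.Build R free_alg
  free_scaleAr.

Definition free_gen (i : 'Z_k.+1) : free_alg := mkmalgU (fmu i) 1.

(* The constant term. *)
Definition aug (x : free_alg) : R := x@_(fmone _).

Lemma aug_gen i : aug (free_gen i) = 0.
Proof. by rewrite /aug /free_gen mcoeffU fmP fmoneE fmuE. Qed.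

Fact aug_is_zmod : zmod_morphism aug.
Proof. by move=> x y; rewrite /aug mcoeffB. Qed.
HB.instance Definition _ := GRing.isZmodMorphism.Build free_alg R aug
  aug_is_zmod.

Fact aug_is_monoid : monoid_morphism aug.
Proof.
split=> [|x y]; rewrite /aug; first exact: (rmorph1 (mcoeff (fmone _))).
by rewrite [x * y]free_mulE; exact: (rmorphM (mcoeff (fmone _))).
Qed.
HB.instance Definition _ := GRing.isMonoidMorphism.Build free_alg R aug
  aug_is_monoid.

Inductive nilcox_rel : free_alg -> Prop :=
| nilcox_sq i : nilcox_rel (free_gen i * free_gen i)
| nilcox_comm i j : j \notin [:: i - 1; i; i + 1] ->
    nilcox_rel (free_gen i * free_gen j - free_gen j * free_gen i)
| nilcox_braid i : (2 <= k)%N ->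
    nilcox_rel (free_gen i * free_gen (i + 1) * free_gen i
                - free_gen (i + 1) * free_gen i * free_gen (i + 1)).

Record is_ideal (J : free_alg -> Prop) : Prop := IsIdeal {
  ideal0 : J 0;
  idealB : forall x y, J x -> J y -> J (x - y);
  idealM : forall a x b, J x -> J (a * x * b) }.

Definition nilcox_ideal (x : free_alg) : Prop :=
  forall J, is_ideal J -> (forall r, nilcox_rel r -> J r) -> J x.

Lemma nilcox_idealP : is_ideal nilcox_ideal.
Proof.
split=> [J JP _|x y Jx Jy J JP Jr|a x b Jx J JP Jr]; first exact: ideal0.
- by apply: (idealB JP); [apply: Jx|apply: Jy].
- by apply: (idealM JP); apply: Jx.
Qed.

Lemma nilcox_ideal_aug (f : {rmorphism free_alg -> R}) :
  (forall i, f (free_gen i) = 0) -> forall x, nilcox_ideal x -> f x = 0.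
Proof.
move=> f0 x /(_ (fun y => f y = 0)); apply=> [|_ [i|i j _|i _]]; last first.
- by rewrite rmorphB !rmorphM !f0 !mulr0 subr0.
- by rewrite rmorphB !rmorphM !f0 !mulr0 subr0.
- by rewrite rmorphM f0 mulr0.
split=> [|y z y0 z0|a y b y0]; first exact: rmorph0.
  by rewrite rmorphB y0 z0 subr0.
by rewrite !rmorphM y0 mulr0 mul0r.
Qed.

Lemma nilcox_ideal_proper : ~ nilcox_ideal 1.
Proof.
move/(nilcox_ideal_aug (f := aug) aug_gen)/eqP.
by rewrite rmorph1 oner_eq0.
Qed.

Definition nilcox_eqv (x y : free_alg) : bool := `[< nilcox_ideal (x - y) >].

Lemma nilcox_idealN x : nilcox_ideal x -> nilcox_ideal (- x).
Proof.
move=> Jx; rewrite -sub0r; apply: (idealB nilcox_idealP) => //.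
exact: (ideal0 nilcox_idealP).
Qed.

Lemma nilcox_idealD x y :
  nilcox_ideal x -> nilcox_ideal y -> nilcox_ideal (x + y).
Proof.
move=> Jx Jy; rewrite -[y]opprK; apply: (idealB nilcox_idealP) => //.
exact: nilcox_idealN.
Qed.

Lemma nilcox_idealMl a x : nilcox_ideal x -> nilcox_ideal (a * x).
Proof. by move=> Jx; rewrite -[a * x]mulr1; apply: (idealM nilcox_idealP). Qed.

Lemma nilcox_idealMr x b : nilcox_ideal x -> nilcox_ideal (x * b).
Proof. by move=> Jx; rewrite -[x]mul1r; apply: (idealM nilcox_idealP). Qed.

Lemma nilcox_eqv_refl : reflexive nilcox_eqv.
Proof.
by move=> x; apply/asboolP; rewrite subrr; apply: (ideal0 nilcox_idealP).
Qed.

Lemma nilcox_eqv_sym : symmetric nilcox_eqv.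
Proof.
by move=> x y; apply/asboolP/asboolP => /nilcox_idealN; rewrite opprB.
Qed.

Lemma nilcox_eqv_trans : transitive nilcox_eqv.
Proof.
move=> y x z /asboolP xy /asboolP yz; apply/asboolP.
by rewrite -[x - z](subrKA y); apply: nilcox_idealD.
Qed.

Canonical nilcox_equiv :=
  EquivRel nilcox_eqv nilcox_eqv_refl nilcox_eqv_sym nilcox_eqv_trans.

Definition nilcox : Type := {eq_quot nilcox_equiv}.
HB.instance Definition _ := Choice.on nilcox.

Definition nilcox_pi (x : free_alg) : nilcox := \pi_{eq_quot nilcox_equiv} x.
Definition nilcox_rep (x : nilcox) : free_alg :=
  repr (x : {eq_quot nilcox_equiv}).

Lemma nilcox_piP x y : nilcox_pi x = nilcox_pi y <-> nilcox_ideal (x - y).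
Proof.
rewrite /nilcox_pi; split.
  by move=> /eqmodP /= /asboolP.
by move=> H; apply/eqmodP => /=; apply/asboolP.
Qed.

Lemma nilcox_repK x : nilcox_pi (nilcox_rep x) = x. Proof. exact: reprK. Qed.

Lemma nilcox_rep_pi x : nilcox_ideal (nilcox_rep (nilcox_pi x) - x).
Proof. by apply/nilcox_piP; rewrite nilcox_repK. Qed.

Lemma nilcox_pi_surj (x : nilcox) : exists y, x = nilcox_pi y.
Proof. by exists (nilcox_rep x); rewrite nilcox_repK. Qed.

Definition nilcox_zero : nilcox := nilcox_pi 0.
Definition nilcox_one : nilcox := nilcox_pi 1.
Definition nilcox_opp :=
  locked_with nilcox_key (fun x : nilcox => nilcox_pi (- nilcox_rep x)).
Definition nilcox_add :=
  locked_with nilcox_key (fun x y : nilcox =>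
    nilcox_pi (nilcox_rep x + nilcox_rep y)).
Definition nilcox_mul :=
  locked_with nilcox_key (fun x y : nilcox =>
    nilcox_pi (nilcox_rep x * nilcox_rep y)).
Definition nilcox_scale :=
  locked_with nilcox_key (fun (c : R) (x : nilcox) =>
    nilcox_pi (c *: nilcox_rep x)).

Lemma nilcox_opp_pi x : nilcox_opp (nilcox_pi x) = nilcox_pi (- x).
Proof.
rewrite /nilcox_opp unlock; apply/nilcox_piP; rewrite -opprD.
by apply: nilcox_idealN; apply: nilcox_rep_pi.
Qed.

Lemma nilcox_add_pi x y :
  nilcox_add (nilcox_pi x) (nilcox_pi y) = nilcox_pi (x + y).
Proof.
rewrite /nilcox_add unlock; apply/nilcox_piP; rewrite opprD addrACA.
by apply: nilcox_idealD; apply: nilcox_rep_pi.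
Qed.

Lemma nilcox_mul_pi x y :
  nilcox_mul (nilcox_pi x) (nilcox_pi y) = nilcox_pi (x * y).
Proof.
rewrite /nilcox_mul unlock; apply/nilcox_piP.
rewrite -(subrKA (x * nilcox_rep (nilcox_pi y))) -mulrBl -mulrBr.
apply: nilcox_idealD; last first.
  by apply: nilcox_idealMl; apply: nilcox_rep_pi.
by apply: nilcox_idealMr; apply: nilcox_rep_pi.
Qed.

Lemma nilcox_scale_pi c x : nilcox_scale c (nilcox_pi x) = nilcox_pi (c *: x).
Proof.
rewrite /nilcox_scale unlock; apply/nilcox_piP.
rewrite -scalerBr -[_ - x]mul1r scalerAl.
by apply: nilcox_idealMl; apply: nilcox_rep_pi.
Qed.

Definition nilcox_piE :=
  (nilcox_opp_pi, nilcox_add_pi, nilcox_mul_pi, nilcox_scale_pi).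

Lemma nilcox_ind (P : nilcox -> Prop) :
  (forall x, P (nilcox_pi x)) -> forall x, P x.
Proof. by move=> H x; have [y ->] := nilcox_pi_surj x. Qed.

Lemma nilcox_addA : associative nilcox_add.
Proof. by do 3!elim/nilcox_ind=> ?; rewrite !nilcox_piE addrA. Qed.
Lemma nilcox_addC : commutative nilcox_add.
Proof. by do 2!elim/nilcox_ind=> ?; rewrite !nilcox_piE addrC. Qed.
Lemma nilcox_add0 : left_id nilcox_zero nilcox_add.
Proof. by elim/nilcox_ind=> ?; rewrite !nilcox_piE add0r. Qed.
Lemma nilcox_addN : left_inverse nilcox_zero nilcox_opp nilcox_add.
Proof. by elim/nilcox_ind=> ?; rewrite !nilcox_piE addNr. Qed.

HB.instance Definition _ := GRing.isZmodule.Build nilcox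
  nilcox_addA nilcox_addC nilcox_add0 nilcox_addN.

Lemma nilcox_mulA : associative nilcox_mul.
Proof. by do 3!elim/nilcox_ind=> ?; rewrite !nilcox_piE mulrA. Qed.
Lemma nilcox_mul1l : left_id nilcox_one nilcox_mul.
Proof. by elim/nilcox_ind=> ?; rewrite !nilcox_piE mul1r. Qed.
Lemma nilcox_mul1r : right_id nilcox_one nilcox_mul.
Proof. by elim/nilcox_ind=> ?; rewrite !nilcox_piE mulr1. Qed.
Lemma nilcox_mulDl : left_distributive nilcox_mul +%R.
Proof. by do 3!elim/nilcox_ind=> ?; rewrite /+%R /= !nilcox_piE mulrDl. Qed.
Lemma nilcox_mulDr : right_distributive nilcox_mul +%R.
Proof. by do 3!elim/nilcox_ind=> ?; rewrite /+%R /= !nilcox_piE mulrDr. Qed.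
Lemma nilcox_one_neq0 : nilcox_one != 0.
Proof.
apply/eqP => /nilcox_piP; rewrite subr0; exact: nilcox_ideal_proper.
Qed.

HB.instance Definition _ := GRing.Zmodule_isNzRing.Build nilcox
  nilcox_mulA nilcox_mul1l nilcox_mul1r nilcox_mulDl nilcox_mulDr
  nilcox_one_neq0.

Lemma nilcox_scaleA a b v :
  nilcox_scale a (nilcox_scale b v) = nilcox_scale (a * b) v.
Proof. by elim/nilcox_ind: v => ?; rewrite !nilcox_piE scalerA. Qed.
Lemma nilcox_scale1 : left_id 1 nilcox_scale.
Proof. by elim/nilcox_ind=> ?; rewrite !nilcox_piE scale1r. Qed.
Lemma nilcox_scaleDr : right_distributive nilcox_scale +%R.
Proof.
by move=> c; do 2!elim/nilcox_ind=> ?; rewrite /+%R /= !nilcox_piE scalerDr.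
Qed.
Lemma nilcox_scaleDl v : {morph nilcox_scale^~ v : a b / a + b}.
Proof.
elim/nilcox_ind: v => v a b.
by rewrite /= !nilcox_piE scalerDl -nilcox_add_pi.
Qed.

HB.instance Definition _ := GRing.Zmodule_isLmodule.Build R nilcox
  nilcox_scaleA nilcox_scale1 nilcox_scaleDr nilcox_scaleDl.

Lemma nilcox_scaleAl (a : R) (u v : nilcox) : a *: (u * v) = (a *: u) * v.
Proof.
elim/nilcox_ind: u => u; elim/nilcox_ind: v => v.
by rewrite /GRing.scale /= /GRing.mul /= !nilcox_piE scalerAl.
Qed.

HB.instance Definition _ := GRing.Lmodule_isLalgebra.Build R nilcox
  nilcox_scaleAl.

Lemma nilcox_scaleAr (a : R) (u v : nilcox) : a *: (u * v) = u * (a *: v).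
Proof.
elim/nilcox_ind: u => u; elim/nilcox_ind: v => v.
by rewrite /GRing.scale /= /GRing.mul /= !nilcox_piE scalerAr.
Qed.

HB.instance Definition _ := GRing.Lalgebra_isAlgebra.Build R nilcox
  nilcox_scaleAr.

Definition gen (i : 'Z_k.+1) : nilcox := nilcox_pi (free_gen i).

Lemma gen_sq i : gen i * gen i = 0.
Proof.
rewrite [LHS]nilcox_mul_pi; apply/nilcox_piP; rewrite subr0 => I _; apply.
exact: nilcox_sq.
Qed.

Lemma gen_comm i j : j \notin [:: i - 1; i; i + 1] ->
  gen i * gen j = gen j * gen i.
Proof.
move=> ij; rewrite [LHS]nilcox_mul_pi [RHS]nilcox_mul_pi.
by apply/nilcox_piP => I _; apply; exact: nilcox_comm.
Qed.

Lemma gen_braid i : (2 <= k)%N ->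
  gen i * gen (i + 1) * gen i = gen (i + 1) * gen i * gen (i + 1).
Proof.
have mulE x y : nilcox_pi x * nilcox_pi y = nilcox_pi (x * y).
  exact: nilcox_mul_pi.
move=> k2; rewrite /gen !mulE.
by apply/nilcox_piP => I _; apply; exact: nilcox_braid.
Qed.

Definition mono (w : seq 'Z_k.+1) : nilcox := \prod_(i <- w) gen i.

(* Affine permutations are identified with the nonzero monomials. *)
Definition affine_perm (x : nilcox) : Prop := x != 0 /\ exists w, x = mono w.

Definition dominant0 (x : nilcox) : Prop :=
  forall p : 'Z_k.+1, x * gen p = 0 -> p = 0.

(* The elements of a proper subset A, read off in the cyclic order
   m-1, m-2, ..., m-k for some m not in A, so that j stands immediately before
   j-1 whenever both are in A (see index_cyc_desc below). *)
Definition cyc_desc (A : {set 'Z_k.+1}) : seq 'Z_k.+1 :=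
  let m := odflt 0 [pick m | m \notin A] in
  [seq j <- [seq m - i%:R | i <- iota 1 k] | j \in A].

Definition cyc_rank (m j : 'Z_k.+1) : nat := nat_of_ord (m - j).

Lemma val_natZ i : (1 <= k)%N -> (i <= k)%N -> nat_of_ord (i%:R : 'Z_k.+1) = i.
Proof. by move=> k1 ik; rewrite val_Zp_nat // modn_small. Qed.

Lemma leZ (j : 'Z_k.+1) : (1 <= k)%N -> (j <= k)%N.
Proof. by move=> k1; have := ltn_ord j; rewrite [X in (_ < X)%N]Zp_cast. Qed.

Lemma cyc_rank_desc m : (1 <= k)%N ->
  [seq cyc_rank m j | j <- [seq m - i%:R | i <- iota 1 k]] = iota 1 k.
Proof.
move=> k1; rewrite -map_comp -[RHS]map_id; apply/eq_in_map => i.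
rewrite mem_iota add1n ltnS => /andP[_ ik] /=.
by rewrite /cyc_rank subKr val_natZ.
Qed.

Lemma cyc_desc_uniq A : (1 <= k)%N -> uniq (cyc_desc A).
Proof.
move=> k1; apply: filter_uniq; set m := odflt _ _.
apply: (@map_uniq _ _ (cyc_rank m)).
by rewrite cyc_rank_desc // iota_uniq.
Qed.

Lemma mem_cyc_desc (A : {set 'Z_k.+1}) :
  (1 <= k)%N -> A \proper [set: 'Z_k.+1] -> cyc_desc A =i A.
Proof.
move=> k1 /properP[_ [m0 _ m0A]] j; rewrite /cyc_desc.
case: pickP => [m mA|/(_ m0)]; last by rewrite m0A.
rewrite /= mem_filter; case: (boolP (j \in A)) => //= jA.
apply/mapP; exists (cyc_rank m j).
  rewrite mem_iota add1n lt0n ltnS; apply/andP; split.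
    apply/eqP => r0; have: m - j == 0 by apply/eqP/val_inj.
    by rewrite subr_eq0 => /eqP mj; rewrite mj jA in mA.
  exact: leZ.
by rewrite /cyc_rank natr_Zp subKr.
Qed.

Lemma index_cyc_desc (A : {set 'Z_k.+1}) j :
  (1 <= k)%N -> A \proper [set: 'Z_k.+1] -> j \in A -> j - 1 \in A ->
  (index j (cyc_desc A) < index (j - 1)%R (cyc_desc A))%N.
Proof.
move=> k1 pA jA j1A; have memA := mem_cyc_desc k1 pA.
move: memA; rewrite /cyc_desc; have /properP[_ [m0 _ m0A]] := pA.
case: pickP => [m mA|/(_ m0)]; last by rewrite m0A.
move=> /=; set s := [seq _ <- _ | _] => memA.
have ss : sorted (relpre (cyc_rank m) ltn) s.
  rewrite -sorted_map; apply: (subseq_sorted ltn_trans _ (iota_ltn_sorted 1 k)).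
  by rewrite -(cyc_rank_desc m k1); apply: map_subseq; apply: filter_subseq.
rewrite ltnNge; apply/negP; rewrite leq_eqVlt => /orP[/eqP eqi|lti].
  have /eqP : j - 1 = j.
    by rewrite -[LHS](@nth_index _ 0 _ s) ?memA // eqi nth_index ?memA.
  by rewrite subr_eq addrC -subr_eq subrr eq_sym oner_eq0.
have tr : transitive (relpre (cyc_rank m) ltn).
  by move=> y x z; apply: ltn_trans.
have /= := sorted_ltn_index tr ss; move=> /(_ (j - 1) j).
rewrite !memA => /(_ j1A jA lti).
have mj : m - (j - 1) = (m - j) + 1 by rewrite opprB addrA addrAC.
have : m - (j - 1) != 0 by rewrite subr_eq0; apply: contraNneq mA => ->.
rewrite /cyc_rank mj -[X in X + 1]natr_Zp natr1.
have := leZ (m - j) k1; rewrite leq_eqVlt => /orP[/eqP -> |lek].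
  by rewrite (@pchar_Zp k.+1) // eqxx.
by move=> _; rewrite val_natZ // ltnNge leqnSn.
Qed.

Definition dA (A : {set 'Z_k.+1}) : nilcox := mono (cyc_desc A).
Definition uA (A : {set 'Z_k.+1}) : nilcox := mono (rev (cyc_desc A)).

(* The list [:: A_1; ...; A_n] encodes x = f A_n * ... * f A_1. *)
Definition is_factorization (f : {set 'Z_k.+1} -> nilcox) (x : nilcox)
    (As : seq {set 'Z_k.+1}) : Prop :=
  (forall A, A \in As -> A != finset.set0 /\ A \proper [set: 'Z_k.+1]) /\
  x = \prod_(A <- rev As) f A.

Definition sizes (As : seq {set 'Z_k.+1}) : seqlexi nat :=
  [seq #|A| | A : {set 'Z_k.+1} <- As].

Definition is_max_factorization f x As : Prop :=
  is_factorization f x As /\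
  forall Bs, is_factorization f x Bs -> (sizes Bs <= sizes As)%O.

Definition max_factorization f x : seq {set 'Z_k.+1} :=
  xget [::] [set As | is_max_factorization f x As]%classic.

(* Lists are indexed from 0, so that position j holds A_(j+1), resp. B_(j+1). *)
Definition RD (x : nilcox) (i : 'Z_k.+1) : nat :=
  let As := max_factorization dA x in
  count (fun j => i - j%:R \in nth finset.set0 As j) (iota 0 (size As)).

Definition RI (x : nilcox) (r : 'Z_k.+1) : nat :=
  let Bs := max_factorization uA x in
  count (fun j => j%:R - r \in nth finset.set0 Bs j) (iota 0 (size Bs)).

Definition code_vector (alpha : 'Z_k.+1 -> nat) : seq nat :=
  [seq alpha i | i <- enum 'Z_k.+1].

Definition h (l : nat) : nilcox := \sum_(A : {set 'Z_k.+1} | #|A| == l) dA A.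

Definition in_h_algebra (x : nilcox) : Prop :=
  forall S : nilcox -> Prop,
    S 1 ->
    (forall u v, S u -> S v -> S (u + v)) ->
    (forall u v, S u -> S v -> S (u * v)) ->
    (forall (c : R) u, S u -> S (c *: u)) ->
    (forall l, (1 <= l <= k)%N -> S (h l)) ->
    S x.

Record is_kSchur (s : seq nat -> nilcox) : Prop := IsKSchur {
  kSchur_in : forall lam, kbounded k lam -> in_h_algebra (s lam);
  kSchur_nil : s [::] = 1;
  kSchur_pieri : forall l mu, (1 <= l <= k)%N -> kbounded k mu ->
    h l * s mu =
    \sum_(kap <- kbparts k (sumn mu + l)
          | horizontal_strip kap mu &&
            vertical_strip (kconj k kap) (kconj k mu))
       s kap }.

(* x occurs, with a nonzero coefficient, in an expansion of f as a linear
   combination of distinct affine permutations; as these form a basis, the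
   expansion is unique. *)
Definition is_summand (x f : nilcox) : Prop :=
  exists (ys : seq nilcox) (c : nilcox -> R),
    [/\ uniq ys,
        forall y, y \in ys -> affine_perm y /\ c y != 0,
        f = \sum_(y <- ys) c y *: y
      & x \in ys].

(* x is the 0-dominant summand (it is unique) of the k-Schur function s lam. *)
Definition associated (s : seq nat -> nilcox) (x : nilcox) (lam : seq nat) :=
  dominant0 x /\ is_summand x (s lam).

End NilCoxeter.

(* Main.v *)
Require Import Defs.
From mathcomp Require Import all_boot all_order all_algebra.
From mathcomp Require Import boolp classical_sets finmap monalg.
From mathcomp Require Import zify ring.

Set Implicit Arguments.
Unset Strict Implicit.
Unset Printing Implicit Defensive.

Import Order.TTheory GRing.Theory Num.Theory.
Local Open Scope ring_scope.

(** The algebra acts on (k+1)-cores, [a_i] adding all addable boxes of residue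
    [i] (and giving [0] when there is none).  Encode a core of charge zero by the
    first gaps [g_0 < ... < g_k] of its bead set, one in each residue class mod
    [k+1].  Its bounded partition has column heights
    [L_a = sum_(b > a) floor ((g_b - g_a) / (k+1))], its k-conjugate has the column
    heights [N_b = sum_(a < b) floor ((g_b - g_a) / (k+1))] in reverse order, and
    [g_b = b + N_b - L_b].  A generator moves the two first gaps of residues [i] and
    [i-1] past each other, which raises one [L_a] and one [N_b] by one, so [d_A]
    raises [L_a] by one exactly when [g_a mod (k+1)] lies in [A].

    Hence a factorization of [x] into [d_A]'s is a chain of horizontal strips from
    the empty core to the core of [x]; its sizes are dominated by the partition, and
    the filling by rows is the only chain whose sizes are the rows.  Comparing the
    k-Pieri rule with the action of [h_l] shows that [s_lam] maps the empty core to
    the core of [lam], and a nonzero monomial is either determined by the core that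
    it creates or is not 0-dominant.  Negating residues transposes cores and
    exchanges [u] with [d], which gives the statement on [RI]. *)

(** * The action of the nil-Coxeter algebra on states *)

(** The algebra is a quotient by relations, so its elements are read through scalars: [ev F c] acts
    on [c] and applies an arbitrary function [F] on states. With [F] an indicator this is a matrix
    coefficient, which separates words that create different cores; an exchange argument gives the
    converse, that words creating the same core are equal monomials. Maximal factorizations and the
    core of a partition are defined by choice operators, so existence and uniqueness are both
    required. Uniqueness rests on a rigidity fact: the heights $L_a$ determine the first gaps, since
    $g_b$ is the least solution of a monotone equation once the earlier gaps are known.
    Lexicographic maximality comes from dominance: after $j$ strips no column is higher than $j$, so
    the first $j$ sizes add up to at most the first $j$ rows. The Pieri rule is used through its
    triangularity: apart from $s_{(l,\mu)}$, every term of $h_l s_\mu$ has a first row longer than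
    $l$. Writing $k=K+1$ makes ['Z_K.+2] a nontrivial ring for every [K]; for $K=0$ the two residues
    are neighbours on both sides and satisfy no braid relation, a case treated apart. *)

(* A state lists the first gaps [c r] of a bead set by residue class.  Neither
   [c r = r] mod [k+1] nor the charge matters for the nil-Coxeter relations. *)
Definition state (K : nat) := {ffun 'Z_K.+2 -> int}.

Section Action.
Variable K : nat.
Implicit Types (i j r : 'Z_K.+2) (c d : state K) (w : seq 'Z_K.+2).

(** The simple reflection of index [i]: a shift by one carries class [i - 1] to class [i], and the
    two first gaps are exchanged up to this shift. *)
Definition swap i c : state K :=
  [ffun r => if r == i then c (i - 1) + 1
             else if r == i - 1 then c i - 1 else c r].

(** If each [c r] lies in class [r], an addable box of residue [i] is a bead of class [i - 1]
    followed by a gap of class [i]; one exists exactly when [c i < c (i - 1)]. [None] stands for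
    zero. *)
Definition act i c : option (state K) :=
  if c i < c (i - 1) then Some (swap i c) else None.

Definition actw w c : option (state K) := foldr (fun i => obind (act i)) (Some c) w.

Lemma actw_cat w1 w2 c : actw (w1 ++ w2) c = obind (actw w1) (actw w2 c).
Proof.
rewrite /actw foldr_cat; case: (foldr _ (Some c) w2) => [d|] //=.
by elim: w1 => //= i w1 ->.
Qed.

Lemma Zp_subr1 i : (i - 1 == i) = false.
Proof. by rewrite -subr_eq0 addrAC subrr sub0r oppr_eq0 oner_eq0. Qed.

Lemma Zp_addr1 i : (i + 1 == i) = false.
Proof. by rewrite -subr_eq0 addrAC subrr add0r oner_eq0. Qed.

Lemma swapl i c : swap i c i = c (i - 1) + 1.
Proof. by rewrite ffunE eqxx. Qed.
Lemma swapr i c : swap i c (i - 1) = c i - 1.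
Proof. by rewrite ffunE Zp_subr1 eqxx. Qed.
Lemma swapo i c r : r != i -> r != i - 1 -> swap i c r = c r.
Proof. by rewrite ffunE => /negbTE -> /negbTE ->. Qed.

Lemma swapK i : involutive (swap i).
Proof.
move=> c; apply/ffunP => r; rewrite [LHS]ffunE swapl swapr subrK addrK.
case: eqP => [->|/eqP ri] //; case: eqP => [->|/eqP ri1] //.
by rewrite swapo.
Qed.

Lemma act_sq i c : obind (act i) (act i c) = None.
Proof.
rewrite /act; case: ifP => //= lt; rewrite swapl swapr.
by case: ifP => // lt2; exfalso; lia.
Qed.

Lemma act_comm i j c : j \notin [:: i - 1; i; i + 1] ->
  obind (act i) (act j c) = obind (act j) (act i c).
Proof.
rewrite !inE !negb_or => /and3P[ji1 ji ji2].
have ij1 : i - 1 != j by rewrite eq_sym.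
have ij : i != j by rewrite eq_sym.
have ij2 : i != j - 1 by rewrite eq_sym subr_eq.
have ij3 : i - 1 != j - 1 by rewrite (inj_eq (addIr _)).
have ji4 : j - 1 != i by rewrite eq_sym.
have ji3 : j - 1 != i - 1 by rewrite eq_sym.
rewrite /act; case: ifP => lj; case: ifP => li //=; rewrite ?swapo // ?lj ?li //.
congr Some; apply/ffunP => r; rewrite !ffunE.
rewrite !(negbTE ij1, negbTE ij, negbTE ij2, negbTE ij3).
rewrite !(negbTE ji1, negbTE ji, negbTE ji3, negbTE ji4).
case: eqP => [->|_]; first by rewrite (negbTE ij) (negbTE ij2).
case: eqP => [->|_]; first by rewrite (negbTE ij1) (negbTE ij3).
by [].
Qed.

(** Both sides are defined exactly when the values at [i + 1], [i], [i - 1] increase in this order,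
    and then both reverse them up to shifts by 2. The hypothesis keeps the three classes
    distinct. *)
Lemma act_braid i c : (1 <= K)%N ->
  actw [:: i; i + 1; i] c = actw [:: i + 1; i; i + 1] c.
Proof.
move=> K1.
have two : (2%:R : 'Z_K.+2) != 0.
  apply/eqP => /(congr1 (@nat_of_ord _)).
  by rewrite (@val_natZ K.+1 2).
have e1 : (i + 1 == i) = false by rewrite Zp_addr1.
have e2 : (i + 1 == i - 1) = false.
  by apply/negbTE; rewrite -subr_eq0 opprB addrA addrAC (addrC i) addrK.
have e3 : (i - 1 == i) = false by rewrite Zp_subr1.
have e4 : (i == i - 1) = false by rewrite eq_sym.
have e5 : (i == i + 1) = false by rewrite eq_sym.
have e6 : (i - 1 == i + 1) = false by rewrite eq_sym.
rewrite /= /act addrK.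
set u := c (i - 1); set v := c i; set z := c (i + 1).
case: (ltP v u) => vu /=; case: (ltP z v) => zv /=;
  rewrite ?ffunE ?addrK ?(eqxx, e1,e2,e3,e4,e5,e6) -/u -/v -/z.
- have -> : z < u + 1 by lia.
  have -> : z - 1 < u by lia.
  rewrite /= ?ffunE ?addrK ?(eqxx, e1,e2,e3,e4,e5,e6) -/u -/v -/z.
  have -> : z - 1 < v - 1 by lia.
  have -> : v + 1 < u + 1 by lia.
  congr Some; apply/ffunP => r; rewrite ?ffunE ?addrK ?(eqxx, e1,e2,e3,e4,e5,e6) -/u -/v -/z.
  case: (r =P i) => [->|_]; first by rewrite ?e5 ?e4; lia.
  case: (r =P i - 1) => [->|_]; first by rewrite ?e6; lia.
  by case: (r =P i + 1) => [_|_]; lia.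
- case: ifP => //= lt; rewrite ?ffunE ?addrK ?(eqxx, e1,e2,e3,e4,e5,e6) -/u -/v -/z.
  by case: ifP => // lt2; exfalso; lia.
- case: ifP => //= lt; rewrite ?ffunE ?addrK ?(eqxx, e1,e2,e3,e4,e5,e6) -/u -/v -/z.
  by case: ifP => // lt2; exfalso; lia.
- by [].
Qed.

End Action.

(** * Functionals on the algebra induced by the action *)

Section Evaluation.
Variables (K : nat) (R : comNzRingType).
Local Notation falg := (free_alg K.+1 R).
Local Notation malg := {malg R[{fmonom 'Z_K.+2}]}.
Implicit Types (F : state K -> R) (c d : state K).

(** The transposed action, on functions of states, so that no formal sums of states are formed. *)
Definition pull (w : seq 'Z_K.+2) F c : R := oapp F 0 (actw w c).

(* The coefficient functional [F] applied to the action of [x] on [c]. *)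
Definition ev_free F c (x : malg) : R :=
  mmap idfun (fun m : {fmonom 'Z_K.+2} => pull m F c) x.

Lemma ev_freeB F c x y : ev_free F c (x - y) = ev_free F c x - ev_free F c y.
Proof. exact: (mmapB (f := idfun)). Qed.

Lemma ev_free0 F c : ev_free F c 0 = 0.
Proof. exact: (mmap0 (f := idfun)). Qed.

Lemma ev_freeD F c x y : ev_free F c (x + y) = ev_free F c x + ev_free F c y.
Proof. exact: (mmapD (f := idfun)). Qed.

Lemma ev_free_sum F c (I : Type) (s : seq I) (G : I -> malg) :
  ev_free F c (\sum_(i <- s) G i) = \sum_(i <- s) ev_free F c (G i).
Proof.
by elim: s => [|i s IH]; rewrite ?big_nil ?ev_free0 // !big_cons ev_freeD IH.
Qed.

Lemma ev_freeU F c a m : ev_free F c << a *g m >> = a * pull m F c.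
Proof. exact: (mmapU (f := idfun)). Qed.

Lemma ev_freeZ F c a x : ev_free F c (a *: x) = a * ev_free F c x.
Proof.
rewrite /ev_free (mmapEw (f := idfun) (msuppZ_le a x)) mmapE mulr_sumr.
by apply: eq_bigr => m _; rewrite mcoeffZ /= mulrA.
Qed.

Lemma pullM (m m' : {fmonom 'Z_K.+2}) F c :
  pull (mmul m m') F c = pull m' (pull m F) c.
Proof.
rewrite /pull; have -> : (mmul m m') = m ++ m' :> seq _ by rewrite /mmul /= /fmmul fmE.
by rewrite actw_cat; case: (actw m' c).
Qed.

Lemma malgUM a b (m m' : {fmonom 'Z_K.+2}) :
  << a *g m >> * << b *g m' >> = << a * b *g (mmul m m') >> :> malg.
Proof. by rewrite malgM_def fgmulUU. Qed.

Lemma ev_freeUM F c a m x :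
  ev_free F c (<< a *g m >> * x) = a * ev_free (pull m F) c x.
Proof.
rewrite (monalgE x) mulr_sumr !ev_free_sum mulr_sumr; apply: eq_bigr => m' _.
by rewrite malgUM !ev_freeU pullM mulrA.
Qed.

Lemma ev_freeMU F c a m x :
  ev_free F c (x * << a *g m >>)
  = a * oapp (fun d => ev_free F d x) 0 (actw m c).
Proof.
rewrite (monalgE x) mulr_suml.
rewrite !ev_free_sum.
transitivity (a * \sum_(m' <- msupp x) oapp (fun d => ev_free F d << x@_m' *g m' >>) 0 (actw m c)).
  rewrite mulr_sumr; apply: eq_bigr => m' _.
  rewrite malgUM ev_freeU pullM {1}/pull.
  by case: (actw m c) => [d|] /=; rewrite ?mulr0 // ev_freeU mulrCA mulrA.
congr (_ * _); case: (actw m c) => [d|] /=; last by rewrite big1.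
by rewrite ev_free_sum.
Qed.

Definition ev_null (x : falg) : Prop := forall F c, ev_free F c x = 0.

(** A left factor is absorbed by changing the functional and a right factor by changing the state;
    hence the quantification over both in [ev_null]. *)
Lemma ev_null_ideal : is_ideal ev_null.
Proof.
split=> [F c|x y x0 y0 F c|a x b x0 F c].
- exact: ev_free0.
- by rewrite ev_freeB x0 y0 subrr.
rewrite [a * x * b]free_mulE [a * x]free_mulE (monalgE b) mulr_sumr ev_free_sum.
rewrite big1_seq // => m _; rewrite ev_freeMU.
case: (actw m c) => [d|] /=; rewrite ?mulr0 //.
rewrite (monalgE a) mulr_suml ev_free_sum big1_seq ?mulr0 // => m' _.
by rewrite ev_freeUM x0 mulr0.
Qed.

Lemma free_gen_word (w : seq 'Z_K.+2) :
  \prod_(i <- w) free_gen R (k := K.+1) i = << 1 *g FMonom w >> :> malg.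
Proof.
elim: w => [|i w IH]; first by rewrite big_nil -fmoneE.
rewrite big_cons [LHS]free_mulE IH /free_gen malgUM mul1r.
by congr (<< _ *g _ >>); apply/eqP; rewrite fmP /mmul /= /fmmul !fmE /= fmuE.
Qed.

Lemma ev_free_word F c (w : seq 'Z_K.+2) :
  ev_free F c (\prod_(i <- w) free_gen R (k := K.+1) i) = pull w F c.
Proof. by rewrite free_gen_word ev_freeU mul1r. Qed.

Lemma ev_rel x : nilcox_rel x -> ev_null x.
Proof.
have w2 i j : free_gen R (k := K.+1) i * free_gen R j = \prod_(l <- [:: i; j]) free_gen R l.
  by rewrite !big_cons big_nil mulr1.
have w3 i j l : free_gen R (k := K.+1) i * free_gen R j * free_gen R l
    = \prod_(l <- [:: i; j; l]) free_gen R l.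
  by rewrite !big_cons big_nil mulr1 mulrA.
case=> [i|i j ij|i K1] F c.
- by rewrite w2 ev_free_word /pull /= act_sq.
- by rewrite !w2 ev_freeB !ev_free_word /pull /= act_comm // subrr.
- by rewrite !w3 ev_freeB !ev_free_word /pull act_braid // subrr.
Qed.

Lemma nilcox_ideal_null x : nilcox_ideal x -> ev_null x.
Proof. by apply; [exact: ev_null_ideal|exact: ev_rel]. Qed.

Local Notation nilcox := (nilcox K.+1 R).
Definition ev F c (x : nilcox) : R := ev_free F c (nilcox_rep x).

Lemma ev_pi F c x : ev F c (nilcox_pi x) = ev_free F c x.
Proof.
apply/eqP; rewrite -subr_eq0 -ev_freeB; apply/eqP.
by apply: nilcox_ideal_null; apply: nilcox_rep_pi.
Qed.

Lemma ev0 F c : ev F c 0 = 0.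
Proof. by rewrite [0]/(nilcox_pi 0) ev_pi ev_free0. Qed.

Lemma evD F c x y : ev F c (x + y) = ev F c x + ev F c y.
Proof.
elim/nilcox_ind: x => x; elim/nilcox_ind: y => y.
by rewrite [nilcox_pi x + _]nilcox_add_pi !ev_pi ev_freeD.
Qed.

Lemma evZ F c a x : ev F c (a *: x) = a * ev F c x.
Proof.
elim/nilcox_ind: x => x.
by rewrite [a *: _]nilcox_scale_pi !ev_pi ev_freeZ.
Qed.

Lemma ev_sum F c (I : Type) (s : seq I) (P : pred I) (G : I -> nilcox) :
  ev F c (\sum_(i <- s | P i) G i) = \sum_(i <- s | P i) ev F c (G i).
Proof. exact: (big_morph (ev F c) (evD F c) (ev0 F c)). Qed.

Lemma mono_pi w : mono R w = nilcox_pi (\prod_(i <- w) free_gen R (k := K.+1) i).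
Proof.
rewrite /mono; elim: w => [|i w IH]; first by rewrite !big_nil.
by rewrite !big_cons IH [LHS]nilcox_mul_pi.
Qed.

Lemma ev_mono F c w : ev F c (mono R w) = pull w F c.
Proof. by rewrite mono_pi ev_pi ev_free_word. Qed.

Lemma ev_monoM F c w x : ev F c (mono R w * x) = ev (pull w F) c x.
Proof.
rewrite mono_pi; elim/nilcox_ind: x => x.
rewrite [_ * _]nilcox_mul_pi !ev_pi.
by rewrite -[ev_free F c _]/(ev_free F c (free_mul _ _)) free_mulE free_gen_word
  ev_freeUM mul1r.
Qed.

Lemma mono_cat w1 w2 : mono R (w1 ++ w2) = mono R w1 * mono R w2 :> nilcox.
Proof. by rewrite /mono big_cat. Qed.

Lemma mono_cons i w : mono R (i :: w) = gen R i * mono R w :> nilcox.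
Proof. by rewrite /mono big_cons. Qed.

Lemma mono_flatten (T : Type) (f : T -> seq 'Z_K.+2) s :
  \prod_(A <- s) mono R (f A) = mono R (flatten [seq f A | A <- s]) :> nilcox.
Proof.
elim: s => [|A s IH]; first by rewrite big_nil /mono big_nil.
by rewrite big_cons IH /= mono_cat.
Qed.

(** Tested on indicator functions of the two results; [1 != 0] in [R] tells a defined result from an
    undefined one. *)
Lemma mono_actw w w' c : mono R w = mono R w' :> nilcox -> actw w c = actw w' c.
Proof.
move=> e.
have H F : pull w F c = pull w' F c by rewrite -!ev_mono e.
move: (H (fun d => (Some d == actw w c)%:R)) (H (fun d => (Some d == actw w' c)%:R)).
rewrite /pull; case: (actw w c) => [d|]; case: (actw w' c) => [d'|] //=; rewrite !eqxx.
- by case: eqP => [->|_] // /eqP; rewrite oner_eq0.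
- by move/eqP; rewrite oner_eq0.
- by move=> _ /eqP; rewrite eq_sym oner_eq0.
Qed.

End Evaluation.

(** * First gaps in increasing order *)

Section Floor.
Variable n : nat.
Hypothesis n0 : (0 < n)%N.
Implicit Types x y : int.

Lemma floor_succ x :
  ((x + 1) %/ n%:Z)%Z = (x %/ n%:Z)%Z + (n%:Z %| x + 1)%Z%:Z.
Proof.
have n0' : n%:Z != 0 by rewrite eqz_nat -lt0n.
have r0 := modz_ge0 x n0'; have rn := ltz_mod x n0'.
case: (boolP (n%:Z %| x + 1)%Z) => [/dvdzP[q e]|nd] /=.
  rewrite e mulzK //; have -> : x = (q - 1) * n%:Z + (n%:Z - 1) by lia.
  rewrite divzMDl // divz_small ?addr0 ?subrK //; lia.
rewrite addr0 {1}(divz_eq x n%:Z) -addrA divzMDl // [X in _ + X]divz_small ?addr0 //.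
apply/andP; split; first lia.
have := rn; rewrite gtz0_abs ?ltz_nat // => rn'.
rewrite lt_neqAle; apply/andP; split; last by lia.
apply: contra nd => /eqP e; apply/dvdzP; exists ((x %/ n)%Z + 1).
by rewrite {1}(divz_eq x n%:Z); lia.
Qed.

Lemma floor_mono x y : x <= y -> ((x %/ n%:Z) <= (y %/ n%:Z))%Z.
Proof.
move=> xy; have n0' : n%:Z != 0 by rewrite eqz_nat -lt0n.
have n0p : 0 < n%:Z by rewrite ltz_nat.
by rewrite lez_divRL //; apply: le_trans xy; rewrite lez_floor.
Qed.
End Floor.

Definition res (K : nat) (x : int) : 'Z_K.+2 := x%:~R.
Arguments res {K}.

Section Residues.
Variable K : nat.
Local Notation n := (K.+2)%:Z.
Local Notation res := (@res K).

Lemma val_res x : (nat_of_ord (res x))%:Z = (x %% n)%Z.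
Proof.
rewrite {1}(divz_eq x n) /res.
have [r er] : exists r : nat, (x %% n)%Z = r by exists `|(x %% n)%Z|%N; rewrite gez0_abs ?modz_ge0.
have rn : (r < K.+2)%N by have := ltz_mod x (isT : n != 0); rewrite er; lia.
rewrite intrD intrM er -!pmulrn.
have -> : (K.+2%:R : 'Z_K.+2) = 0 by apply: (@pchar_Zp K.+2).
rewrite mulr0 add0r; congr Posz.
by rewrite (@val_natZ K.+1 r) // -ltnS.
Qed.

Lemma res_eq x y : (res x == res y) = (n %| x - y)%Z.
Proof.
by rewrite -eqz_mod_dvd -val_eqE -eqz_nat !val_res.
Qed.

Lemma resD x y : res (x + y) = res x + res y. Proof. exact: intrD. Qed.
Lemma resB x y : res (x - y) = res x - res y. Proof. exact: intrB. Qed.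
Lemma res1 : res 1 = 1. Proof. by []. Qed.
Lemma resN x : res (- x) = - res x. Proof. by rewrite -sub0r resB sub0r. Qed.
Lemma res_nat (i : nat) : res i%:Z = i%:R. Proof. by []. Qed.
Lemma res_ord (r : 'Z_K.+2) : res (nat_of_ord r)%:Z = r.
Proof. by rewrite res_nat natr_Zp. Qed.

End Residues.

(* The increasing sequence of first gaps of the bead set of a core of charge
   zero; [c] is the same data indexed by residues. *)
Record window (K : nat) (g : 'I_K.+2 -> int) (c : state K) : Prop := Window {
  win_inc : forall a b : 'I_K.+2, (a < b)%N -> g a < g b;
  win_res : forall a, c (res (g a)) = g a;
  win_sum : \sum_a g a = \sum_(a < K.+2) (nat_of_ord a)%:Z }.

Section Windows.
Variable K : nat.
Local Notation n := (K.+2)%:Z.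
Local Notation res := (@res K).
Implicit Types (g : 'I_K.+2 -> int) (c : state K).

(* [Lw g] and [Nw g] are the column heights of the bounded partition and, in
   reverse order, of its k-conjugate. *)
Definition Lw g (a : 'I_K.+2) : int := \sum_(b < K.+2 | (a < b)%N) ((g b - g a) %/ n)%Z.
Definition Nw g (b : 'I_K.+2) : int := \sum_(a < K.+2 | (a < b)%N) ((g b - g a) %/ n)%Z.

Section OneWindow.
Variables (g : 'I_K.+2 -> int) (c : state K).
Hypothesis w : window g c.

Lemma win_inj : injective (fun a => res (g a)).
Proof.
move=> a b /= e; have e' : g a = g b by rewrite -(win_res w) e (win_res w).
have [lt|lt|/val_inj //] := ltngtP a b; have := win_inc w lt; rewrite e' ltxx //.
Qed.

Lemma win_eq a b : (res (g a) == res (g b)) = (a == b).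
Proof. exact: (inj_eq win_inj). Qed.

Lemma win_surj r : exists a, res (g a) = r.
Proof.
have [h _ hK] := injF_bij win_inj.
by exists (h r); rewrite hK.
Qed.

Lemma win_le (a b : 'I_K.+2) : (a <= b)%N -> g a <= g b.
Proof. by rewrite leq_eqVlt => /orP[/eqP/val_inj ->|/(win_inc w)/ltW]. Qed.

Lemma win_ltE (a b : 'I_K.+2) : (g a < g b) = (a < b)%N.
Proof.
case: (ltnP a b) => [/(win_inc w) //|/win_le]; by rewrite leNgt => /negbTE.
Qed.

Lemma win_dvd (a b : 'I_K.+2) : (n %| g b - g a)%Z = (a == b).
Proof. by rewrite -res_eq (inj_eq win_inj) eq_sym. Qed.

(** The numbers [g a - x] represent each class mod [n] once, so their remainders add up to the sum
    of [0, ..., K.+1], which is also the sum of the [g a] by the charge condition. *)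
Lemma sum_floor x : \sum_a ((g a - x) %/ n)%Z = - x.
Proof.
have h : \sum_a ((g a - x) %% n)%Z = \sum_(a < K.+2) (nat_of_ord a)%:Z.
  transitivity (\sum_a (nat_of_ord (res (g a - x)))%:Z).
    by apply: eq_bigr => a _; rewrite val_res.
  rewrite [RHS](reindex_inj (h := fun a => res (g a - x))) //.
  by move=> a b /=; rewrite !resB => /addIr /win_inj.
have e : \sum_a (g a - x) = (\sum_a ((g a - x) %/ n)%Z) * n + \sum_a ((g a - x) %% n)%Z.
  by rewrite mulr_suml -big_split /=; apply: eq_bigr => a _; rewrite -divz_eq.
move: e; rewrite h sumrB (win_sum w) sumr_const card_ord -mulr_natr natz.
set T := \sum_a _; set S := \sum_(a < _) _ => e.
have {e}: - x * n = S * n by move: e; lia.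
by move/(mulIf (isT : n != 0)).
Qed.

Lemma floor_opp x : ~~ (n %| x)%Z -> ((- x) %/ n)%Z = - (x %/ n)%Z - 1.
Proof.
move=> nd; rewrite {1}(divz_eq x n).
have r0 := modz_ge0 x (isT : n != 0); have rn := ltz_mod x (isT : n != 0).
have r1 : (x %% n)%Z != 0 by apply: contra nd => /eqP/dvdz_mod0P.
have -> : - ((x %/ n)%Z * n + (x %% n)%Z) = (- (x %/ n)%Z - 1) * n + (n - (x %% n)%Z).
  by ring.
by rewrite divzMDl // [X in _ + X]divz_small ?addr0 //; lia.
Qed.

(** This is [sum_floor] at [x = g b]. The ranks above [b] contribute [Lw g b]; each of the [b] ranks
    below contributes the floor of the negative of a non-multiple of [n], hence an extra -1. *)
Lemma win_formula b : g b = (nat_of_ord b)%:Z + Nw g b - Lw g b.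
Proof.
have /(congr1 (fun x => - x)) := sum_floor (g b); rewrite opprK => <-.
rewrite (bigID (fun a : 'I_K.+2 => (a < b)%N)) /=.
rewrite [X in _ + X](bigD1 b) /=; last by rewrite -leqNgt.
rewrite subrr div0z add0r.
have -> : \sum_(i < K.+2 | ~~ (i < b)%N && (i != b)) ((g i - g b) %/ n)%Z = Lw g b.
  by apply: eq_bigl => i; rewrite -leqNgt ltn_neqAle andbC eq_sym.
have -> : \sum_(i < K.+2 | (i < b)%N) ((g i - g b) %/ n)%Z = - Nw g b - (nat_of_ord b)%:Z.
  have -> : (nat_of_ord b)%:Z = \sum_(i < K.+2 | (i < b)%N) 1.
    rewrite -(big_ord_widen K.+2 (fun=> 1) (ltnW (ltn_ord b))).
    by rewrite sumr_const card_ord natz.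
  rewrite -sumrN -sumrB; apply: eq_bigr => a ab.
  by rewrite -(opprB (g b)) floor_opp // win_dvd -val_eqE /= ltn_eqF.
lia.
Qed.
End OneWindow.

Lemma sum_pred1 (P : pred 'I_K.+2) b :
  \sum_(a < K.+2 | P a) (a == b)%:Z = (P b)%:Z.
Proof.
rewrite big_mkcond (bigD1 b) //= eqxx big1 ?addr0; first by case: (P b).
by move=> a /negbTE ->; case: ifP.
Qed.

Lemma win_stateE g c c' : window g c -> window g c' -> c = c'.
Proof.
move=> w w'; apply/ffunP => r; have [a <-] := win_surj w r.
by rewrite (win_res w) (win_res w').
Qed.

Lemma window_ext g g' c : g =1 g' -> window g c -> window g' c.
Proof.
move=> e [i r s]; split=> [a b ab|a|]; rewrite -?e; [exact: i|exact: r|].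
by rewrite -s; apply: eq_bigr => a _.
Qed.

Lemma Lw_ext g g' a : g =1 g' -> Lw g a = Lw g' a.
Proof. by move=> e; apply: eq_bigr => b _; rewrite !e. Qed.

Lemma gap_count_step g c (b : 'I_K.+2) x : window g c ->
  \sum_(a < K.+2 | (a < b)%N) ((x + 1 - g a) %/ n)%Z
  = \sum_(a < K.+2 | (a < b)%N) ((x - g a) %/ n)%Z
    + [exists a : 'I_K.+2, (a < b)%N && (res (g a) == res (x + 1))]%:Z.
Proof.
move=> w; have [a0 ea0] := win_surj w (res (x + 1)).
have -> : [exists a : 'I_K.+2, (a < b)%N && (res (g a) == res (x + 1))] = (a0 < b)%N.
  apply/existsP/idP => [[a /andP[ab /eqP]]|ab]; last by exists a0; rewrite ab ea0 eqxx.
  by rewrite -ea0 => /(win_inj w) <-.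
rewrite -(sum_pred1 (fun a : 'I_K.+2 => (a < b)%N)) -big_split /=.
apply: eq_bigr => a ab; rewrite addrAC floor_succ // -addrA (addrC (- _)) addrA.
by rewrite -res_eq -ea0 (inj_eq (win_inj w)) eq_sym.
Qed.

(** The function [phi] takes the value [b - Lw g b] at both [g b] and [g' b]. It never decreases, as
    its sum grows by at most one per step, and its last step up to [g' b] is strict, as no earlier
    first gap is congruent to [g' b]. *)
Lemma window_uniq_lt g g' c c' (b : 'I_K.+2) : window g c -> window g' c' ->
  (forall a, Lw g a = Lw g' a) -> (forall a : 'I_K.+2, (a < b)%N -> g a = g' a) ->
  ~ g b < g' b.
Proof.
move=> w w' eL eg lt.
pose phi (x : int) : int := x - \sum_(a < K.+2 | (a < b)%N) ((x - g a) %/ n)%Z.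
have e1 : phi (g b) = phi (g' b).
  rewrite /phi -/(Nw g b).
  have -> : \sum_(a < K.+2 | (a < b)%N) ((g' b - g a) %/ n)%Z = Nw g' b.
    by apply: eq_bigr => a ab; rewrite eg.
  have := win_formula w b; have := win_formula w' b; rewrite eL; lia.
have step (x : int) : phi (x + 1) = phi x + 1 -
    [exists a : 'I_K.+2, (a < b)%N && (res (g a) == res (x + 1))]%:Z.
  rewrite /phi (gap_count_step _ _ w); ring.
have mono (x : int) : phi x <= phi (x + 1).
  by rewrite step; case: [exists _, _]; rewrite /=; lia.
have monoD (x : int) (m : nat) : phi x <= phi (x + m%:Z).
  elim: m => [|m IH]; first by rewrite addr0.
  by apply: le_trans IH _; rewrite -addn1 PoszD addrA mono.
have last : phi (g' b) = phi (g' b - 1) + 1.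
  rewrite -{1}(subrK 1 (g' b)) step subrK.
  case: existsP => [[a /andP[ab]]|_] /=; last by rewrite subr0.
  by rewrite eg // (inj_eq (win_inj w')) => /eqP ab'; rewrite ab' ltnn in ab.
have := monoD (g b) `|(g' b - 1 - g b)%R|%N.
have -> : g b + `|(g' b - 1 - g b)%R|%N = g' b - 1 by lia.
by lia.
Qed.

Lemma window_uniq g g' c c' : window g c -> window g' c' ->
  (forall a, Lw g a = Lw g' a) -> g =1 g' /\ c = c'.
Proof.
move=> w w' eL.
have e : g =1 g'.
  suff H m (b : 'I_K.+2) : (b < m)%N -> g b = g' b by move=> b; apply: (H b.+1).
  elim: m b => [|m IH] b // bm.
  have eg (a : 'I_K.+2) : (a < b)%N -> g a = g' a.
    by move=> ab; apply: IH; apply: leq_trans ab _.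
  have [lt|lt|//] := ltgtP (g b) (g' b).
    by case: (window_uniq_lt w w' eL eg).
  case: (window_uniq_lt w' w (fun a => esym (eL a)) _ lt) => a ab.
  by rewrite eg.
by split=> //; apply: (win_stateE (window_ext e w) w').
Qed.

(** The order of the first gaps survives the step: ranks [p] and [q] exchange their classes, [p]
    falling and [q] rising by one. Only the difference of this pair passes a multiple of [n], so
    only its floor changes. *)
Lemma act_window g c i c' : window g c -> act i c = Some c' ->
  exists p q : 'I_K.+2, exists g',
    [/\ res (g p) = i /\ res (g q) = i - 1, (p < q)%N, window g' c',
        forall a, g' a = g a + (a == q)%:Z - (a == p)%:Z &
        forall a, Lw g' a = Lw g a + (a == p)%:Z].
Proof.
move=> w; rewrite /act; case: ifP => // lt [<-].
have [p ep] := win_surj w i; have [q eq] := win_surj w (i - 1).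
have cp : c i = g p by rewrite -ep (win_res w).
have cq : c (i - 1) = g q by rewrite -eq (win_res w).
have pq : (p < q)%N by rewrite -(win_ltE w) -cp -cq.
have pq' : p != q by rewrite -val_eqE /= ltn_eqF.
pose g' (a : 'I_K.+2) : int := g a + (a == q)%:Z - (a == p)%:Z.
have dvdP (a b : 'I_K.+2) (e : int) :
    (n %| g b - g a + e)%Z = (res (g b) + res e == res (g a)).
  by rewrite -resD res_eq; have -> : g b - g a + e = g b + e - g a by ring.
have d1 (a b : 'I_K.+2) : (n %| g b - g a + 1)%Z -> (a == p) = (b == q).
  rewrite dvdP res1 => /eqP e.
  rewrite -[LHS](inj_eq (win_inj w)) -[RHS](inj_eq (win_inj w)) /= ep eq.
  by rewrite -[RHS](inj_eq (addIr 1)) subrK e eq_sym.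
have d2 : res (g q) + 1 = res (g p) by rewrite eq ep subrK.
have fl (a b : 'I_K.+2) : (a < b)%N ->
    ((g' b - g' a) %/ n)%Z = ((g b - g a) %/ n)%Z + ((a == p) && (b == q))%:Z
    /\ g' a < g' b.
  move=> ab; have ab0 := win_inc w ab.
  have ab1 : (n %| g b - g a)%Z = false by rewrite (win_dvd w) -val_eqE /= ltn_eqF.
  have s1 := floor_succ (isT : (0 < K.+2)%N) (g b - g a).
  have s0 := floor_succ (isT : (0 < K.+2)%N) (g b - g a - 1).
  have s2 := floor_succ (isT : (0 < K.+2)%N) (g b - g a + 1).
  rewrite subrK ab1 addr0 in s0.
  have aq : a == q -> (a == p) = false /\ (b == p) = false.
    move=> /eqP h; rewrite -!val_eqE /= !gtn_eqF // ?h //.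
    by apply: ltn_trans pq _; rewrite -h.
  have bp : b == p -> (b == q) = false /\ (a == q) = false.
    move=> /eqP h; rewrite -!val_eqE /= !ltn_eqF // ?h //.
    by apply: leq_ltn_trans pq; rewrite ltnW // -h.
  (* These differences shrink. A difference of 1 starting at [q] or ending at [p] would make the
     pair [(q, p)], against [p < q]. *)
  have big : (a == q) || (b == p) -> 1 < g b - g a.
    move=> h; rewrite lt_neqAle; apply/andP; split; last by lia.
    apply/eqP => e1; have e2 : res (g b) = res (g a) + 1.
      by rewrite -res1 -resD; congr res; lia.
    case/orP: h => h.
      case: (aq h) => _; rewrite -(inj_eq (win_inj w)) e2 (eqP h) d2 eqxx //.
    case: (bp h) => _; rewrite -(inj_eq (win_inj w)) -(inj_eq (addIr 1)) -e2 (eqP h) d2 eqxx //.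
  have nd1 : (a == p) != (b == q) -> (n %| g b - g a + 1)%Z = false.
    by move=> h; apply: contraNF h => /d1 ->.
  rewrite /g'; case ap: (a == p); case bq: (b == q).
  - have -> : (a == q) = false by apply: contraTF pq' => /eqP <-; rewrite (eqP ap) negbK.
    have -> : (b == p) = false by apply: contraTF pq' => /eqP <-; rewrite (eqP bq) negbK.
    have e1 : (n %| g b - g a + 1)%Z by rewrite dvdP (eqP ap) (eqP bq) res1 d2.
    have e2 : (n %| g b - g a + 1 + 1)%Z = false.
      by rewrite -addrA dvdP (eqP ap) (eqP bq) resD res1 addrA d2 Zp_addr1.
    rewrite e1 in s1; rewrite e2 in s2; split; last by rewrite /=; lia.
    have -> : g b + true%:Z - false%:Z - (g a + false%:Z - true%:Z) =
          g b - g a + 1 + 1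
        by rewrite /=; ring.
    by rewrite s2 s1 addr0.
  - have e1 := nd1; rewrite ap bq in e1; rewrite e1 // in s1.
    have -> : (a == q) = false by apply: contraTF pq' => /eqP <-; rewrite (eqP ap) negbK.
    have -> : (b == p) = false by move: ab; rewrite (eqP ap) => /gtn_eqF h; rewrite -val_eqE.
    split; last by rewrite /=; lia.
    have -> : g b + false%:Z - false%:Z - (g a + false%:Z - true%:Z) =
          g b - g a + 1
        by rewrite /=; ring.
    by rewrite s1.
  - have e1 := nd1; rewrite ap bq in e1; rewrite e1 // in s1.
    have -> : (a == q) = false by move: ab; rewrite (eqP bq) => /ltn_eqF h; rewrite -val_eqE.
    have -> : (b == p) = false by apply: contraTF pq' => /eqP <-; rewrite (eqP bq) negbK.
    split; last by rewrite /=; lia.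
    have -> : g b + true%:Z - false%:Z - (g a + false%:Z - false%:Z) =
          g b - g a + 1
        by rewrite /=; ring.
    by rewrite s1.
  - case aq': (a == q); case bp': (b == p) => //.
    + by case: (aq aq'); rewrite bp'.
    + have := big; rewrite aq' => /(_ isT) big1; split; last by rewrite /=; lia.
      have -> : g b + false%:Z - false%:Z - (g a + true%:Z - false%:Z) =
          g b - g a - 1
        by rewrite /=; ring.
      by rewrite s0 addr0.
    + have := big; rewrite bp' orbT => /(_ isT) big1; split; last by rewrite /=; lia.
      have -> : g b + false%:Z - true%:Z - (g a + false%:Z - false%:Z) =
          g b - g a - 1
        by rewrite /=; ring.
      by rewrite s0 addr0.
    + have -> : g b + false%:Z - false%:Z - (g a + false%:Z - false%:Z) =
          g b - g a
        by rewrite /=; ring.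
      by split; rewrite /= ?addr0 //; lia.
exists p, q, g'; split=> //.
- split.
  + by move=> a b /fl [].
  + move=> a; rewrite /g'; case: (a =P q) => [->|/eqP aq].
      rewrite (negbTE (_ : q != p)) ?[q == p]eq_sym // subr0.
      by rewrite resD d2 ep swapl cq.
    case: (a =P p) => [->|/eqP ap].
      by rewrite addr0 resB ep swapr cp.
    rewrite subr0 addr0 swapo ?(win_res w) //.
      by rewrite -ep (win_eq w).
    by rewrite -eq (win_eq w).
  + by rewrite sumrB big_split /= !sum_pred1 addrK (win_sum w).
- move=> a; rewrite /Lw.
  have -> : (a == p)%:Z = \sum_(b < K.+2 | (a < b)%N) ((a == p) && (b == q))%:Z.
    case: (a =P p) => [->|_] /=; last by rewrite big1.
    by rewrite sum_pred1 pq.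
  rewrite -big_split /=; apply: eq_bigr => b ab.
  by case: (fl a b ab).
Qed.
End Windows.

(** * The action of [d_A] *)

Section CyclicStrips.
Variable K : nat.
Local Notation res := (@res K).
Local Notation n := (K.+2)%:Z.
Implicit Types (A : {set 'Z_K.+2}) (m r : 'Z_K.+2) (c : state K).

Lemma val_Zp_addr1 (x : 'Z_K.+2) : x != -1 -> nat_of_ord (x + 1) = (nat_of_ord x).+1.
Proof.
move=> x1; have xle : (x <= K.+1)%N by rewrite -ltnS.
have x2 : (x < K.+1)%N.
  rewrite ltn_neqAle xle andbT; apply: contra x1 => /eqP e.
  rewrite -subr_eq0 opprK -[x]natr_Zp e natr1.
  by apply/eqP; apply: (@pchar_Zp K.+2).
by rewrite -{1}[x]natr_Zp natr1 (@val_natZ K.+1).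
Qed.

(** The distance from [m] up to [r]. For [m] outside [A] the letters of [d_A] act in the order of
    increasing [rk m]. *)
Definition rk m r : nat := nat_of_ord (r - m).

Lemma rk_le m r : (rk m r <= K.+1)%N. Proof. by rewrite -ltnS ltn_ord. Qed.

Lemma rkm m : rk m m = 0%N. Proof. by rewrite /rk subrr. Qed.

Lemma rkS m r : r != m -> rk m r = (rk m (r - 1)).+1.
Proof.
move=> rm; rewrite /rk -val_Zp_addr1; first by rewrite -addrA [- m + 1]addrC addrA subrK.
by rewrite -subr_eq0 opprK addrAC subrK subr_eq0.
Qed.

Lemma rk_inj m : injective (rk m).
Proof. by move=> r s e; apply: (addIr (- m)); apply: val_inj. Qed.

Lemma rk_nat m t : (t <= K.+1)%N -> rk m (m + t%:R) = t.
Proof. by move=> tk; rewrite /rk addrAC subrr add0r (@val_natZ K.+1). Qed.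

Lemma rk0 m r : rk m r = 0%N -> r = m.
Proof. by rewrite -{1}(rkm m) => /rk_inj. Qed.

Lemma cyc_ind A m (P : 'Z_K.+2 -> Prop) : m \notin A ->
  (forall r, r \notin A -> P r) -> (forall r, r \in A -> P (r - 1) -> P r) ->
  forall r, P r.
Proof.
move=> mA P0 PS r; move: {2}(rk m r) (erefl (rk m r)) => t.
elim: t r => [|t IH] r er; first by rewrite (rk0 er); apply: P0.
have [rA|/P0 //] := boolP (r \in A).
have rm : r != m by apply: contraNneq mA => <-.
by apply: PS => //; apply: IH; apply: succn_inj; rewrite -er (rkS rm).
Qed.

(** [cyc_desc] hides the choice of its starting residue; as a parameter it can follow [A] under
    negation of residues. *)
Definition cdesc m A : seq 'Z_K.+2 :=
  [seq j <- [seq m - i%:R | i <- iota 1 K.+1] | j \in A].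

Lemma cyc_descE A : A \proper [set: 'Z_K.+2] ->
  exists2 m, m \notin A & cyc_desc (k := K.+1) A = cdesc m A.
Proof.
move=> /properP[_ [m0 _ m0A]]; rewrite /cyc_desc.
by case: pickP => [m mA|/(_ m0)]; [exists m|rewrite m0A].
Qed.

(* [C r] is the first gap of class [r] after the steps of residue up to [r]: a
   first gap of class outside [A] is carried up along the run of [A] above it. *)
Definition is_carry A c (C : 'Z_K.+2 -> int) :=
  forall r, C r = if r \in A then C (r - 1) + 1 else c r.

Lemma carry_exists A m c : m \notin A -> exists C, is_carry A c C.
Proof.
move=> mA.
pose Cn := fix Cn t : int := if t is t'.+1 then
   (if m + t%:R \in A then Cn t' + 1 else c (m + t%:R)) else c m.
exists (fun r => Cn (rk m r)) => r.
have [->|rm] := eqVneq r m; first by rewrite rkm (negbTE mA).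
rewrite (rkS rm) /= -(rkS rm).
by have -> : m + (rk m r)%:R = r by rewrite /rk natr_Zp addrC subrK.
Qed.

Section Run.
Variables (A : {set 'Z_K.+2}) (m : 'Z_K.+2) (mA : m \notin A).

(** The letters among [m + 1, ..., m + t]: the suffix of [cdesc m A] that acts first. *)
Definition pcdesc t : seq 'Z_K.+2 :=
  [seq j <- [seq m - i%:R | i <- iota (K.+2 - t) t] | j \in A].

Lemma pcdescT : pcdesc K.+1 = cdesc m A.
Proof. by rewrite /pcdesc subSnn. Qed.

Lemma pcdescS t : (t < K.+1)%N ->
  pcdesc t.+1 = if m + t.+1%:R \in A then (m + t.+1%:R) :: pcdesc t else pcdesc t.
Proof.
move=> tk; rewrite /pcdesc.
have -> : iota (K.+2 - t.+1) t.+1 = (K.+1 - t)%N :: iota (K.+2 - t) t.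
  by rewrite subSS (subSn (ltnW tk)).
have e : m - (K.+1 - t)%:R = m + t.+1%:R :> 'Z_K.+2.
  congr (_ + _); apply/eqP; rewrite eq_sym -subr_eq0 opprK -natrD addSn subnKC ?(ltnW tk) //.
  by apply/eqP; apply: (@pchar_Zp K.+2).
by rewrite map_cons e.
Qed.

(** The state once the letters up to [m + t] have acted. A class whose successor has acted is left
    at [c (s + 1) - 1], the other classes up to the front hold the carried gap, and those beyond it
    are untouched. *)
Definition run_state C c t : state K :=
  [ffun s => if (rk m s < t)%N && (s + 1 \in A) then c (s + 1) - 1
             else if (rk m s <= t)%N then C s else c s].

Lemma run_state0 C c : is_carry A c C -> run_state C c 0 = c.
Proof.
move=> hC; apply/ffunP => s; rewrite ffunE ltn0 /= leqn0.
by case: eqP => // /rk0 ->; rewrite hC (negbTE mA).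
Qed.

Lemma run_step C c t : is_carry A c C -> (t < K.+1)%N ->
  let r := m + t.+1%:R in
  if r \in A then
    run_state C c t r = c r /\ run_state C c t (r - 1) = C (r - 1)
    /\ run_state C c t.+1 = swap r (run_state C c t)
  else run_state C c t.+1 = run_state C c t.
Proof.
move=> hC tk r.
have er : rk m r = t.+1 by rewrite rk_nat.
have rm : r != m by apply: contra_eq_neq er => ->; rewrite rkm.
have er1 : rk m (r - 1) = t by apply: succn_inj; rewrite -rkS.
have diff s : s != r -> s != r - 1 ->
    run_state C c t.+1 s = run_state C c t s.
  move=> sr sr1; rewrite !ffunE.
  have -> : (rk m s < t.+1)%N = (rk m s < t)%N.
    by rewrite ltnS leq_eqVlt -{1}er1 (inj_eq (@rk_inj m)) (negbTE sr1).
  have -> : (rk m s <= t.+1)%N = (rk m s <= t)%N.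
    by rewrite leq_eqVlt -{1}er (inj_eq (@rk_inj m)) (negbTE sr) ltnS.
  by [].
case: ifP => rA.
  have e1 : run_state C c t r = c r.
    by rewrite ffunE er ltnNge leqnSn /= ltnn.
  have e2 : run_state C c t (r - 1) = C (r - 1).
    by rewrite ffunE er1 ltnn leqnn.
  split=> //; split=> //; apply/ffunP => s.
  have [->|sr] := eqVneq s r.
    by rewrite swapl e2 ffunE er ltnn leqnn /= hC rA.
  have [->|sr1] := eqVneq s (r - 1).
    by rewrite swapr e1 ffunE er1 ltnSn subrK rA.
  by rewrite swapo // diff.
apply/ffunP => s.
have [->|sr] := eqVneq s r.
  by rewrite !ffunE er ltnn leqnn ltnNge leqnSn /= ltnn hC rA.
have [->|sr1] := eqVneq s (r - 1); last exact: diff.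
by rewrite !ffunE er1 ltnn ltnSn leqnn leqnSn subrK rA.
Qed.

Lemma actw_pcdesc C c t : is_carry A c C -> (t <= K.+1)%N ->
  (forall a, a \in A -> (rk m a <= t)%N -> c a < C (a - 1)) ->
  actw (pcdesc t) c = Some (run_state C c t).
Proof.
move=> hC; elim: t => [|t IH] tk cond.
  by rewrite run_state0 // /pcdesc subn0.
have {}IH := IH (ltnW tk) (fun a aA at' => cond a aA (leqW at')).
have := run_step hC tk; rewrite pcdescS //=; case: ifP => rA; last by move=> ->.
move=> [e1 [e2 ->]] /=; rewrite -/(actw _ _) IH /= /act e1 e2.
by rewrite cond // rk_nat.
Qed.

Lemma actw_pcdesc_cond C c t : is_carry A c C -> (t <= K.+1)%N ->
  actw (pcdesc t) c ->
  forall a, a \in A -> (rk m a <= t)%N -> c a < C (a - 1).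
Proof.
move=> hC; elim: t => [|t IH] tk.
  by move=> _ a aA; rewrite leqn0 => /eqP/rk0 am; rewrite am (negbTE mA) in aA.
move=> Hs; have Ht : actw (pcdesc t) c.
  move: Hs; rewrite pcdescS //; case: ifP => //= _.
  by rewrite -/(actw _ _); case: (actw _ c).
have {}IH := IH (ltnW tk) Ht.
move=> a aA; rewrite leq_eqVlt => /orP[/eqP at1|]; last by rewrite ltnS; apply: IH.
have ea : a = m + t.+1%:R by apply: (@rk_inj m); rewrite at1 rk_nat.
have := run_step hC tk; rewrite /= -ea aA => -[e1 [e2 _]].
move: Hs; rewrite pcdescS // -ea aA /= -/(actw _ _) (actw_pcdesc hC (ltnW tk) IH) /=.
by rewrite /act e1 e2; case: ifP.
Qed.

Lemma actw_cdesc C c : is_carry A c C ->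
  (forall a, a \in A -> c a < C (a - 1)) ->
  actw (cdesc m A) c =
  Some [ffun s => if s + 1 \in A then c (s + 1) - 1 else C s].
Proof.
move=> hC cond; rewrite -pcdescT (actw_pcdesc hC) // => [|a aA _]; last exact: cond.
congr Some; apply/ffunP => s; rewrite !ffunE rk_le.
have [sA|] := boolP (s + 1 \in A); rewrite ?andbF // andbT.
rewrite ltn_neqAle rk_le andbT; case: eqP => // e.
have sm : s + 1 != m by apply: contraNneq mA => <-.
by have := rk_le m (s + 1); rewrite (rkS sm) addrK e ltnn.
Qed.

End Run.

(** The third clause says that a climbing gap passes only values in the classes of smaller first
    gaps. It bounds the climb by the next first gap, which is where the vertical strip condition
    comes from. *)
Definition strip A (g g' : 'I_K.+2 -> int) : Prop :=
  [/\ forall a, Lw g' a = Lw g a + (res (g a) \in A)%:Z,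
      forall a, res (g a) \in A -> g' a = g a - 1 &
      forall e, res (g e) \notin A -> exists2 l : nat, g' e = g e + l%:Z &
        forall i, (i < l)%N -> exists2 a : 'I_K.+2, (a < e)%N &
          res (g a) = res (g e + i.+1%:Z)].

(** The clause on gaps beyond the front serves the induction: it identifies the gap that the next
    letter lowers as one of [g] itself. *)
Lemma actw_pcdesc_strip A m g c t c' : m \notin A -> window g c ->
  (t <= K.+1)%N -> actw (pcdesc A m t) c = Some c' ->
  exists g', [/\ window g' c',
      forall a, Lw g' a = Lw g a + ((res (g a) \in A) && (rk m (res (g a)) <= t)%N)%:Z,
      forall a, (t < rk m (res (g a)))%N -> g' a = g a,
      forall a, res (g a) \in A -> (rk m (res (g a)) <= t)%N -> g' a = g a - 1 &
      forall e, res (g e) \notin A -> exists2 l : nat, g' e = g e + l%:Z &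
        forall i, (i < l)%N -> exists2 a : 'I_K.+2, (a < e)%N &
          res (g a) = res (g e + i.+1%:Z)].
Proof.
move=> mA w; elim: t c' => [|t IH] c' tk.
  rewrite /pcdesc subn0 /= => -[<-]; exists g; split=> //.
  - move=> a; case: (boolP (_ \in A)) => /= [aA|_]; last by rewrite addr0.
    rewrite leqn0; case: eqP => [/rk0 am|_]; last by rewrite addr0.
    by rewrite am (negbTE mA) in aA.
  - by move=> a aA; rewrite leqn0 => /eqP/rk0 am; rewrite am (negbTE mA) in aA.
  - by move=> e _; exists 0%N; rewrite ?addr0.
set r := m + t.+1%:R.
have er : rk m r = t.+1 by rewrite rk_nat.
have rm : r != m by apply: contra_eq_neq er => ->; rewrite rkm.
have er1 : rk m (r - 1) = t by apply: succn_inj; rewrite -rkS.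
have rkE s : (rk m s == t.+1) = (s == r) by rewrite -er (inj_eq (@rk_inj m)).
rewrite pcdescS // -/r; case: ifP => rA; last first.
  move=> /(IH _ (ltnW tk)) [g' [w' hL h1 h2 h3]]; exists g'; split=> //.
  - move=> a; rewrite hL; congr (_ + Posz (nat_of_bool _)).
    case: (boolP (_ \in A)) => //= aA; rewrite [in RHS]leq_eqVlt rkE ltnS.
    by case: eqP => // ar; rewrite ar rA in aA.
  - by move=> a /ltnW; apply: h1.
  - move=> a aA; rewrite leq_eqVlt rkE => /orP[/eqP ar|]; last exact: h2.
    by rewrite ar rA in aA.
move=> /=; rewrite -/(actw _ _); case E: (actw _ c) => [d|] //= Ha.
have [g0 [w0 hL h1 h2 h3]] := IH _ (ltnW tk) E.
have [p [q [g' [[ep eq] pq w' hg hL']]]] := act_window w0 Ha.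
have [p0 ep0] := win_surj w r.
have pp : p = p0.
  by apply: (win_inj w0); rewrite /= ep h1 // ep0 er.
subst p0.
have qr a : res (g a) = r - 1 -> ~~ (t < rk m (res (g a)))%N.
  by move=> ->; rewrite er1 ltnn.
exists g'; split=> //.
- move=> a; rewrite hL' hL -addrA; congr (_ + _).
  rewrite -(win_eq w) ep0; case: (boolP (_ \in A)) => aA /=; last first.
    by case: eqP => // ar; rewrite ar rA in aA.
  rewrite [in RHS]leq_eqVlt rkE ltnS; case: (_ =P r) => [ar|_] /=; last by rewrite addr0.
  by rewrite ar er ltnn.
- move=> a at1; rewrite hg h1 1?ltnW //.
  have -> : (a == p) = false.
    by apply: contraTF at1 => /eqP ->; rewrite ep0 er ltnn.
  have -> : (a == q) = false.
    apply: contraTF at1 => /eqP aq; rewrite aq -leqNgt.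
    case: (leqP (rk m (res (g q))) t) => [/leqW //|/h1 e].
    by rewrite -e eq er1 ltnW.
  by rewrite /= subr0 addr0.
- move=> a aA; rewrite leq_eqVlt rkE => /orP[/eqP ar|].
    have -> : a = p by apply: (win_inj w); rewrite /= ar ep0.
    by rewrite hg eqxx (ltn_eqF pq : (p == q) = false) addr0 h1 // ep0 er.
  rewrite ltnS => at1; rewrite hg h2 //.
  have -> : (a == p) = false.
    by apply: contraTF at1 => /eqP ->; rewrite ep0 er ltnn.
  have -> : (a == q) = false; last by rewrite /= subr0 addr0.
  apply/negP => /eqP aq; move: eq; rewrite -aq h2 // resB res1 => /addIr ar.
  by rewrite ar er ltnn in at1.
- move=> e eA; rewrite hg.
  have -> : (e == p) = false.
    by apply: contraNF eA => /eqP ->; rewrite ep0.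
  rewrite subr0; have [l el hl] := h3 e eA.
  case: (e =P q) => [eq'|_]; last by exists l; rewrite ?addr0.
  exists l.+1; first by rewrite el -addrA -PoszD addn1.
  move=> i; rewrite ltnS leq_eqVlt => /orP[/eqP ->|]; last exact: hl.
  exists p; first by rewrite eq'.
  have -> : g e + l.+1%:Z = g0 e + 1 by rewrite el; lia.
  by rewrite resD eq' eq res1 subrK ep0.
Qed.

Lemma actw_cdesc_strip A m g c c' : m \notin A -> window g c ->
  actw (cdesc m A) c = Some c' -> exists2 g', window g' c' & strip A g g'.
Proof.
move=> mA w; rewrite -(pcdescT A m) => /(actw_pcdesc_strip mA w (leqnn _)).
case=> g' [w' hL _ h2 h3]; exists g' => //; split=> //.
  by move=> a; rewrite hL rk_le andbT.
by move=> a aA; apply: h2 => //; apply: rk_le.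
Qed.

End CyclicStrips.

(** * Partitions and the filling by rows *)

Section PartitionFacts.
Local Open Scope nat_scope.
Implicit Types p q : seq nat.

Lemma geq_trans : transitive geq.
Proof. by move=> y x z /= yx zy; exact: leq_trans zy yx. Qed.

Lemma ltn_nth_col p r c : sorted geq p -> (c < nth 0 p r) = (r < col_height p c).
Proof.
elim: p r => [|x p IH] r sp; first by rewrite nth_nil.
have := sp; rewrite /= (path_sortedE geq_trans) => /andP[/allP xp sp'].
rewrite /col_height /=; case: r => [|r] /=.
  case: ltnP => // xc; rewrite add0n; apply/esym/negbTE; rewrite -leqNgt.
  rewrite leqNgt -has_count; apply/hasPn => y yp /=.
  by rewrite -leqNgt; apply: leq_trans xc; apply: xp.
rewrite IH // -/(col_height p c); case: (ltnP c x) => // xc.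
rewrite add0n; have -> : col_height p c = 0; last by [].
apply/eqP; rewrite /col_height -leqn0 leqNgt -has_count; apply/hasPn => y yp.
by rewrite -leqNgt; apply: leq_trans xc; apply: xp.
Qed.

Lemma col_height_mono p c c' : c <= c' -> col_height p c' <= col_height p c.
Proof. by move=> cc; apply: sub_count => r /=; apply: leq_ltn_trans. Qed.

Lemma col_height_le_size p c : col_height p c <= size p.
Proof. exact: count_size. Qed.

Lemma col_height0 p : 0 \notin p -> col_height p 0 = size p.
Proof.
move=> p0; apply/eqP; rewrite -all_count; apply/allP => x xp; rewrite lt0n.
by apply: contraNneq p0 => <-.
Qed.

Lemma is_partition_sorted p : is_partition p -> sorted geq p.
Proof. by case/andP. Qed.

Lemma kbounded_partition k p : kbounded k p -> is_partition p.
Proof. by case/andP. Qed.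

Lemma col_height_inj p q : is_partition p -> is_partition q ->
  (forall c, col_height p c = col_height q c) -> p = q.
Proof.
move=> /andP[sp p0] /andP[sq q0] e; apply: (@eq_from_nth _ 0).
  by rewrite -(col_height0 p0) e col_height0.
move=> r _; apply/eqP; rewrite eqn_leq; apply/andP; split; rewrite leqNgt.
  by rewrite ltn_nth_col // e -ltn_nth_col // ltnn.
by rewrite ltn_nth_col // -e -ltn_nth_col // ltnn.
Qed.

Lemma col_height_ge k p c : kbounded k p -> k <= c -> col_height p c = 0.
Proof.
case/andP=> _ /allP pk kc; apply/eqP; rewrite -leqn0 leqNgt -has_count.
by apply/hasPn => y /pk yk; rewrite -leqNgt; apply: leq_trans kc.
Qed.

Lemma kbounded_col_inj k p q : kbounded k p -> kbounded k q ->
  (forall c, c < k -> col_height p c = col_height q c) -> p = q.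
Proof.
move=> kp kq e; apply: (col_height_inj (kbounded_partition kp) (kbounded_partition kq)).
move=> c; case: (ltnP c k) => [/e //|kc].
by rewrite (col_height_ge kp) // (col_height_ge kq).
Qed.

Lemma sumn_col k p : all (fun r => r <= k) p ->
  sumn p = \sum_(c < k) col_height p c.
Proof.
elim: p => [|x p IH] /=; first by rewrite big1.
case/andP=> xk /IH ->; rewrite /col_height /= big_split /=; congr (_ + _).
rewrite -{1}[x](card_ord x) -sum1_card (big_ord_widen k (fun=> 1)) //.
by rewrite big_mkcond; apply: eq_bigr => i _; case: ltnP.
Qed.

Lemma kbounded_sumn k p : kbounded k p -> sumn p = \sum_(c < k) col_height p c.
Proof. by case/andP => _; apply: sumn_col. Qed.

Lemma count_ltn_iota x m : x <= m -> count (fun r => r < x) (iota 0 m) = x.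
Proof.
move=> xm; rewrite -(subnKC xm) iotaD count_cat add0n.
have -> : count (fun r => r < x) (iota 0 x) = x.
  rewrite -[RHS](size_iota 0 x); apply/eqP; rewrite -all_count; apply/allP => r.
  by rewrite mem_iota.
apply/eqP; rewrite -[X in _ == X]addn0 eqn_add2l -leqn0 leqNgt -has_count.
by apply/hasPn => r; rewrite mem_iota -leqNgt => /andP[].
Qed.

Lemma sorted_mkseq (f : nat -> nat) m : (forall a b, a <= b -> f b <= f a) ->
  sorted geq (mkseq f m).
Proof.
move=> mono; rewrite /mkseq sorted_map; apply: (sub_sorted _ (iota_sorted 0 m)).
by move=> a b /=; apply: mono.
Qed.

Lemma partition_of_cols k (f : nat -> nat) :
  (forall a b, a <= b -> f b <= f a) -> f k = 0 ->
  exists2 p, kbounded k p & forall a, col_height p a = f a.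
Proof.
move=> mono fk; pose q := mkseq f k.
have sq : sorted geq q by apply: sorted_mkseq.
have qE a : nth 0 q a = f a.
  case: (ltnP a k) => ak; first by rewrite nth_mkseq.
  rewrite nth_default ?size_mkseq //; apply/esym/eqP.
  by rewrite -leqn0 -fk mono.
exists (mkseq (col_height q) (f 0)); last first.
  move=> a; rewrite /col_height count_map /=.
  rewrite -[RHS](@count_ltn_iota _ (f 0)) ?mono //.
  by apply: eq_count => r /=; rewrite -ltn_nth_col // qE.
rewrite /kbounded /is_partition sorted_mkseq /=; last exact: col_height_mono.
apply/andP; split; last first.
  apply/allP => _ /mapP[r _ ->]; apply: leq_trans (col_height_le_size _ _) _.
  by rewrite size_mkseq.
apply/mapP => -[r]; rewrite mem_iota add0n /= => r0 e.
by move: r0; rewrite -qE ltn_nth_col // -e.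
Qed.

Lemma col_height_rcons p m c : col_height (rcons p m) c = col_height p c + (c < m).
Proof. by rewrite /col_height -cats1 count_cat /= addn0. Qed.

Lemma kbounded_rcons k p m : kbounded k (rcons p m) ->
  [/\ kbounded k p, 0 < m <= k & forall r, r \in p -> m <= r].
Proof.
rewrite /kbounded /is_partition mem_rcons inE negb_or all_rcons.
case/andP => /andP[sp /andP[m0 p0]] /andP[mk pk].
have sp' : sorted geq p.
  by apply: (subseq_sorted geq_trans _ sp); rewrite -cats1 prefix_subseq.
split; first by rewrite sp' p0.
  by rewrite lt0n eq_sym m0.
move=> r rp; move: sp; rewrite -rev_sorted rev_rcons /=.
rewrite path_sortedE => [/andP[/allP h _]|]; first by apply: h; rewrite mem_rev.
by move=> y x z /=; apply: leq_trans.
Qed.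

End PartitionFacts.

(** * The core of a bounded partition, built row by row *)

Section Canonical.
Variable K : nat.
Local Notation res := (@res K).
Local Notation n := (K.+2)%:Z.
Implicit Types (A : {set 'Z_K.+2}) (m r : 'Z_K.+2) (c : state K).

Lemma Lw_ge0 (g : 'I_K.+2 -> int) c a : window g c -> 0 <= Lw g a.
Proof.
move=> w; apply: sumr_ge0 => b ab; rewrite divz_ge0 // subr_ge0.
by rewrite ltW // (win_inc w).
Qed.

Lemma Nw_ge0 (g : 'I_K.+2 -> int) c a : window g c -> 0 <= Nw g a.
Proof.
move=> w; apply: sumr_ge0 => b ab; rewrite divz_ge0 // subr_ge0.
by rewrite ltW // (win_inc w).
Qed.

Lemma Lw_mono (g : 'I_K.+2 -> int) c (a b : 'I_K.+2) : window g c -> (a <= b)%N -> Lw g b <= Lw g a.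
Proof.
move=> w ab; rewrite /Lw (bigID (fun i : 'I_K.+2 => (b < i)%N) (fun i : 'I_K.+2 => (a < i)%N)) /=.
rewrite -[X in X <= _]addr0 lerD //; last first.
  apply: sumr_ge0 => i /andP[ai _]; rewrite divz_ge0 // subr_ge0.
  by rewrite ltW // (win_inc w).
rewrite [X in _ <= X](eq_bigl (fun i : 'I_K.+2 => (b < i)%N)); last first.
  move=> i; case: (ltnP b i) => bi; rewrite ?andbF // andbT.
  by apply: leq_ltn_trans bi.
by apply: ler_sum => i bi; apply: floor_mono => //; rewrite lerB // (win_le w).
Qed.

Lemma Lw_max (g : 'I_K.+2 -> int) : Lw g ord_max = 0.
Proof. by rewrite /Lw big_pred0 // => b; rewrite ltnNge -ltnS ltn_ord. Qed.

Lemma window_shape (g : 'I_K.+2 -> int) c : window g c ->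
  exists2 lam, kbounded K.+1 lam & forall a : 'I_K.+2, Lw g a = (col_height lam a)%:Z.
Proof.
move=> w; pose f (a : nat) := if (a < K.+1)%N then `|Lw g (inord a)|%N else 0%N.
case: (@partition_of_cols K.+1 f) => [a b ab||lam kl e].
- rewrite /f; case: (ltnP b K.+1) => // bk; rewrite (leq_ltn_trans ab bk).
  have := Lw_mono (a := inord a) (b := inord b) w.
  rewrite !inordK ?ltnS ?(ltnW bk) ?(ltnW (leq_ltn_trans ab bk)) // => /(_ ab).
  have := Lw_ge0 (inord b) w; have := Lw_ge0 (inord a) w; lia.
- by rewrite /f ltnn.
exists lam => // a; rewrite e /f.
case: ltnP => ak; first by rewrite inord_val gez0_abs // (Lw_ge0 _ w).
have -> : a = ord_max; last by rewrite Lw_max.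
by apply: val_inj; apply/eqP; rewrite eqn_leq ak -ltnS ltn_ord.
Qed.

Definition vac : state K := [ffun r => (nat_of_ord r)%:Z].

Lemma vac_window : window (fun a => (nat_of_ord a)%:Z) vac.
Proof. by split=> // a; rewrite ffunE res_ord. Qed.

Lemma vac_Lw a : Lw (fun a : 'I_K.+2 => (nat_of_ord a)%:Z) a = 0.
Proof.
rewrite /Lw big1 // => b ab; rewrite divz_small //.
by have := ltn_ord b; lia.
Qed.

(* The residues of the row of length [l] lying [j] rows above the bottom. *)
Definition row_res (l j : nat) : {set 'Z_K.+2} :=
  [set r : 'Z_K.+2 | (nat_of_ord (r + j%:R)%R < l)%N].

Definition row_sets (lam : seq nat) := mkseq (fun j => row_res (nth 0%N lam j) j) (size lam).

Lemma row_sets_rcons lam l : row_sets (rcons lam l) = rcons (row_sets lam) (row_res l (size lam)).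
Proof.
rewrite /row_sets size_rcons mkseqS nth_rcons ltnn eqxx; congr rcons.
apply/eq_in_map => j; rewrite mem_iota add0n => /andP[_ js].
by rewrite nth_rcons js.
Qed.

Definition wordd (As : seq {set 'Z_K.+2}) : seq 'Z_K.+2 :=
  flatten [seq cyc_desc (k := K.+1) A | A <- rev As].

Lemma wordd_rcons As A : wordd (rcons As A) = cyc_desc (k := K.+1) A ++ wordd As.
Proof. by rewrite /wordd rev_rcons. Qed.

(** The gaps of classes outside [A] start at [g l] or above and carrying only raises them, so each
    letter finds the carried gap above its own. *)
Lemma actw_add_row A m g c (l : 'I_K.+2) : window g c -> m \notin A ->
  (forall a, (res (g a) \in A) = (a < l)%N) -> actw (cdesc m A) c <> None.
Proof.
move=> w mA hA; have [C hC] := carry_exists c mA.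
rewrite (actw_cdesc mA hC) // => r rA.
have hr s : g l <= C s.
  apply: (cyc_ind mA (P := fun s => g l <= C s)) => {}s sA.
    rewrite hC (negbTE sA); have [a ea] := win_surj w s.
    by rewrite -ea (win_res w) (win_le w) // leqNgt -hA ea.
  by move=> h; rewrite hC sA; apply: le_trans h _; rewrite lerDl.
have [a ea] := win_surj w r; rewrite -ea (win_res w); apply: lt_le_trans (hr _).
by rewrite (win_ltE w) -hA ea.
Qed.

Lemma sub_properT A m : m \notin A -> A \proper [set: 'Z_K.+2].
Proof. by move=> mA; apply/properP; split; [apply: finset.subsetT|exists m]. Qed.

(** Each row longer than [a] has lowered the first gap of rank [a] by one. So the ranks below [l]
    have the residues [a - size lam], which fill the next row. *)
Lemma row_res_window (g : 'I_K.+2 -> int) c (lam : seq nat) (l : nat) :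
  window g c -> (l <= K.+1)%N ->
  (forall a : 'I_K.+2, (forall x, x \in lam -> (a < x)%N) ->
    g a = (nat_of_ord a)%:Z - (size lam)%:Z) ->
  (forall x, x \in lam -> (l <= x)%N) ->
  forall a, (res (g a) \in row_res l (size lam)) = (a < l)%N.
Proof.
move=> w lk hg hl a; rewrite inE; case: (ltnP a l) => al.
  rewrite hg; last by move=> r /hl; apply: leq_trans.
  by rewrite resB res_nat res_nat subrK natr_Zp.
apply: contraTF al => h; rewrite -ltnNge.
set b := res (g a) + (size lam)%:R in h.
have -> : a = b; last by [].
apply: (win_inj w) => /=; rewrite (hg b).
  by rewrite resB res_nat res_nat natr_Zp addrK.
by move=> r /hl; apply: leq_trans.
Qed.

Lemma row_sets_spec lam : kbounded K.+1 lam -> exists g c,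
  [/\ window g c, actw (wordd (row_sets lam)) vac = Some c,
      forall a : 'I_K.+2, Lw g a = (col_height lam a)%:Z &
      forall a : 'I_K.+2, (forall x, x \in lam -> (a < x)%N) ->
        g a = (nat_of_ord a)%:Z - (size lam)%:Z].
Proof.
elim/last_ind: lam => [_|lam l IH].
  exists (fun a => (nat_of_ord a)%:Z), vac; split=> //.
  - exact: vac_window.
  - exact: vac_Lw.
  - by move=> a _; rewrite subr0.
case/kbounded_rcons => kl /andP[l0 lk] hl.
have [g [c [w Hc hL hg]]] := IH kl.
have lk' : (l < K.+2)%N by rewrite ltnS.
have hA := row_res_window w lk hg hl.
have mA : res (g (Ordinal lk')) \notin row_res l (size lam) by rewrite hA ltnn.
have [m mA' em] := cyc_descE (sub_properT mA).
have := actw_add_row (l := Ordinal lk') w mA' hA.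
case E: (actw _ c) => [c'|] // _.
have [g' w' [hL' h1 _]] := actw_cdesc_strip mA' w E.
exists g', c'; split=> //.
- by rewrite row_sets_rcons wordd_rcons actw_cat Hc /= em.
- by move=> a; rewrite hL' hL col_height_rcons hA PoszD.
- move=> a ha; have al : (a < l)%N by apply: ha; rewrite mem_rcons mem_head.
  rewrite h1 ?hA // hg ?size_rcons; first by lia.
  by move=> r rl; apply: ha; rewrite mem_rcons inE rl orbT.
Qed.

Definition core_state lam : option (state K) := actw (wordd (row_sets lam)) vac.

Lemma core_state_window lam : kbounded K.+1 lam -> exists g c,
  [/\ core_state lam = Some c, window g c &
      forall a : 'I_K.+2, Lw g a = (col_height lam a)%:Z].
Proof. by case/row_sets_spec => g [c [w e hL _]]; exists g, c. Qed.

Lemma core_stateP lam g c : kbounded K.+1 lam -> window g c ->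
  (forall a : 'I_K.+2, Lw g a = (col_height lam a)%:Z) -> core_state lam = Some c.
Proof.
move=> kl w hL; have [g' [c' [-> w' hL']]] := core_state_window kl.
by congr Some; case: (window_uniq w' w) => // a; rewrite hL hL'.
Qed.

(** The exchange arguments undo letters on states; the filling by rows supplies words that create
    the states so obtained. *)
Lemma window_reach g c : window g c -> exists w, actw w vac = Some c.
Proof.
move=> w; have [lam kl e] := window_shape w.
by exists (wordd (row_sets lam)); apply: (core_stateP kl w e).
Qed.

Lemma actw_window w g c c' : window g c -> actw w c = Some c' ->
  exists2 g', window g' c' &
    (\sum_a Lw g' a = \sum_a Lw g a + (size w)%:Z) /\ forall a, Lw g a <= Lw g' a.
Proof.
elim: w c' => [|i w IH] c' wg /=.
  by case=> <-; exists g => //; split=> //; rewrite addr0.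
rewrite -/(actw _ _); case E: (actw w c) => [d|] //= Ha.
have [g0 w0 [hs hle]] := IH _ wg E.
have [p [q [g' [_ _ w' _ hL]]]] := act_window w0 Ha.
exists g' => //; split; last by move=> a; rewrite hL; apply: le_trans (hle a) _; rewrite lerDl.
rewrite (eq_bigr _ (fun a _ => hL a)) big_split /= hs sum_pred1 /= -addrA -PoszD.
by rewrite addn1.
Qed.

End Canonical.

(** * Monomials and the cores they create *)

Section Uniqueness.
Variable K : nat.
Local Notation res := (@res K).
Local Notation n := (K.+2)%:Z.
Local Notation vac := (vac K).
Implicit Types (i j r : 'Z_K.+2) (c d : state K) (w : seq 'Z_K.+2).

(** The states of cores, described so as to be stable under every [swap], including those that [act]
    does not allow. *)
Definition valid c : Prop :=
  (forall r, res (c r) = r) /\ \sum_r c r = \sum_(a < K.+2) (nat_of_ord a)%:Z.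

Lemma valid_window c : valid c -> exists g, window g c.
Proof.
move=> [hr hs]; pose s := sort <=%R [seq c r | r : 'Z_K.+2].
have ss : size s = K.+2 by rewrite size_sort size_map size_enum_ord.
have ps : perm_eq s [seq c r | r : 'Z_K.+2] by rewrite perm_sort.
have us : uniq s.
  rewrite (perm_uniq ps) map_inj_uniq ?enum_uniq // => r r' e.
  by rewrite -(hr r) e hr.
have srt : sorted <%R s by rewrite lt_sorted_uniq_le us (sort_sorted (@le_total _ _)).
exists (fun a => nth 0 s a); split.
- move=> a b ab; apply: (sorted_ltn_nth lt_trans 0 srt) => //; rewrite inE ss ltn_ord //.
- move=> a; have : nth 0 s a \in s by rewrite mem_nth // ss ltn_ord.
  by rewrite (perm_mem ps) => /mapP[r _ ->]; rewrite hr.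
- transitivity (\sum_(x <- s) x); first by rewrite [RHS](big_nth 0) ss big_mkord.
  by rewrite (perm_big _ ps) big_map big_enum -hs.
Qed.

Lemma window_valid g c : window g c -> valid c.
Proof.
move=> w; split=> [r|].
  by have [a <-] := win_surj w r; rewrite (win_res w).
rewrite -(win_sum w) (reindex_inj (h := fun a => res (g a)) (win_inj w)) /=.
by apply: eq_bigr => a _; rewrite (win_res w).
Qed.

Lemma swap_valid i c : valid c -> valid (swap i c).
Proof.
move=> [hr hs]; split=> [r|].
  have [->|ri] := eqVneq r i; first by rewrite swapl resD res1 hr subrK.
  have [->|ri1] := eqVneq r (i - 1); first by rewrite swapr resB res1 hr.
  by rewrite swapo.
rewrite -hs (bigD1 i) // (bigD1 (i - 1)) ?Zp_subr1 //= swapl swapr.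
rewrite [in RHS](bigD1 i) // [in RHS](bigD1 (i - 1)) ?Zp_subr1 //=.
rewrite (eq_bigr (fun r => c r)); last by move=> r /andP[ri ri1]; rewrite swapo.
by set S := \sum_(r | _) _; ring.
Qed.

Lemma act_inv i c d : act i c = Some d -> c = swap i d /\ d (i - 1) + 2 < d i.
Proof.
rewrite /act; case: ifP => // lt [<-]; rewrite swapK; split=> //.
by rewrite swapl swapr; lia.
Qed.

(** On a valid state the hypothesis says that the core has a removable box of residue [i]. *)
Lemma act_swap i c : c (i - 1) + 2 < c i -> act i (swap i c) = Some c.
Proof.
move=> h; rewrite /act swapK swapl swapr.
by have -> : c (i - 1) + 1 < c i - 1 by lia.
Qed.

Lemma reach_valid w c : actw w vac = Some c -> valid c.
Proof. by case/(actw_window (vac_window K)) => g /window_valid. Qed.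

Lemma valid_reach c : valid c -> exists w, actw w vac = Some c.
Proof. by case/valid_window => g /window_reach. Qed.

Lemma window_state_le g g' c (b : 'I_K.+2) : window g c -> window g' c ->
  (forall a : 'I_K.+2, (a < b)%N -> g a = g' a) -> g' b <= g b.
Proof.
move=> w w' e; have [b' eb] := win_surj w' (res (g b)).
have eb' : g' b' = g b by rewrite -(win_res w') eb (win_res w).
rewrite -eb' (win_le w') // leqNgt; apply/negP => lt.
by move: (e _ lt); rewrite eb' => /eqP; rewrite lt_eqF // (win_inc w).
Qed.

Lemma window_state_uniq g g' c : window g c -> window g' c -> g =1 g'.
Proof.
move=> w w'.
suff H m (b : 'I_K.+2) : (b < m)%N -> g b = g' b by move=> b; apply: (H b.+1).
elim: m b => [|m IH] b // bm.
have eg (a : 'I_K.+2) : (a < b)%N -> g a = g' a.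
  by move=> ab; apply: IH; apply: leq_trans ab _.
apply/eqP; rewrite eq_le (window_state_le w w' eg) andbT.
by apply: (window_state_le w' w) => a /eg.
Qed.

Lemma actw_size w w' c : actw w vac = Some c -> actw w' vac = Some c -> size w = size w'.
Proof.
case/(actw_window (vac_window K)) => g wg [hs _].
case/(actw_window (vac_window K)) => g' wg' [hs' _].
have e a : Lw g a = Lw g' a by apply/Lw_ext/(window_state_uniq wg wg').
move: hs; rewrite (eq_bigr _ (fun a _ => e a)) hs' => /addrI [].
by move=> ->.
Qed.


(** The last alternative is that of two residues only, where [i + 1 = i - 1] and no braid relation
    is available. *)
Lemma neighbors i j : i != j ->
  [\/ j \notin [:: i - 1; i; i + 1],
      [/\ (0 < K)%N, j = i + 1 & j != i - 1],
      [/\ (0 < K)%N, i = j + 1 & i != j - 1] |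
      K = 0%N /\ (j - 1 = i /\ i - 1 = j)].
Proof.
move=> ij.
have e2 : (i + 1 == i - 1) = (K == 0%N).
  rewrite -subr_eq0 opprB addrA addrAC (addrC i) addrK.
  case: K => [|K'] in i j ij *; first by apply/eqP; apply: val_inj.
  apply/negbTE/eqP => /(congr1 (@nat_of_ord _)).
  by rewrite (@val_natZ K'.+2 2).
have [jn|] := boolP (j \notin [:: i - 1; i; i + 1]); first by constructor 1.
rewrite negbK !inE [j == i]eq_sym (negbTE ij) /=.
case: (posnP K) => [K0 h|K0].
  constructor 4; split=> //; have e3 : i + 1 = i - 1 by apply/eqP; rewrite e2 K0.
  by case/orP: h => /eqP ->; rewrite ?addrK ?e3 // -e3 addrK.
have {}e2 : (i + 1 == i - 1) = false by rewrite e2 eqn0Ngt K0.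
case/orP => /eqP ej; [constructor 3|constructor 2]; rewrite ej.
  split=> //; first by rewrite subrK.
  by apply: contraFneq e2 => h; rewrite {1}h subrK.
by split=> //; rewrite e2.
Qed.

End Uniqueness.

(** * Words creating the same core, and 0-dominance *)

Section MonomialsOfStates.
Variables (K : nat) (R : comNzRingType).
Local Notation vac := (vac K).
Local Notation gen := (@gen K.+1 R).
Local Notation mono := (@mono K.+1 R).
Implicit Types (i j r : 'Z_K.+2) (c d : state K) (w : seq 'Z_K.+2).

(** An exchange argument as in Matsumoto's theorem, by induction on the length, which the core
    determines. If the first letters differ, boxes of both residues are removable from the core.
    Undoing the two or three letters of a commutation or braid relation yields a common tail, and
    this relation then links the two words. *)
Lemma mono_uniq w w' c :
  actw w vac = Some c -> actw w' vac = Some c -> mono w = mono w'.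
Proof.
move: {2}(size w) (erefl (size w)) => N; elim: N w w' c => [|N IH] w w' c sw hw hw'.
  have sw' := actw_size hw hw'.
  by rewrite (size0nil sw) (size0nil (etrans (esym sw') sw)).
case: w sw hw => [|i v] // [sv]; case: w' hw' => [|j v'] hw' hw.
  by have := actw_size hw hw'.
have sv' : size v' = N by have [] := actw_size hw hw'; rewrite sv.
move: hw hw'; rewrite /= -!/(actw _ _).
case Hv: (actw v vac) => [d|] //=; case Hv': (actw v' vac) => [d'|] //= hi hj.
have [ed ci] := act_inv hi; have [ed' cj] := act_inv hj.
rewrite !mono_cons; have [eij|ij] := eqVneq i j.
  by subst j; rewrite (IH v v' d) // ed -ed' Hv'.
have vc : valid c by rewrite -(swapK i c) -ed; apply/swap_valid/(reach_valid Hv).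
have braid a b x x' : (0 < K)%N -> b = a + 1 -> b != a - 1 ->
    c (a - 1) + 2 < c a -> c (b - 1) + 2 < c b ->
    actw x vac = Some (swap a c) -> actw x' vac = Some (swap b c) ->
    size x = N -> size x' = N -> gen a * mono x = gen b * mono x'.
  move=> K0 eb ba ha hb hx hx' sx sx'.
  have eb1 : b - 1 = a by rewrite eb addrK.
  have ab : a != b by rewrite eb eq_sym Zp_addr1.
  have aa : (a - 1 == a) = false by rewrite Zp_subr1.
  pose e := swap a (swap b (swap a c)).
  have [t ht] : exists t, actw t vac = Some e by apply/valid_reach; do 3!apply: swap_valid.
  have h1 : act a e = Some (swap b (swap a c)).
    have v1 : swap b (swap a c) (a - 1) = c a - 1.
      by rewrite swapo ?swapr ?eb1 ?aa // eq_sym.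
    have v2 : swap b (swap a c) a = c b - 1.
      by rewrite -{2}eb1 swapr swapo // eq_sym.
    by apply: act_swap; rewrite v1 v2; move: hb; rewrite eb1; lia.
  have h2 : act b (swap b (swap a c)) = Some (swap a c).
    have v3 : swap a c b = c b by rewrite swapo // eq_sym.
    apply: act_swap; rewrite eb1 swapl v3.
    by move: ha hb; rewrite eb1; move: (c _) (c a) (c b) => X Y Z; lia.
  have h3 : act a (swap a c) = Some c by apply: act_swap.
  have ex : actw (b :: a :: t) vac = Some (swap a c).
    by rewrite /= -/(actw _ _) ht /= h1 /= h2.
  have eabac : actw [:: b; a; b] e = Some c.
    by rewrite eb -(act_braid a e) // -eb /= h1 /= h2 /= h3.
  have ex' : actw (a :: b :: t) vac = Some (swap b c).
    rewrite /= -/(actw _ _) ht /=; move: eabac => /=.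
    by case: (act b e) => [f|] //=; case: (act a f) => [f'|] //= /act_inv [-> _].
  rewrite (IH x (b :: a :: t) _ _ hx ex) // (IH x' (a :: b :: t) _ _ hx' ex') //.
  by rewrite !mono_cons !mulrA eb gen_braid.
case: (neighbors ij) => [jn|[K0 ej ji]|[K0 ei ij1]|[_ [ej ei]]].
- have jn' := jn; move: jn'; rewrite !inE !negb_or => /and3P[ji1 ji ji2].
  have ij1 : i != j - 1 by apply: contraNneq ji2 => ->; rewrite subrK.
  pose e := swap j (swap i c).
  have [t ht] : exists t, actw t vac = Some e by apply/valid_reach; do 2!apply: swap_valid.
  have h1 : act j e = Some (swap i c).
    by apply: act_swap; rewrite !swapo // 1?eq_sym // (inj_eq (addIr _)).
  have h2 : act i (swap i c) = Some c by apply: act_swap.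
  have ex : actw (j :: t) vac = Some d by rewrite /= -/(actw _ _) ht /= h1 ed.
  have ex' : actw (i :: t) vac = Some d'.
    rewrite /= -/(actw _ _) ht /=.
    have : obind (act j) (act i e) = Some c by rewrite -act_comm // h1.
    by case: (act i e) => [f|] //= /act_inv [-> _]; rewrite ed'.
  rewrite (IH v (j :: t) _ _ Hv ex) // (IH v' (i :: t) _ _ Hv' ex') //.
  by rewrite !mono_cons !mulrA gen_comm.
- by apply: braid => //; rewrite -?ed -?ed'.
- by apply/esym/braid => //; rewrite -?ed -?ed'.
(* With two residues, removability at both would give [c j + 2 < c i] and [c i + 2 < c j]. *)
- by move: ci cj; rewrite ej ei; lia.
Qed.

Lemma val_vac_pred i : vac i = vac (i - 1) + 1 -> i != 0.
Proof.
apply: contra_eq_neq => ->; rewrite sub0r !ffunE /=.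
by case: (modn _ _) => [|r]; lia.
Qed.

(* A simple reflection fixing the core of [w] moves past [w] and becomes a
   generator that kills the empty core. *)
Lemma mono_fixed w c i : actw w vac = Some c -> c i = c (i - 1) + 1 ->
  exists2 p : 'Z_K.+2, p != 0 & gen i * mono w * gen p = 0.
Proof.
move: {2}(size w) (leqnn (size w)) => N; elim: N w c i => [|N IH] w c i.
  rewrite leqn0 => /eqP/size0nil -> /= [<-] /val_vac_pred i0.
  by exists i => //; rewrite /mono big_nil mulr1 gen_sq.
case: w => [|j v] sw; first by apply: IH.
rewrite /= -/(actw _ _); case Hv: (actw v vac) => [d|] //= hj ci.
have [ed cj] := act_inv hj.
have vd := reach_valid Hv.
have ij : i != j by apply: contraTneq cj => <-; rewrite ci; lia.
(* Here [v] can be rewritten as [i] followed by a shorter [t]. The braid relation turns [i j i t]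
   into [j i j t], and [j] fixes the core created by [t]. *)
have braid : act i (swap i d) = Some d ->
    gen i * gen j * gen i = gen j * gen i * gen j ->
    swap i d j = swap i d (j - 1) + 1 ->
    exists2 p : 'Z_K.+2, p != 0 & gen i * mono (j :: v) * gen p = 0.
  move=> h1 hb h2.
  have [t ht] : exists t, actw t vac = Some (swap i d) by apply/valid_reach/swap_valid.
  have ex : actw (i :: t) vac = Some d by rewrite /= -/(actw _ _) ht.
  have st : size v = (size t).+1 := actw_size Hv ex.
  have [|p p0 hp] := IH t _ j _ ht h2; first by rewrite /= st in sw; apply: ltnW.
  exists p => //; rewrite mono_cons (mono_uniq Hv ex) mono_cons !mulrA hb.
  by move: hp; rewrite -!mulrA => ->; rewrite !mulr0.
case: (neighbors ij) => [jn|[K0 ej ji]|[K0 ei ij1]|[_ [ej ei]]].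
- have jn' := jn; move: jn'; rewrite !inE !negb_or => /and3P[ji1 ji ji2].
  have ij1 : i != j - 1 by apply: contraNneq ji2 => ->; rewrite subrK.
  have [|p p0 hp] := IH v d i sw Hv.
    by rewrite ed !swapo // 1?eq_sym // (inj_eq (addIr _)).
  exists p => //; rewrite mono_cons !mulrA gen_comm // -!(mulrA (gen j)).
  by rewrite hp mulr0.
- have ej1 : j - 1 = i by rewrite ej addrK.
  have d1 : d j = c i + 1 by rewrite ed swapl ej1.
  have d2 : d i = c j - 1 by rewrite ed -ej1 swapr.
  have d3 : d (i - 1) = c (i - 1).
    by rewrite ed swapo ?ej1 ?Zp_subr1 // eq_sym.
  apply: braid.
  + apply: act_swap; rewrite d2 d3; move: ci cj; rewrite ej1.
    by move: (c _) (c i) (c j) => X Y Z; lia.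
  + by rewrite ej gen_braid.
  + have -> : swap i d j = d j by rewrite swapo // eq_sym.
    by rewrite ej1 swapl d1 d3 ci.
- have ei1 : i - 1 = j by rewrite ei addrK.
  have d1 : d j = c (j - 1) + 1 by rewrite ed swapl.
  have d2 : d i = c i by rewrite ed swapo // 1?eq_sym.
  have d3 : d (j - 1) = c j - 1 by rewrite ed swapr.
  apply: braid.
  + apply: act_swap; rewrite ei1 d1 d2; move: ci cj; rewrite ei1.
    by move: (c _) (c i) (c j) => X Y Z; lia.
  + by rewrite ei gen_braid.
  + have -> : swap i d j = c i - 1 by rewrite -ei1 swapr d2.
    have j1 : j - 1 != i by rewrite eq_sym.
    have -> : swap i d (j - 1) = d (j - 1).
      by rewrite swapo // ei1 Zp_subr1.
    by rewrite d3 ci ei1; move: (c j); lia.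
- by move: ci cj; rewrite ej ei; lia.
Qed.

(** A word that kills the empty core fails at some letter [i]. Either [i] fixes the core reached so
    far, and [mono_fixed] provides a nonzero right descent; or [i] is removable from it, so the
    letters already used can be rewritten to begin with [i], and the monomial contains a square. *)
Lemma dominant_word w : mono w != 0 -> dominant0 (mono w) ->
  exists c, actw w vac = Some c.
Proof.
move=> nz dom.
suff H : actw w vac = None -> exists2 p : 'Z_K.+2, p != 0 & mono w * gen p = 0.
  case E: (actw w vac) => [c|]; first by exists c.
  by have [p p0 /dom e] := H E; rewrite e eqxx in p0.
elim: w nz {dom} => [|i w IH]; first by move=> _; discriminate.
rewrite mono_cons => nz.
have nzw : mono w != 0 by apply: contraNneq nz => ->; rewrite mulr0.
rewrite /= -/(actw _ _); case E: (actw w vac) => [c|] /=; last first.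
  by move=> _; have [p p0 hp] := IH nzw E; exists p; rewrite // -mulrA hp mulr0.
rewrite /act; case: ifP => // /negbT; rewrite -leNgt => h _.
have vc := reach_valid E.
have d0 : (K.+2%:Z %| c i - (c (i - 1) + 1))%Z.
  by rewrite -res_eq resD !(proj1 vc) subrK.
case: (c i =P c (i - 1) + 1) => [e|ne]; first exact: mono_fixed E e.
have h2 : c (i - 1) + 2 < c i.
  have /dvdzP[q eq] := d0.
  move: h ne eq; move: (c (i - 1)) (c i) => X Y h ne eq.
  have [q0|q0|q0] := ltgtP q 0; last by case: ne; rewrite q0 mul0r in eq; lia.
    have : q * K.+2%:Z <= - (K.+2%:Z) by rewrite -mulN1r ler_pM2r //; lia.
    by lia.
  have : K.+2%:Z <= q * K.+2%:Z by rewrite ler_peMl //; lia.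
  by lia.
have [t ht] : exists t, actw t vac = Some (swap i c) by apply/valid_reach/swap_valid.
have ex : actw (i :: t) vac = Some c by rewrite /= -/(actw _ _) ht /= act_swap.
by case/eqP: nz; rewrite (mono_uniq E ex) mono_cons mulrA gen_sq mul0r.
Qed.

End MonomialsOfStates.

(** * Maximal factorizations *)

(** At the first difference the partial sums compare the entries; positivity excludes that [t] is a
    proper prefix of [s]. *)
Lemma lexi_of_sums (s t : seqlexi nat) : (0%N \notin (s : seq nat)) ->
  (forall j, (sumn (take j s) <= sumn (take j t))%N) -> (s <= t)%O.
Proof.
elim: s t => [|x s IH] [|y t] //= s0 h.
- by have := h 1%N; rewrite /= take0 /= addn0 leqn0 => /eqP x0; rewrite x0 inE in s0.
- move: s0; rewrite inE negb_or => /andP[_ s0].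
  rewrite lexi_cons; have xy := h 1%N; rewrite /= !take0 /= !addn0 in xy.
  rewrite -leEnat in xy; rewrite leEnat in xy.
  apply/andP; split; first by rewrite leEnat.
  apply/implyP; rewrite leEnat => yx; apply: IH => // j.
  have := h j.+1; rewrite /=.
  have -> : x = y by apply/eqP; rewrite eqn_leq xy.
  by rewrite leq_add2l.
Qed.

Section MaxFactorization.
Variable K : nat.
Local Notation res := (@res K).
Local Notation n := (K.+2)%:Z.
Local Notation vac := (vac K).
Implicit Types (A : {set 'Z_K.+2}) (As : seq {set 'Z_K.+2}) (c d : state K).

Definition strips_ok As := forall A, A \in As -> A != finset.set0 /\ A \proper [set: 'Z_K.+2].

Lemma col_take (lam : seq nat) j a : sorted geq lam ->
  col_height (take j lam) a = minn j (col_height lam a).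
Proof.
move=> sl; elim: lam j sl => [|x p IH] j sp; first by rewrite /= minn0.
have sp' : sorted geq p by apply: path_sorted sp.
case: j => [|j] /=; first by rewrite min0n.
rewrite /col_height /= -!/(col_height _ _) IH //.
case: (ltnP a x) => ax; first by rewrite !add1n minnSS.
have -> : col_height p a = 0%N; last by rewrite !minn0.
apply/eqP; rewrite -leqn0 leqNgt -ltn_nth_col //.
rewrite -leqNgt; case: p sp {IH sp'} => [|y p] //= /andP[yx _].
by apply: leq_trans ax.
Qed.

Lemma wordd_cat As Bs : wordd (As ++ Bs) = wordd Bs ++ wordd As.
Proof. by rewrite /wordd rev_cat map_cat flatten_cat. Qed.

Lemma card_res_window (g : 'I_K.+2 -> int) c A : window g c ->
  \sum_a (res (g a) \in A)%:Z = (#|A|)%:Z.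
Proof.
move=> w; rewrite -(reindex_inj (P := predT) (F := fun r => (r \in A)%:Z) (win_inj w)) /=.
rewrite -sum1_card (big_morph Posz PoszD (erefl 0%:Z)) [RHS]big_mkcond /=.
by apply: eq_bigr => r _; case: (r \in A).
Qed.

Lemma wordd_window As c : strips_ok As -> actw (wordd As) vac = Some c ->
  exists2 g, window g c &
    (forall a, Lw g a <= (size As)%:Z) /\ \sum_a Lw g a = (sumn (sizes (k := K.+1) As))%:Z.
Proof.
elim/last_ind: As c => [|As A IH] c ok.
  case=> <-; exists (fun a => (nat_of_ord a)%:Z); first exact: vac_window.
  by split=> [a|]; rewrite ?vac_Lw // big1 // => a _; rewrite vac_Lw.
rewrite wordd_rcons actw_cat; case E: (actw _ vac) => [d|] //= Hc.
have ok' : strips_ok As by move=> B BA; apply: ok; rewrite mem_rcons inE BA orbT.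
have [g0 w0 [hb hs]] := IH d ok' E.
have [_ pA] : A != finset.set0 /\ A \proper [set: 'Z_K.+2].
  by apply: ok; rewrite mem_rcons mem_head.
have [m mA em] := cyc_descE pA; rewrite em in Hc.
have [g w [hL _ _]] := actw_cdesc_strip mA w0 Hc.
exists g => //; split=> [a|].
  rewrite hL size_rcons (_ : (size As).+1%:Z = (size As)%:Z + 1); last by lia.
  by rewrite lerD //; case: (_ \in _).
rewrite (eq_bigr _ (fun a _ => hL a)) big_split /= hs (card_res_window A w0).
by rewrite /sizes map_rcons sumn_rcons PoszD.
Qed.

Section Shape.
Variables (lam : seq nat) (kl : kbounded K.+1 lam).
Variables (g : 'I_K.+2 -> int) (c : state K).
Hypotheses (w : window g c) (hL : forall a : 'I_K.+2, Lw g a = (col_height lam a)%:Z).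

Lemma sumn_col_ord (mu : seq nat) : kbounded K.+1 mu ->
  (sumn mu)%:Z = \sum_(a < K.+2) (col_height mu a)%:Z.
Proof.
move=> km; rewrite (@sumn_col K.+2) ?(big_morph Posz PoszD (erefl 0%:Z)) //.
by case/andP: km => _ /allP h; apply/allP => x /h /leqW.
Qed.

Lemma kbounded_take (mu : seq nat) j : kbounded K.+1 mu -> kbounded K.+1 (take j mu).
Proof.
case/andP=> /andP[sm m0] mk; apply/andP; split; last first.
  by apply/allP => x /mem_take /(allP mk).
apply/andP; split; first by apply: take_sorted.
by apply: contra m0 => /mem_take.
Qed.

(** After [j] strips a column is at most [j] high, and at most as high as in the end, since letters
    never lower heights. Cutting all columns of [lam] at height [j] leaves its first [j] rows. *)
Lemma wordd_prefix_sum As j : strips_ok As -> actw (wordd As) vac = Some c ->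
  (sumn (take j (sizes (k := K.+1) As)) <= sumn (take j lam))%N.
Proof.
move=> ok; rewrite -{1}(cat_take_drop j As) wordd_cat actw_cat.
case E: (actw _ vac) => [d|] //= Hd.
have ok' : strips_ok (take j As) by move=> B /mem_take; apply: ok.
have [g0 w0 [hb hs]] := wordd_window ok' E.
have [g1 w1 [_ hle]] := actw_window w0 Hd.
rewrite /sizes -map_take -lez_nat -hs (sumn_col_ord (kbounded_take j kl)).
apply: ler_sum => a _; rewrite col_take; last by case/andP: kl => /andP[].
have := hb a; have := hle a.
rewrite (Lw_ext _ (window_state_uniq w1 w)) hL => h1 h2.
case: (leqP j (col_height lam a)) => _ //.
by apply: le_trans h2 _; rewrite lez_nat size_take_min geq_minl.
Qed.

Lemma factorization_le As : strips_ok As -> actw (wordd As) vac = Some c ->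
  (sizes (k := K.+1) As <= (lam : seqlexi nat))%O.
Proof.
move=> ok Hc; apply: lexi_of_sums => [|j]; last exact: wordd_prefix_sum.
apply/mapP => -[A /ok [A0 _] /esym/eqP]; by rewrite cards_eq0 (negbTE A0).
Qed.

End Shape.

Lemma sizes_row_sets lam : kbounded K.+1 lam -> sizes (k := K.+1) (row_sets K lam) = lam.
Proof.
elim/last_ind: lam => [|lam l IH] // /kbounded_rcons[kl /andP[l0 lk] hl].
rewrite row_sets_rcons /sizes map_rcons -/(sizes _) IH //; congr rcons.
have [g [c [w _ _ hg]]] := row_sets_spec kl.
have hA := row_res_window w lk hg hl.
apply/eqP; rewrite -eqz_nat -(card_res_window _ w); apply/eqP.
transitivity (\sum_(a < K.+2 | (a < l)%N) (1 : int)).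
  rewrite [RHS]big_mkcond; apply: eq_bigr => a _; rewrite hA.
  by case: (a < l)%N.
by rewrite -(big_ord_widen K.+2 (fun=> 1)) 1?ltnW ?ltnS // sumr_const card_ord natz.
Qed.

Lemma row_sets_ok lam : kbounded K.+1 lam -> strips_ok (row_sets K lam).
Proof.
elim/last_ind: lam => [|lam l IH] //.
move=> kll; have /kbounded_rcons[kl /andP[l0 lk] hl] := kll.
rewrite row_sets_rcons => A; rewrite mem_rcons inE => /orP[/eqP->|]; last exact: IH.
have [g [c [w _ _ hg]]] := row_sets_spec kl.
have hA := row_res_window w lk hg hl; split.
  by apply/set0Pn; exists (res (g ord0)); rewrite hA.
have lk' : (l < K.+2)%N by rewrite ltnS.
by apply: (sub_properT (m := res (g (Ordinal lk')))); rewrite hA ltnn.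
Qed.

(** Before the last strip no column exceeds its height in [lam]: the first [l] columns because of
    the number of strips, the others because they are the same in [lam] and [rcons lam l]. The total
    sizes agree, so all heights do, and these determine the earlier core and hence the last set. *)
Lemma factorization_uniq lam As g c : kbounded K.+1 lam -> window g c ->
  (forall a : 'I_K.+2, Lw g a = (col_height lam a)%:Z) ->
  strips_ok As -> actw (wordd As) vac = Some c -> sizes (k := K.+1) As = lam ->
  As = row_sets K lam.
Proof.
elim/last_ind: lam As g c => [|lam l IH] As g c.
  by move=> _ _ _ _ _; case: As.
move=> kll w hL; have /kbounded_rcons[kl /andP[l0 lk] hl] := kll.
elim/last_ind: As => [|As A _] ok; first by move=> _ /(congr1 size); rewrite size_rcons.
rewrite wordd_rcons actw_cat; case E: (actw _ vac) => [d|] //= Hc.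
rewrite /sizes map_rcons => /rcons_inj[es eA].
have ok' : strips_ok As by move=> B BA; apply: ok; rewrite mem_rcons inE BA orbT.
have [g0 w0 [hb hs]] := wordd_window ok' E.
have [_ pA] : A != finset.set0 /\ A \proper [set: 'Z_K.+2].
  by apply: ok; rewrite mem_rcons mem_head.
have [m mA em] := cyc_descE pA; rewrite em in Hc.
have [g1 w1 [hL1 _ _]] := actw_cdesc_strip mA w0 Hc.
have hLA (a : 'I_K.+2) : (col_height (rcons lam l) a)%:Z = Lw g0 a + (res (g0 a) \in A)%:Z.
  by rewrite -hL1 -hL; apply/Lw_ext/(window_state_uniq w w1).
have le (a : 'I_K.+2) : Lw g0 a <= (col_height lam a)%:Z.
  have := hLA a; rewrite col_height_rcons; case: (ltnP a l) => al; last first.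
    by case: (_ \in _); rewrite /=; lia.
  move=> _; have -> : col_height lam a = size As; last exact: hb.
  have -> : size As = size lam by rewrite -es size_map.
  apply/eqP; rewrite -all_count; apply/allP => x /hl; exact: leq_trans.
have eqL (a : 'I_K.+2) : Lw g0 a = (col_height lam a)%:Z.
  have h0 : \sum_(b < K.+2) ((col_height lam b)%:Z - Lw g0 b) = 0.
    by rewrite sumrB hs -(sumn_col_ord kl) /sizes es subrr.
  have /psumr_eq0P h : forall b : 'I_K.+2, predT b -> 0 <= (col_height lam b)%:Z - Lw g0 b.
    by move=> b _; rewrite subr_ge0.
  by apply/eqP; rewrite eq_sym -subr_eq0 (h h0).
rewrite row_sets_rcons (IH As g0 d) //; congr rcons.
have [g2 [d2 [w2 _ hL2 hg2]]] := row_sets_spec kl.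
have [e2 _] : g0 =1 g2 /\ d = d2 by apply: (window_uniq w0 w2) => a; rewrite eqL hL2.
apply/setP => r; have [a ea] := win_surj w0 r.
rewrite -{2}ea e2 (row_res_window w2 lk hg2 hl) -ea.
have := hLA a; rewrite eqL col_height_rcons PoszD => /addrI [].
by case: (a < l)%N; case: (_ \in A).
Qed.

End MaxFactorization.

(** * Cores as bead sets *)

Section Maya.
Implicit Types p : seq nat.

(* The boundary steps of the diagram: its rows end at the beads, its columns
   at the gaps, and hook lengths are differences of the two. *)
Definition bead (q : seq nat) (r : nat) : int := (nth 0%N q r)%:Z - r.+1%:Z.
Definition gap (q : seq nat) (c : nat) : int := c%:Z - (col_height q c)%:Z.

Lemma nth_sorted_le p r r' : sorted geq p -> (r <= r')%N -> (nth 0 p r' <= nth 0 p r)%N.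
Proof.
move=> sp rr; rewrite leqNgt; apply/negP; rewrite ltn_nth_col // => h.
have : (r < col_height p (nth 0 p r))%N by apply: leq_ltn_trans h.
by rewrite -ltn_nth_col // ltnn.
Qed.

Lemma bead_lt p r r' : sorted geq p -> (r < r')%N -> bead p r' < bead p r.
Proof. move=> sp rr; have := nth_sorted_le sp (ltnW rr); rewrite /bead; lia. Qed.

Lemma bead_inj p : sorted geq p -> injective (bead p).
Proof.
move=> sp r r' e; have [/(bead_lt sp)|/(bead_lt sp)|//] := ltngtP r r'; by rewrite e ltxx.
Qed.

Lemma gap_lt p c c' : (c < c')%N -> gap p c < gap p c'.
Proof. by move=> cc; have := col_height_mono p (ltnW cc); rewrite /gap; lia. Qed.

Lemma gap_lt_bead p r c : sorted geq p -> (gap p c < bead p r) = (c < nth 0 p r)%N.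
Proof.
move=> sp; case: (ltnP c (nth 0%N p r)) => h.
  have h' : (r < col_height p c)%N by rewrite -ltn_nth_col.
  by have -> : gap p c < bead p r by rewrite /gap /bead; lia.
have : (col_height p c <= r)%N by rewrite leqNgt -ltn_nth_col // -leqNgt.
rewrite /gap /bead => h'; apply/negbTE; rewrite -leNgt; lia.
Qed.

Lemma gap_neq_bead p r c : sorted geq p -> gap p c <> bead p r.
Proof.
move=> sp; case: (ltnP c (nth 0%N p r)) => h.
  by have := gap_lt_bead r c sp; rewrite h => + e; rewrite e ltxx.
have : (col_height p c <= r)%N by rewrite leqNgt -ltn_nth_col // -leqNgt.
rewrite /gap /bead => h'; lia.
Qed.

(** The least [r] with [bead p r <= x] decides: [x] is this bead or the gap of column [x + r]. *)
Lemma bead_or_gap p x : sorted geq p -> (exists r, x = bead p r) \/ (exists c, x = gap p c).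
Proof.
move=> sp; have ex : exists r, bead p r <= x.
  exists (nth 0%N p 0 + `|x|)%N.
  have := nth_sorted_le sp (leq0n (nth 0%N p 0 + `|x|)%N); rewrite /bead; lia.
case: (ex_minnP ex) => r hr rmin.
have [e|/eqP ne] := x =P bead p r; first by left; exists r.
right; have lt : bead p r < x by rewrite lt_neqAle hr eq_sym ne.
have c0 : 0 <= x + r%:Z by move: lt; rewrite /bead; lia.
pose c := `|(x + r%:Z)%R|%N; exists c; have ec : c%:Z = x + r%:Z by rewrite gez0_abs.
rewrite /gap; suff -> : col_height p c = r by lia.
apply/eqP; rewrite eqn_leq; apply/andP; split.
  rewrite leqNgt -ltn_nth_col // -leqNgt; move: lt; rewrite /bead; lia.
move: c ec => c ec; case: r hr rmin ne lt c0 ec => [|r] // hr rmin ne lt c0 ec.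
rewrite -ltn_nth_col //; have : ~~ (bead p r <= x).
  by apply/negP => /rmin; rewrite ltnn.
by rewrite -ltNge /bead; lia.
Qed.

Lemma hook_bead p r c : sorted geq p -> (c < nth 0 p r)%N -> (hook p r c)%:Z = bead p r - gap p c.
Proof.
move=> sp h; have := h; rewrite ltn_nth_col // => h'.
by rewrite /hook /bead /gap; lia.
Qed.

End Maya.

(** * Counting beads beyond a position *)

Section BeadCount.
Variable K : nat.
Local Notation res := (@res K).
Local Notation n := (K.+2)%:Z.
Implicit Types (c : state K) (r : 'Z_K.+2) (x : int).

(* The number of beads [>= x] of the core with first gaps [c]. *)
Definition bc c x : int := \sum_r (if x <= c r then ((c r - x) %/ n)%Z else 0).

Section State.
Variable c : state K.
Hypothesis hc : forall r, res (c r) = r.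

Lemma bc_succ x : bc c x = bc c (x + 1) + (x < c (res x))%R%:Z.
Proof.
rewrite /bc; have -> : (x < c (res x))%R%:Z =
    \sum_(r : 'Z_K.+2) ((r == res x) && (x < c r)%R : nat)%:Z.
  rewrite (bigD1 (res x)) //= eqxx big1 ?addr0 // => r /negbTE ->; by [].
rewrite -big_split /=; apply: eq_bigr => r _.
have -> : (r == res x) = (n %| c r - x)%Z by rewrite -res_eq hc.
have := floor_succ (isT : (0 < K.+2)%N) (c r - (x + 1)).
have -> : c r - (x + 1) + 1 = c r - x by ring.
move=> s; have [h|h|h] := ltgtP x (c r).
- have -> : x + 1 <= c r by lia.
  by rewrite s andbT.
- have -> : (x + 1 <= c r) = false by lia.
  by rewrite andbF.
- have -> : (x + 1 <= c r) = false by lia.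
  by rewrite h subrr div0z andbF.
Qed.

Lemma bc_period x : bc c x = bc c (x + n) + \sum_r (x + n <= c r)%R%:Z.
Proof.
rewrite /bc -big_split /=; apply: eq_bigr => r _.
case: (lerP (x + n) (c r)) => h.
  have -> : x <= c r by lia.
  have -> : c r - x = 1 * n + (c r - (x + n)) by ring.
  by rewrite divzMDl // addrC.
rewrite addr0; case: ifP => // h'; rewrite divz_small //; lia.
Qed.

Lemma bc_small x : (forall r, x <= c r) -> bc c x = \sum_r ((c r - x) %/ n)%Z.
Proof. by move=> h; apply: eq_bigr => r _; rewrite h. Qed.

Lemma bc_large x : (forall r, c r <= x) -> bc c x = 0.
Proof.
move=> h; rewrite /bc big1 // => r _; case: ifP => // h'.
have -> : c r = x by apply/eqP; rewrite eq_le h h'.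
by rewrite subrr div0z.
Qed.

Lemma state_bounds : exists m : nat, forall r, - m%:Z <= c r <= m%:Z.
Proof.
exists (\sum_r `|c r|)%N => r.
have : (`|c r| <= \sum_r `|c r|)%N by rewrite (bigD1 r) //= leq_addr.
by lia.
Qed.

Lemma bc_anti x y : x <= y -> bc c y <= bc c x.
Proof.
move=> xy; have -> : y = x + `|(y - x)%R|%N%:Z by lia.
elim: `|_|%N => [|m IH]; first by rewrite addr0.
apply: le_trans IH; rewrite [X in _ <= X]bc_succ -addrA -PoszD addn1.
by rewrite lerDl.
Qed.

Lemma sum_floor_state x :
  (\sum_r ((c r - x) %/ n)%Z) * n =
  \sum_r c r - x * n - \sum_(a < K.+2) (nat_of_ord a)%:Z.
Proof.
have h : \sum_r ((c r - x) %% n)%Z = \sum_(a < K.+2) (nat_of_ord a)%:Z.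
  transitivity (\sum_r (nat_of_ord (res (c r - x)))%:Z).
    by apply: eq_bigr => a _; rewrite val_res.
  rewrite [RHS](reindex_inj (h := fun a => res (c a - x))) //.
  by move=> a b /=; rewrite !resB !hc => /addIr.
have e : \sum_r (c r - x) = (\sum_r ((c r - x) %/ n)%Z) * n + \sum_r ((c r - x) %% n)%Z.
  by rewrite mulr_suml -big_split /=; apply: eq_bigr => a _; rewrite -divz_eq.
rewrite -h; move: e; rewrite sumrB sumr_const card_ord -mulr_natr natz => ->.
by ring.
Qed.
End State.

(** The charge condition: as many beads lie at or beyond [x] as for the empty core. *)
Lemma bc_valid c x : valid c -> (forall r, x <= c r) -> bc c x = - x.
Proof.
move=> [hc hs] h; rewrite bc_small //.
apply: (mulIf (isT : n != 0)); rewrite sum_floor_state // hs.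
by rewrite addrAC subrr sub0r mulNr.
Qed.

Lemma sum_window (g : 'I_K.+2 -> int) c (F : int -> int) : window g c ->
  \sum_r F (c r) = \sum_a F (g a).
Proof.
move=> w; rewrite (reindex_inj (h := fun a => res (g a)) (win_inj w)) /=.
by apply: eq_bigr => a _; rewrite (win_res w).
Qed.

Lemma bc_window (g : 'I_K.+2 -> int) c a : window g c -> bc c (g a) = Lw g a.
Proof.
move=> w; rewrite /bc (sum_window (fun y => if g a <= y then ((y - g a) %/ n)%Z else 0) w).
rewrite /Lw [RHS]big_mkcond; apply: eq_bigr => b _.
have [ab|ab|ab] := ltngtP a b.
- by rewrite (win_le w) // ltnW.
- by rewrite leNgt (win_ltE w) ab.
- by rewrite (val_inj ab) subrr div0z if_same.
Qed.

End BeadCount.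

(** * First gaps of a core, its bounded partition and its transpose *)

Section Cores.
Variable K : nat.
Local Notation res := (@res K).
Local Notation n := (K.+2)%:Z.
Implicit Types (c : state K) (r : 'Z_K.+2) (x : int) (p q : seq nat).

Definition first_gaps p c : Prop :=
  (forall r, res (c r) = r) /\
  forall x, (exists i : nat, x = bead p i) <-> (x < c (res x)).

Lemma first_gaps_gap p c x : sorted geq p -> first_gaps p c ->
  c (res x) <= x -> exists j, x = gap p j.
Proof.
by move=> sp [_ h] cx; case: (bead_or_gap x sp) => // /h; rewrite ltNge cx.
Qed.

Lemma gap_first_gaps p c j : sorted geq p -> first_gaps p c ->
  c (res (gap p j)) <= gap p j.
Proof.
move=> sp [_ h]; rewrite leNgt; apply/negP => /h[r e].
exact: (gap_neq_bead sp e).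
Qed.

Lemma first_gaps_size p c r : sorted geq p -> first_gaps p c -> - (size p)%:Z <= c r.
Proof.
move=> sp [hc h]; rewrite leNgt; apply/negP => lt.
have : c r < c (res (c r)).
  apply/h; exists `|(c r + 1)%R|%N; rewrite /bead nth_default; last by lia.
  by lia.
by rewrite hc ltxx.
Qed.

(** Hooks of length at most [k] belong to gaps strictly between [y - n] and [y], and each class
    whose first gap is below [y] has exactly one there. Allowing [y] to be a bead or a first gap
    also covers a row that is still to be added. *)
Lemma count_short_hooks p c (y : int) (P : nat) : sorted geq p -> first_gaps p c ->
  y <= c (res y) -> (forall j, (j < P)%N = (gap p j < y)) ->
  count (fun j => y - gap p j <= (K.+1)%:Z) (iota 0 P) = #|[pred r | (c r < y)%R]|.
Proof.
move=> sp fg yc hP; have [hc h] := fg.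
rewrite -size_filter; set s := filter _ _.
rewrite -(size_map (fun j => res (gap p j)) s).
have inj : {in s &, injective (fun j => res (gap p j))}.
  move=> i j; rewrite !mem_filter !mem_iota !add0n /= !hP.
  move=> /andP[i1 i2] /andP[j1 j2] /eqP; rewrite res_eq => /dvdzP[q e].
  have q0 : q = 0.
    have h1 : q * n < 1 * n by rewrite -e mul1r; lia.
    have h2 : -1 * n < q * n by rewrite -e mulN1r; lia.
    by rewrite !ltr_pM2r // in h1 h2; lia.
  move: e; rewrite q0 mul0r => e.
  have [/(gap_lt p)|/(gap_lt p)|//] := ltngtP i j; lia.
rewrite -(card_uniqP _); last by rewrite map_inj_in_uniq // filter_uniq ?iota_uniq.
apply: eq_card => r; rewrite !inE; apply/mapP/idP => [[j]|cr].
  rewrite mem_filter mem_iota add0n /= hP => /andP[j1 j2] ->.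
  by apply: le_lt_trans j2; apply: gap_first_gaps.
have ry : r != res y by apply: contraTneq cr => ->; rewrite -leNgt.
(* [y - m] is the last element of class [r] before [y]; it is not below [c r], hence a gap. *)
set m := ((y - c r) %% n)%Z.
have m0 : 0 <= m by rewrite modz_ge0.
have mn : m < n by have := ltz_mod (y - c r) (isT : n != 0).
have em : res (y - m) = r.
  apply/eqP; rewrite -(hc r) res_eq.
  have -> : y - m - c r = ((y - c r) %/ n)%Z * n.
    by have := divz_eq (y - c r) n; rewrite -/m; lia.
  by rewrite dvdz_mull.
have m1 : m != 0 by apply: contraNneq ry => m1; rewrite -em m1 subr0.
have le : c (res (y - m)) <= y - m.
  rewrite em; have d0 : 0 <= ((y - c r) %/ n)%Z by rewrite divz_ge0 //; lia.
  have := divz_eq (y - c r) n; rewrite -/m.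
  have : 0 <= ((y - c r) %/ n)%Z * n by rewrite mulr_ge0.
  by lia.
have [j ej] := first_gaps_gap sp fg le.
exists j; last by rewrite -ej em.
by rewrite mem_filter mem_iota add0n /= hP -ej; lia.
Qed.

Lemma card_below (g : 'I_K.+2 -> int) c (y : int) (b : 'I_K.+2) : window g c ->
  (b < #|[pred r | (c r < y)%R]|)%N = (g b < y).
Proof.
move=> w.
have e : (#|[pred r | (c r < y)%R]|)%:Z = \sum_a (g a < y)%R%:Z.
  rewrite -(sum_window (fun z => (z < y)%R%:Z) w).
  rewrite -sum1_card (big_morph Posz PoszD (erefl 0%:Z)) [LHS]big_mkcond /=.
  by apply: eq_bigr => r _; rewrite inE; case: (c r < y).
have cnt (m : nat) : (m <= K.+2)%N -> \sum_(a < K.+2) (a < m)%N%:Z = m%:Z.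
  move=> mk; transitivity (\sum_(a < K.+2 | (a < m)%N) (1 : int)).
    by rewrite [RHS]big_mkcond; apply: eq_bigr => a _; case: (a < m)%N.
  by rewrite -(big_ord_widen K.+2 (fun=> 1)) // sumr_const card_ord natz.
set N := #|_| in e *; case: (ltP (g b) y) => h.
  have : (b.+1)%:Z <= N%:Z.
    rewrite e -(cnt b.+1) //; apply: ler_sum => a _; case: (ltnP a b.+1) => // ab.
    by rewrite (le_lt_trans _ h) // (win_le w).
  by rewrite lez_nat.
have : N%:Z <= b%:Z.
  rewrite e -(cnt b) 1?ltnW //; apply: ler_sum => a _.
  case: (ltnP a b) => ab; first by case: (_ < _).
  by rewrite ltNge (le_trans h) // (win_le w).
by rewrite lez_nat ltnNge => ->.
Qed.

Lemma core_to_bounded_row p c (i : nat) : sorted geq p -> first_gaps p c -> (i < size p)%N ->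
  nth 0%N (core_to_bounded K.+1 p) i = #|[pred s | (c s < bead p i)%R]|.
Proof.
move=> sp fg rs; rewrite nth_mkseq //.
rewrite -(@count_short_hooks p c (bead p i) (nth 0%N p i)) //.
- apply: eq_in_count => j; rewrite mem_iota add0n /= => ji.
  by rewrite -lez_nat hook_bead.
- by apply: ltW; apply/(proj2 fg); exists i.
- by move=> j; rewrite gap_lt_bead.
Qed.

Lemma core_to_bounded_sorted p c : sorted geq p -> first_gaps p c ->
  sorted geq (core_to_bounded K.+1 p).
Proof.
move=> sp fg; apply/(sortedP 0%N) => r; rewrite size_mkseq => rs.
rewrite /geq /= (core_to_bounded_row sp fg rs) (core_to_bounded_row sp fg (ltnW rs)).
apply: subset_leq_card; apply/fintype.subsetP => s; rewrite !inE => /lt_trans; apply.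
exact: bead_lt.
Qed.

Lemma count_beads p c x : sorted geq p -> first_gaps p c -> - (size p)%:Z <= x ->
  (count (fun i : nat => (x <= bead p i)%R) (iota 0 (size p)))%:Z = bc c x.
Proof.
move=> sp fg; have [hc h] := fg; have [M hM] := state_bounds c.
have [m em] : exists m : nat, x + m%:Z = Num.max x (Num.max M%:Z (nth 0%N p 0%N)%:Z).
  exists `|(Num.max x (Num.max M%:Z (nth 0%N p 0%N)%:Z) - x)%R|%N; lia.
have : M%:Z <= x + m%:Z /\ (nth 0%N p 0%N)%:Z <= x + m%:Z by lia.
move=> {em} [hm1 hm2]; elim: m x hm1 hm2 => [|m IH] x hm1 hm2 hx.
  rewrite addr0 in hm1 hm2; rewrite bc_large; last by move=> r; have := hM r; lia.
  apply/eqP; rewrite eqz_nat -leqn0 leqNgt -has_count; apply/hasPn => r _.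
  by rewrite -ltNge; have := nth_sorted_le sp (leq0n r); rewrite /bead; lia.
rewrite (bc_succ hc) -IH //; try lia.
rewrite -PoszD; congr Posz.
have split_count (s : seq nat) : count (fun i : nat => (x <= bead p i)%R) s =
    (count (fun i : nat => (x + 1 <= bead p i)%R) s + count (fun i : nat => bead p i == x) s)%N.
  elim: s => //= r s ->; rewrite addnACA; congr (_ + _)%N.
  by have [lt|lt|eq] := ltgtP (bead p r) x; lia.
rewrite split_count; congr (_ + _)%N.
case: (boolP (x < c (res x))) => hb.
  have [r0 er0] := (proj2 (h x)) hb.
  have r0s : (r0 < size p)%N.
    rewrite ltnNge; apply/negP => h0; move: hx; rewrite er0 /bead nth_default //; lia.
  rewrite (@eq_count _ _ (pred1 r0)); last by move=> r /=; rewrite er0 (inj_eq (bead_inj sp)).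
  by rewrite count_uniq_mem ?iota_uniq // mem_iota r0s.
apply/eqP; rewrite -leqn0 leqNgt -has_count; apply/hasPn => r _.
by apply: contra hb => /eqP e; apply/h; exists r.
Qed.

(** A row has more than [b] short hooks exactly when its bead lies beyond [g b], and [Lw g b] counts
    the beads beyond [g b]. *)
Lemma core_to_bounded_col p (g : 'I_K.+2 -> int) c (b : 'I_K.+2) :
  sorted geq p -> first_gaps p c -> window g c ->
  (col_height (core_to_bounded K.+1 p) b)%:Z = Lw g b.
Proof.
move=> sp fg w; rewrite -(bc_window b w).
have hgb : g b = c (res (g b)) by rewrite (win_res w).
rewrite -(count_beads sp fg); last by rewrite hgb; apply: first_gaps_size.
congr Posz; rewrite /col_height /core_to_bounded count_map.
apply: eq_in_count => r; rewrite mem_iota add0n /= => rs.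
have := core_to_bounded_row sp fg rs; rewrite nth_mkseq // => ->.
rewrite (card_below _ _ w) le_eqVlt.
case: eqP => //= e; have : g b < c (res (g b)) by apply/(proj2 fg); exists r.
by rewrite -hgb ltxx.
Qed.

Lemma first_gaps_valid p c : sorted geq p -> first_gaps p c -> valid c.
Proof.
move=> sp fg; have [hc h] := fg; split=> //.
have hM r : - (size p)%:Z <= c r by apply: first_gaps_size.
have := count_beads sp fg (lexx _).
rewrite (bc_small hM) => e.
have := sum_floor_state hc (- (size p)%:Z); rewrite -e.
have -> : count (fun i : nat => - (size p)%:Z <= bead p i) (iota 0 (size p)) = size p.
  rewrite -[RHS](size_iota 0); apply/eqP; rewrite -all_count; apply/allP => r.
  by rewrite mem_iota add0n /bead => /andP[_]; lia.
lia.
Qed.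


(* Transposing a core reverses its bead set and exchanges beads with gaps. *)
Definition tau c : state K := [ffun r => (K.+1)%:Z - c (- 1 - r)].
Definition wtau (g : 'I_K.+2 -> int) (a : 'I_K.+2) : int := (K.+1)%:Z - g (rev_ord a).

Lemma res_Kp1 : res (K.+1)%:Z = -1.
Proof. by apply/eqP; rewrite -[-1]/(- res 1) -resN res_eq opprK -PoszD addn1 dvdzz. Qed.

Lemma tauK : involutive tau.
Proof. by move=> c; apply/ffunP => r; rewrite !ffunE subKr subKr. Qed.

Lemma tau_window g c : window g c -> window (wtau g) (tau c).
Proof.
move=> w; split.
- move=> a b ab; rewrite /wtau ltrD2l ltrN2; apply: (win_inc w) => /=.
  by have := ltn_ord a; have := ltn_ord b; lia.
- by move=> a; rewrite /wtau ffunE resB res_Kp1 subKr (win_res w).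
- transitivity (\sum_a ((K.+1)%:Z - g a)); first by rewrite [RHS](reindex_inj rev_ord_inj).
  rewrite sumrB (win_sum w) -sumrB [RHS](reindex_inj rev_ord_inj) /=.
  by apply: eq_bigr => a _; have := ltn_ord a; lia.
Qed.

Lemma Lw_tau g c a : window g c -> Lw (wtau g) a = Nw g (rev_ord a).
Proof.
move=> w; rewrite /Lw /Nw (reindex_inj rev_ord_inj) /=.
apply: eq_big => [b|b _].
  by have := ltn_ord a; have := ltn_ord b; lia.
by rewrite /wtau rev_ordK; congr (_ %/ _)%Z; ring.
Qed.

Lemma bead_transpose p (i : nat) : sorted geq p ->
  bead (transpose p) i = - 1 - gap p i.
Proof.
move=> sp; rewrite /bead /gap.
have -> : nth 0%N (transpose p) i = col_height p i; last by lia.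
case: (ltnP i (head 0%N p)) => h; first by rewrite nth_mkseq.
rewrite nth_default ?size_mkseq //; apply/esym/eqP; rewrite -leqn0 leqNgt.
by rewrite -ltn_nth_col // nth0 -leqNgt.
Qed.

Lemma first_gaps_transpose p c : sorted geq p -> first_gaps p c ->
  first_gaps (transpose p) (tau c).
Proof.
move=> sp fg; have [hc h] := fg; split=> [r|x].
  by rewrite ffunE resB res_Kp1 hc subKr.
have e1 : res (- 1 - x) = -1 - res x by rewrite resB resN res1.
have -> : (x < tau c (res x)) = (c (res (- 1 - x)) <= - 1 - x).
  rewrite ffunE -e1; set s := res (- 1 - x).
  have /dvdzP[q e] : (n %| - 1 - x - c s)%Z by rewrite -res_eq hc.
  apply/idP/idP => h1; last by lia.
  have : -1 * n < q * n by rewrite -e mulN1r; lia.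
  rewrite ltr_pM2r // => q1; have : 0 <= q * n by rewrite mulr_ge0 //; lia.
  by lia.
split=> [[i ei]|le].
  have -> : - 1 - x = gap p i by rewrite ei bead_transpose //; ring.
  exact: gap_first_gaps.
have [j ej] := first_gaps_gap sp fg le; exists j.
by rewrite bead_transpose // -ej; ring.
Qed.

Lemma transpose_sorted p : sorted geq (transpose p).
Proof. by apply: sorted_mkseq => a b; apply: col_height_mono. Qed.

(** If the position were a gap, it would meet row [i] in a box with hook length [n]. *)
Lemma core_bead_down p (i : nat) : is_core K.+2 p -> exists j : nat, bead p i - n = bead p j.
Proof.
move=> /andP[/is_partition_sorted sp /allP hk].
have [//|[j ej]] := bead_or_gap (bead p i - n) sp.
have lt : (j < nth 0%N p i)%N by rewrite -gap_lt_bead // -ej; lia.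
have isz : (i < size p)%N.
  by rewrite ltnNge; apply/negP => h; rewrite nth_default // in lt.
have := hk i; rewrite mem_iota add0n /= => /(_ isz) /allP /(_ j).
rewrite mem_iota add0n /= => /(_ lt) /eqP[].
by apply/eqP; rewrite -eqz_nat hook_bead // -ej; apply/eqP; ring.
Qed.

Lemma core_first_gaps p : is_core K.+2 p -> exists c, first_gaps p c.
Proof.
move=> cp; have sp : sorted geq p by case/andP: cp => /is_partition_sorted.
pose isb x := `[< exists i : nat, x = bead p i >].
have down x (m : nat) : isb x -> isb (x - m%:Z * n).
  move=> bx; elim: m => [|m]; first by rewrite mul0r subr0.
  move/asboolP => [i ei]; apply/asboolP.
  have -> : x - m.+1%:Z * n = bead p i - n by rewrite -ei; lia.
  exact: core_bead_down.
(* Far enough to the left that all elements of the class up to [x0 r] are beads; the search for the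
   first gap starts there. *)
pose x0 (r : 'Z_K.+2) : int := (nat_of_ord r)%:Z - (size p).+2%:Z * n.
have resn (x y : int) : res (x + y * n) = res x.
  by apply/eqP; rewrite res_eq addrAC subrr add0r dvdz_mull.
have rx0 r : res (x0 r) = r by rewrite /x0 -mulNr resn res_ord.
have x0s r : x0 r + n <= - (size p)%:Z.
  have : (nat_of_ord r)%:Z < n := ltn_ord r.
  by rewrite /x0; move: (nat_of_ord r) (size p) => a b; nia.
have low x : x < - (size p)%:Z -> isb x.
  move=> h; apply/asboolP; exists `|(x + 1)%R|%N.
  by rewrite /bead nth_default; lia.
have ex r : exists j : nat, ~~ isb (x0 r + j%:Z * n).
  exists ((size p).+2 + nth 0%N p 0%N)%N; apply/asboolP => -[i].
  have := nth_sorted_le sp (leq0n i); rewrite /bead /x0 PoszD.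
  by move: (nth _ _ _) (nth _ _ _) (nat_of_ord r) (size p) => a b d e; nia.
pose c : state K := [ffun r => x0 r + (ex_minn (ex r))%:Z * n].
exists c; split=> [r|x]; first by rewrite ffunE resn rx0.
rewrite ffunE; case: ex_minnP => m hm mmin.
have /dvdzP[q e] : (n %| x - x0 (res x))%Z by rewrite -res_eq rx0.
have ex' : x = x0 (res x) + q * n by rewrite -e; ring.
split=> [bx|].
  rewrite ltNge; apply/negP => le; case/negP: hm.
  have mq : m%:Z <= q by rewrite -(ler_pM2r (isT : 0 < n)); lia.
  have -> : x0 (res x) + m%:Z * n = x - (`|(q - m%:Z)%R|%N)%:Z * n.
    by rewrite gez0_abs ?subr_ge0 // {2}ex'; ring.
  by apply: down; apply/asboolP.
rewrite {1}ex' ltrD2l ltr_pM2r // => qm; apply/asboolP.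
have [q0|q0] := lerP 0 q; last first.
  apply: low; rewrite ex'; apply: lt_le_trans (x0s (res x)).
  rewrite ltrD2l -[X in _ < X]mul1r ltr_pM2r //; lia.
apply/negPn/negP => nb; have := mmin `|q|%N.
rewrite gez0_abs // -ex' => /(_ nb); lia.
Qed.


(** The beads of [P :: q] are those of [q] together with [P], all shifted down by one. Filling the
    first gap [P = g l] leaves no gap below a bead in its class, so no hook of length [n] appears;
    [Lw g l = 0] puts the new bead beyond all others. Its short hooks correspond to the [l] first
    gaps below it. *)
Lemma core_add_row q (g : 'I_K.+2 -> int) c (l : 'I_K.+2) : is_core K.+2 q ->
  first_gaps q c -> window g c -> (0 < l)%N -> Lw g l = 0 ->
  exists P, is_core K.+2 (P :: q) /\
    core_to_bounded K.+1 (P :: q) = nat_of_ord l :: core_to_bounded K.+1 q.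
Proof.
move=> cq fg w l0 Ll; have [/[dup] pq /is_partition_sorted sq hk] := andP cq.
have [P eP] : exists P : nat, P%:Z = g l.
  exists `|g l|%N; have := Nw_ge0 l w; have := win_formula w l; rewrite Ll; lia.
have Pl : (l <= P)%N.
  have := Nw_ge0 l w; have := win_formula w l; rewrite Ll -eP; lia.
have cgl : c (res (g l)) = g l by rewrite (win_res w).
have top i : (nth 0%N q i <= P)%N.
  apply: leq_trans (nth_sorted_le sq (leq0n i)) _.
  case: (posnP (size q)) => [/size0nil -> //|qs].
  have := count_beads sq fg (x := g l); rewrite (bc_window _ w) Ll => e.
  have /e {e} : - (size q)%:Z <= g l by rewrite -eP; lia.
  move=> [] /eqP; rewrite -leqn0 leqNgt -has_count => /hasPn /(_ 0%N).
  by rewrite mem_iota qs => /(_ isT); rewrite -ltNge -eP /bead; lia.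
have colP j : (P <= j)%N -> col_height q j = 0%N.
  move=> Pj; apply/eqP; rewrite -leqn0 leqNgt -ltn_nth_col // -leqNgt.
  by apply: leq_trans (top _) Pj.
have hook0 j : (j < P)%N -> (hook (P :: q) 0 j)%:Z = g l - gap q j.
  by move=> jP; rewrite /hook /= -/(col_height q j) jP -eP /gap; lia.
have hookS i j : (j < nth 0%N q i)%N -> hook (P :: q) i.+1 j = hook q i j.
  move=> h; have jP : (j < P)%N by apply: leq_trans h (top i).
  by rewrite /hook /= -/(col_height q j) jP add1n subSS.
exists P; split.
  apply/andP; split.
    rewrite is_partition_cons pq (leq_trans l0 Pl) /= andbT.
    by apply/(all_nthP 0%N) => i _; apply: top.
  apply/allP => -[|i]; rewrite mem_iota add0n /= ?ltnS => h; apply/allP => j;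
    rewrite mem_iota add0n /= => hj.
    rewrite -eqz_nat hook0 //; apply/negP => /eqP e.
    have := gap_first_gaps j sq fg.
    have -> : gap q j = g l - n by rewrite -e; ring.
    have -> : res (g l - n) = res (g l).
      by apply/eqP; rewrite res_eq (_ : g l - n - g l = -1 * n) ?dvdz_mull //; ring.
    by rewrite cgl; lia.
  rewrite hookS //; have := allP hk i; rewrite mem_iota add0n h => /(_ isT).
  by move/allP/(_ j); rewrite mem_iota add0n; apply.
rewrite /core_to_bounded /mkseq /=; congr cons; last first.
  rewrite -[1%N]/(1 + 0)%N iotaDl -map_comp; apply: eq_map => i /=.
  by apply: eq_in_count => j; rewrite mem_iota add0n /= => h; rewrite hookS.
transitivity (count (fun j => g l - gap q j <= (K.+1)%:Z) (iota 0 P)).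
  by apply: eq_in_count => j; rewrite mem_iota add0n /= => jP; rewrite -lez_nat hook0.
rewrite (count_short_hooks sq fg).
- apply/eqP; rewrite eqn_leq; apply/andP; split.
    by rewrite leqNgt (card_below _ _ w) ltxx.
  have l1 : (l.-1 < K.+2)%N by have := ltn_ord l; lia.
  rewrite -(prednK l0); have := card_below (g l) (Ordinal l1) w; rewrite /= => ->.
  by rewrite (win_ltE w) /= prednK.
- by rewrite cgl.
- move=> j; rewrite -eP /gap; case: (ltnP j P) => h; first by apply/esym; lia.
  by rewrite colP // subr0; apply/esym/negbTE; rewrite -leNgt lez_nat.
Qed.

Lemma core_exists lam : kbounded K.+1 lam ->
  exists2 p, is_core K.+2 p & core_to_bounded K.+1 p = lam.
Proof.
elim: lam => [|l lam IH]; first by exists [::].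
rewrite /kbounded is_partition_cons /= => /andP[/and3P[l0 al pl] /andP[lk kl]].
have [|q cq eq] := IH; first by apply/andP.
have sq : sorted geq q by case/andP: cq => /is_partition_sorted.
have [c fg] := core_first_gaps cq.
have [g w] := valid_window (first_gaps_valid sq fg).
have lk' : (l < K.+2)%N by rewrite ltnS.
have [||P [cP eP]] := core_add_row (l := Ordinal lk') cq fg w; rewrite ?l0 //.
  rewrite -(core_to_bounded_col _ sq fg w) eq /=; congr Posz; apply/eqP.
  rewrite -leqn0 leqNgt -has_count; apply/hasPn => x /(allP al).
  by rewrite -leqNgt.
by exists (P :: q); rewrite // eP eq.
Qed.

Lemma bounded_to_coreP lam : kbounded K.+1 lam ->
  is_core K.+2 (bounded_to_core K.+1 lam) /\
  core_to_bounded K.+1 (bounded_to_core K.+1 lam) = lam.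
Proof.
case/core_exists => p cp ep.
pose P q := is_core K.+2 q /\ core_to_bounded K.+1 q = lam.
by have := xgetPex [::] (ex_intro P p (conj cp ep)).
Qed.

(** The core chosen by [bounded_to_core] has the heights of [lam], so by rigidity its first gaps are
    those of the given window. Transposing it turns [Lw] into [Nw] in reverse order. *)
Lemma kconj_window lam (g : 'I_K.+2 -> int) c : kbounded K.+1 lam -> window g c ->
  (forall a : 'I_K.+2, Lw g a = (col_height lam a)%:Z) ->
  sorted geq (kconj K.+1 lam) /\
  forall a : 'I_K.+2, (col_height (kconj K.+1 lam) a)%:Z = Nw g (rev_ord a).
Proof.
move=> kl w hL; have [cp ep] := bounded_to_coreP kl.
rewrite /kconj; set p := bounded_to_core _ _ in cp ep *.
have sp : sorted geq p by case/andP: cp => /is_partition_sorted.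
have [d fg] := core_first_gaps cp.
have [g' w'] := valid_window (first_gaps_valid sp fg).
have ed : d = c.
  have [] // := window_uniq w' w.
  by move=> a; rewrite -(core_to_bounded_col _ sp fg w') ep hL.
subst d; have fg' := first_gaps_transpose sp fg.
have st := transpose_sorted p.
split; first exact: core_to_bounded_sorted fg'.
by move=> a; rewrite (core_to_bounded_col _ st fg' (tau_window w)) (Lw_tau _ w).
Qed.

End Cores.

(** * The Pieri rule *)

(* [D x] is the difference of the numbers of beads [>= x] after and before the
   strip.  Along a residue class it descends from 1 to 0, and it drops at [y]
   exactly when [y] lies in one of the intervals [(g a, g2 a]]. *)
Section StripConverse.
Variable K : nat.
Local Notation res := (@res K).
Local Notation n := (K.+2)%:Z.
Variables (g g' : 'I_K.+2 -> int) (c c' : state K).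
Hypotheses (w : window g c) (w' : window g' c').
Variable t : 'I_K.+2 -> bool.
Hypothesis hL : forall a, Lw g' a = Lw g a + (t a)%:Z.
Hypothesis hN : forall a, Nw g a <= Nw g' a.

(** The later bead set is moved up by one, the position in which a horizontal strip makes it
    interlace with the earlier one: the gaps of growing columns coincide, the others move up. *)
Let g2 a : int := g' a + 1.
Let c2 : state K := [ffun r => c' (r - 1) + 1].

Let hc r : res (c r) = r. Proof. exact: (proj1 (window_valid w)). Qed.
Let hc2 r : res (c2 r) = r.
Proof. by rewrite ffunE resD res1 (proj1 (window_valid w')) subrK. Qed.

Let c2g a : c2 (res (g2 a)) = g2 a.
Proof. by rewrite ffunE /g2 resD res1 addrK (win_res w'). Qed.

Let g2_surj r : exists a, res (g2 a) = r.
Proof.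
have [a ea] := win_surj w' (r - 1).
by exists a; rewrite /g2 resD res1 ea subrK.
Qed.

Let g2_inj a b : res (g2 a) = res (g2 b) -> a = b.
Proof. by rewrite /g2 !resD => /addIr /(win_inj w'). Qed.

Let g2_ge a : g a + (~~ t a)%:Z <= g2 a.
Proof.
have := win_formula w a; have := win_formula w' a; have := hN a; rewrite hL /g2.
by case: (t a); rewrite /=; lia.
Qed.

Let g2_le a : g a <= g2 a.
Proof. by apply: le_trans (g2_ge a); rewrite lerDl. Qed.

Let bc2 x : bc c2 (x + 1) = bc c' x.
Proof.
rewrite /bc [RHS](reindex_inj (h := fun r : 'Z_K.+2 => r - 1)) /=; last exact: addIr.
apply: eq_bigr => r _; rewrite ffunE lerD2r; case: ifP => // _.
by congr (_ %/ _)%Z; ring.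
Qed.

Let bc2g a : bc c2 (g2 a) = Lw g a + (t a)%:Z.
Proof. by rewrite bc2 (bc_window _ w') hL. Qed.

Let D x : int := bc c2 x - bc c x.

Let cov y : int := \sum_a ((g a < y) && (y <= g2 a))%R%:Z.

Let D_period x : D x = D (x + n) + cov (x + n).
Proof.
rewrite /D (bc_period c2) (bc_period c).
rewrite (sum_window (fun z => (x + n <= z)%R%:Z) w).
have -> : \sum_r (x + n <= c2 r)%R%:Z = \sum_a (x + n <= g2 a)%R%:Z.
  rewrite (reindex_inj (h := fun a => res (g2 a))) /=; last exact: g2_inj.
  by apply: eq_bigr => a _; rewrite c2g.
have -> : cov (x + n) = \sum_a (x + n <= g2 a)%R%:Z - \sum_a (x + n <= g a)%R%:Z.
  rewrite -sumrB; apply: eq_bigr => a _; have := g2_le a => h.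
  have [h1|h1] := ltP (g a) (x + n); first by rewrite subr0.
  by rewrite (le_trans h1 h).
by ring.
Qed.

Let cov_ge1 y a : g a < y -> y <= g2 a -> 1 <= cov y.
Proof.
move=> h1 h2; rewrite /cov (bigD1 a) //= h1 h2 lerDl.
by apply: sumr_ge0.
Qed.

Let cov_ge2 y a b : a != b -> g a < y -> y <= g2 a -> g b < y -> y <= g2 b -> 2 <= cov y.
Proof.
move=> ab h1 h2 h3 h4; rewrite /cov (bigD1 a) //= (bigD1 b) 1?eq_sym //= h1 h2 h3 h4 addrA.
by rewrite lerDl; apply: sumr_ge0.
Qed.

Let D_anti x y : x <= y -> res x = res y -> D y <= D x.
Proof.
move=> xy /esym/eqP; rewrite res_eq => /dvdzP[q e].
have q0 : 0 <= q by rewrite -(ler_pM2r (isT : 0 < n)) mul0r -e subr_ge0.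
have -> : y = x + `|q|%N%:Z * n by rewrite gez0_abs // -e; ring.
elim: `|q|%N => [|m IH]; first by rewrite mul0r addr0.
apply: le_trans IH; rewrite [X in _ <= X]D_period.
have -> : x + m%:Z * n + n = x + m.+1%:Z * n by lia.
by rewrite lerDl; apply: sumr_ge0.
Qed.

Let far_right x : exists y, [/\ x <= y, res x = res y & D y = 0].
Proof.
have [M hM] := state_bounds c; have [M2 hM2] := state_bounds c2.
exists (x + (`|x|%N + M + M2)%N%:Z * n); split.
- by rewrite lerDl mulr_ge0.
- by apply/eqP; rewrite eq_sym res_eq addrAC subrr add0r dvdz_mull.
have h : (`|x|%N + M + M2)%N%:Z <= (`|x|%N + M + M2)%N%:Z * n by rewrite ler_peMr.
rewrite /D !bc_large ?subrr // => r; have := hM r; have := hM2 r; lia.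
Qed.

Let far_left x : exists y, [/\ y <= x, res y = res x & D y = 1].
Proof.
have [M hM] := state_bounds c; have [M2 hM2] := state_bounds c'.
exists (x - (`|x|%N + M + M2).+1%:Z * n); split.
- by rewrite gerBl mulr_ge0.
- by apply/eqP; rewrite res_eq addrAC subrr sub0r -mulNr dvdz_mull.
have h : (`|x|%N + M + M2).+1%:Z <= (`|x|%N + M + M2).+1%:Z * n by rewrite ler_peMr.
set y := x - _; have y1 : y = y - 1 + 1 by rewrite subrK.
rewrite /D {1}y1 bc2 (bc_valid (window_valid w)) ?(bc_valid (window_valid w')); first by ring.
- by move=> r; have := hM2 r; rewrite /y; lia.
- by move=> r; have := hM r; rewrite /y; lia.
Qed.

Let D_ge0 x : 0 <= D x.
Proof. by have [y [xy e <-]] := far_right x; apply: D_anti. Qed.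

Let D_le1 x : D x <= 1.
Proof. by have [y [xy e <-]] := far_left x; apply: D_anti. Qed.

Let D_drop y a : g a < y -> y <= g2 a -> D (y - n) = 1 /\ D y = 0.
Proof.
move=> h1 h2; have := cov_ge1 h1 h2; have := D_period (y - n); rewrite subrK.
have := D_le1 (y - n); have := D_ge0 y; lia.
Qed.

Let D_t a : t a -> D (g a) = 1.
Proof.
move=> ta; apply/eqP; rewrite eq_le D_le1 /D (bc_window _ w).
have := bc_anti hc2 (g2_le a); rewrite bc2g ta /=; lia.
Qed.

Let t_fixed a : t a -> g2 a = g a.
Proof.
move=> ta; apply/eqP; rewrite eq_le g2_le andbT leNgt; apply/negP => lt.
have h : g a + 1 <= g2 a by lia.
have [|_ D0] := @D_drop (g a + 1) a _ h; first by lia.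
have := bc_succ hc (g a); rewrite (win_res w) ltxx addr0 (bc_window _ w) => e.
have := bc_anti hc2 h; rewrite bc2g ta; move: D0; rewrite /D -e /=; lia.
Qed.

Let nt_moves a : ~~ t a -> g a < g2 a.
Proof. by move=> ta; have := g2_ge a; rewrite ta /=; lia. Qed.

(** Along a residue class [D] never increases and stays in [{0, 1}], so it drops only once. *)
Let drop_uniq y z a b : res y = res z ->
  g a < y -> y <= g2 a -> g b < z -> z <= g2 b -> y = z.
Proof.
have le y1 y2 a1 a2 : res y1 = res y2 -> g a1 < y1 -> y1 <= g2 a1 ->
    g a2 < y2 -> y2 <= g2 a2 -> ~ y1 < y2.
  move=> e h1 h2 h3 h4 lt.
  have [_ d1] := D_drop h1 h2; have [d2 _] := D_drop h3 h4.
  have /eqP := e; rewrite eq_sym res_eq => /dvdzP[q eq].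
  have q0 : 0 < q by rewrite -(ltr_pM2r (isT : 0 < n)) mul0r -eq; lia.
  have : D (y2 - n) <= D y1; last by rewrite d1 d2.
  apply: D_anti.
    have : 1 * n <= q * n by rewrite ler_pM2r.
    by rewrite -eq mul1r; lia.
  rewrite e; apply/eqP; rewrite res_eq (_ : y2 - (y2 - n) = 1 * n) ?dvdz_mull //; ring.
move=> e h1 h2 h3 h4; have [lt|lt|//] := ltgtP y z.
  by case: (le _ _ _ _ e h1 h2 h3 h4).
by case: (le _ _ _ _ (esym e) h3 h4 h1 h2).
Qed.

Variable A : {set 'Z_K.+2}.
Hypothesis hA : forall a, (res (g a) \in A) = t a.

(** A class outside [A] drops at its own endpoint [g2 j]. If [z] were in this class it would be that
    same point, covered by two intervals, and [D] would fall by two. *)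
Let interior e z : g e < z -> z < g2 e -> res z \in A.
Proof.
move=> h1 h2; apply/negPn/negP => zA.
have [j ej] := g2_surj (res z).
have tj : ~~ t j.
  by apply: contra zA => tj; rewrite -ej t_fixed // hA.
have lj := nt_moves tj.
have ez := drop_uniq (esym ej) h1 (ltW h2) lj (lexx _).
have je : e != j by apply: contraTneq h2 => ->; rewrite ez ltxx.
rewrite -ez in lj.
have z2 : z <= g2 j by rewrite ez.
have := cov_ge2 je h1 (ltW h2) lj z2; have := D_period (z - n); rewrite subrK.
have := D_le1 (z - n); have := D_ge0 z; lia.
Qed.

(** Along the interval of a moving gap the carried gap is the current position. For [r] in [A] the
    drop of class [r] occurs inside such an interval, so the carried gap of class [r] is the point
    [y] of the drop, at least [n] above [c r], and every letter can act. *)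
Lemma strip_converse m : m \notin A -> actw (cdesc m A) c = Some c'.
Proof.
move=> mA; have [C hC] := carry_exists c mA.
have Ce e (i : nat) : ~~ t e -> g e + i%:Z < g2 e -> C (res (g e + i%:Z)) = g e + i%:Z.
  move=> te; elim: i => [|i IH] lt.
    by rewrite addr0 hC hA (negbTE te) (win_res w).
  rewrite hC (interior (e := e)) //; last by lia.
  have -> : res (g e + i.+1%:Z) - 1 = res (g e + i%:Z).
    by rewrite -res1 -resB; congr res; lia.
  by rewrite IH; lia.
have Cr r : r \in A -> exists2 y, C r = y & c r < y - 1.
  move=> rA; have [a ea] := win_surj w r; have ta : t a by rewrite -hA ea.
  have [z [az ez Dz]] := far_right (g a).
  have /eqP := ez; rewrite eq_sym res_eq => /dvdzP[q eq].
  have q0 : 0 <= q by rewrite -(ler_pM2r (isT : 0 < n)) mul0r -eq; lia.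
  have ex : exists j : nat, D (g a + j%:Z * n) == 0.
    by exists `|q|%N; rewrite gez0_abs // -eq -Dz; apply/eqP; congr D; ring.
  case: (ex_minnP ex) => -[|j] /eqP dj jmin.
    by move: dj; rewrite mul0r addr0 D_t.
  set y := g a + j.+1%:Z * n in dj.
  have yE : y - n = g a + j%:Z * n by rewrite /y; lia.
  have ry : res y = res (g a).
    by apply/eqP; rewrite res_eq /y addrAC subrr add0r dvdz_mull.
  have yn : g a <= y - n by rewrite yE lerDl mulr_ge0.
  have d1 : D (y - n) != 0.
    by apply/eqP => /eqP; rewrite yE => /jmin; rewrite ltnn.
  have cy : 0 < cov y.
    have := D_period (y - n); rewrite subrK dj add0r => <-.
    by rewrite lt_neqAle eq_sym d1 D_ge0.
  have [e /andP[e1 e2]] : exists e, (g e < y) && (y <= g2 e).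
    apply/existsP; apply: contraTT cy => /existsPn h.
    by rewrite -leNgt /cov big1 // => b _; rewrite (negbTE (h b)).
  have te : ~~ t e by apply/negP => te; move: e1 e2; rewrite t_fixed //; lia.
  have ne : y != g2 e.
    apply: contra te => /eqP ye; have : res (g2 a) = res (g2 e) by rewrite -ye ry t_fixed.
    by move/g2_inj => <-.
  have lt : y < g2 e by rewrite lt_neqAle ne.
  exists y; last by rewrite -ea (win_res w); lia.
  have := Ce e `|(y - g e)%R|%N te; rewrite gez0_abs ?subr_ge0 1?ltW //.
  by rewrite (addrC (g e)) subrK => /(_ lt); rewrite ry ea.
have cond r : r \in A -> c r < C (r - 1).
  by move=> rA; have [y ey] := Cr r rA; rewrite -ey hC rA addrK.
rewrite (actw_cdesc mA hC cond); congr Some; apply/ffunP => s; rewrite ffunE.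
have [j ej] := g2_surj (s + 1).
have es : res (g2 j - 1) = s by rewrite resB res1 ej addrK.
have cs : c' s = g2 j - 1.
  by have := c2g j; rewrite ffunE ej addrK => <-; rewrite addrK.
rewrite cs; case: ifP => sA.
  have [a ea] := win_surj w (s + 1); have ta : t a by rewrite -hA ea.
  have -> : j = a by apply: g2_inj; rewrite (t_fixed ta) ej ea.
  by rewrite -ea (win_res w) t_fixed.
have tj : ~~ t j.
  by apply/negP => tj; move: ej; rewrite t_fixed // => ej; rewrite -ej hA tj in sA.
have lj := nt_moves tj.
have := Ce j `|(g2 j - 1 - g j)%R|%N tj; rewrite gez0_abs; last by lia.
have -> : g j + (g2 j - 1 - g j) = g2 j - 1 by ring.
by rewrite es => -> //; lia.
Qed.

End StripConverse.

(** * Vertical strips of k-conjugates *)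

Section StripForward.
Variable K : nat.
Local Notation res := (@res K).
Local Notation n := (K.+2)%:Z.
Implicit Types (A : {set 'Z_K.+2}) (g : 'I_K.+2 -> int) (c : state K).

Lemma Nw_mono g c (a b : 'I_K.+2) : window g c -> (a <= b)%N -> Nw g a <= Nw g b.
Proof.
move=> w ab; rewrite /Nw [X in _ <= X](bigID (fun i : 'I_K.+2 => (i < a)%N)) /=.
rewrite -[X in X <= _]addr0 lerD //; last first.
  by apply: sumr_ge0 => i /andP[ib _]; rewrite divz_ge0 // subr_ge0 ltW // (win_inc w).
rewrite [X in _ <= X](eq_bigl (fun i : 'I_K.+2 => (i < a)%N)); last first.
  move=> i; case: (ltnP i a) => ia; rewrite ?andbF // andbT.
  by apply: leq_trans ab.
by apply: ler_sum => i bi; apply: floor_mono => //; rewrite lerB // (win_le w).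
Qed.

(** A climbing gap meets the class of a smaller first gap at each unit step, so [Nw] rises by the
    length of the climb, which cannot pass the next first gap. The second conclusion is the vertical
    strip condition, the columns of the k-conjugate being in reverse order. *)
Lemma strip_Nw A g g' c c' : window g c -> window g' c' -> strip A g g' ->
  (forall a, Nw g a <= Nw g' a) /\
  (forall e b : 'I_K.+2, nat_of_ord b = e.+1 -> Nw g' e <= Nw g b).
Proof.
move=> w w' [hL h1 h2].
have NE a : Nw g' a = Nw g a + (g' a - g a) + (res (g a) \in A)%:Z.
  have := win_formula w a; have := win_formula w' a; rewrite hL.
  by move: (_ \in _) => u; lia.
split=> [a|e b eb].
  rewrite NE; case: (boolP (res (g a) \in A)) => aA; first by rewrite h1 //=; lia.
  by have [l -> _] := h2 a aA; rewrite /=; lia.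
have eb' : (e < b)%N by rewrite eb.
rewrite NE; case: (boolP (res (g e) \in A)) => eA.
  by rewrite h1 //=; have := Nw_mono w (ltnW eb'); lia.
have [l -> hl] := h2 e eA; rewrite /=.
have cnt (i : nat) : (i <= l)%N ->
    \sum_(a < K.+2 | (a < e)%N) ((g e + i%:Z - g a) %/ n)%Z = Nw g e + i%:Z.
  elim: i => [|i IH] il; first by rewrite addr0 [RHS]addr0.
  have -> : g e + i.+1%:Z = (g e + i%:Z) + 1 by lia.
  rewrite (gap_count_step e (g e + i%:Z) w) (IH (ltnW il)).
  have [a ae ea] := hl i il.
  have -> : [exists a : 'I_K.+2, (a < e)%N && (res (g a) == res (g e + i%:Z + 1))].
    apply/existsP; exists a; rewrite ae ea /=; apply/eqP; congr res; lia.
  by rewrite /=; lia.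
have gb : g e + l%:Z <= g b.
  rewrite leNgt; apply/negP => lt; have lt2 := win_inc w eb'.
  have il : (`|(g b - g e - 1)%R|%N < l)%N by lia.
  have [a ae ea] := hl _ il.
  have : a = b.
    by apply: (win_inj w); rewrite /= ea; congr res; lia.
  by move=> ab; move: ae; rewrite ab ltnNge (ltnW eb').
have -> : Nw g e + (g e + l%:Z - g e) + 0 = Nw g e + l%:Z by ring.
rewrite -cnt // /Nw [X in _ <= X](bigID (fun i : 'I_K.+2 => (i < e)%N)) /=.
rewrite -[X in X <= _]addr0 lerD //; last first.
  by apply: sumr_ge0 => i /andP[ib _]; rewrite divz_ge0 // subr_ge0 ltW // (win_inc w).
rewrite [X in _ <= X](eq_bigl (fun i : 'I_K.+2 => (i < e)%N)); last first.
  move=> i; case: (ltnP i e) => ia; rewrite ?andbF // andbT.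
  by apply: ltn_trans eb'.
by apply: ler_sum => i bi; apply: floor_mono => //; rewrite lerD2r.
Qed.

End StripForward.

(** * Strip conditions in terms of column heights *)

Section StripsOfPartitions.
Local Open Scope nat_scope.
Implicit Types kap mu : seq nat.

Lemma subpartP kap mu : sorted geq kap -> sorted geq mu ->
  subpart mu kap <-> forall j, col_height mu j <= col_height kap j.
Proof.
move=> sk sm; split=> [/allP h j|h].
  rewrite leqNgt; apply/negP => lt; have := lt; rewrite -ltn_nth_col // => lt'.
  have rs : col_height kap j < size mu.
    by rewrite ltnNge; apply/negP => h'; rewrite nth_default in lt'.
  have := h (col_height kap j); rewrite mem_iota add0n rs => /(_ isT) le.
  by have := leq_trans lt' le; rewrite ltn_nth_col // ltnn.
apply/allP => r _; rewrite leqNgt; apply/negP => lt; have := lt.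
rewrite ltn_nth_col // => lt'; have := leq_trans lt' (h _).
by rewrite -ltn_nth_col // ltnn.
Qed.

Lemma horizontal_stripP kap mu : sorted geq kap -> sorted geq mu ->
  horizontal_strip kap mu <->
  forall j, col_height mu j <= col_height kap j <= (col_height mu j).+1.
Proof.
move=> sk sm; split=> [/andP[/(subpartP sk sm) h /allP h1] j|h].
  rewrite h /=; case: (ltnP j (head 0 kap)) => jk.
    have := h1 j; rewrite mem_iota add0n jk => /(_ isT).
    by rewrite leq_subLR addn1.
  have -> : col_height kap j = 0; last by [].
  by apply/eqP; rewrite -leqn0 leqNgt -ltn_nth_col // nth0 -leqNgt.
apply/andP; split; first by apply/(subpartP sk sm) => j; case/andP: (h j).
by apply/allP => j _; rewrite leq_subLR addn1; case/andP: (h j).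
Qed.

Lemma vertical_strip_intro kap mu : sorted geq kap -> sorted geq mu ->
  (forall j, col_height mu j <= col_height kap j) ->
  (forall j, col_height kap j.+1 <= col_height mu j) -> vertical_strip kap mu.
Proof.
move=> sk sm h1 h2; apply/andP; split; first exact/(subpartP sk sm).
apply/allP => r _; rewrite leq_subLR addn1 leqNgt; apply/negP.
rewrite ltn_nth_col // => lt; have := leq_trans lt (h2 _).
by rewrite -ltn_nth_col // ltnn.
Qed.

End StripsOfPartitions.

(** * Pieri strips and the sets acting on a core *)

Section Pieri.
Variable K : nat.
Local Notation res := (@res K).
Local Notation n := (K.+2)%:Z.
Implicit Types (A : {set 'Z_K.+2}) (g : 'I_K.+2 -> int) (c : state K) (kap mu : seq nat).

Definition pieri_strip kap mu : bool :=
  horizontal_strip kap mu && vertical_strip (kconj K.+1 kap) (kconj K.+1 mu).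

Section OneStep.
Variables (mu : seq nat) (g : 'I_K.+2 -> int) (c : state K).
Hypotheses (km : kbounded K.+1 mu) (w : window g c).
Hypothesis hL : forall a : 'I_K.+2, Lw g a = (col_height mu a)%:Z.

Lemma kbounded_sorted lam : kbounded K.+1 lam -> sorted geq lam.
Proof. by move/kbounded_partition/is_partition_sorted. Qed.

Lemma col_height_ord (P : nat -> Prop) : (forall a : 'I_K.+2, P a) ->
  (forall j, (K.+2 <= j)%N -> P j) -> forall j, P j.
Proof. by move=> h1 h2 j; case: (ltnP j K.+2) => [jk|/h2 //]; apply: (h1 (Ordinal jk)). Qed.

Lemma kconj_col_ge lam d e j : kbounded K.+1 lam -> window d e ->
  (forall a : 'I_K.+2, Lw d a = (col_height lam a)%:Z) -> (K.+1 <= j)%N ->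
  col_height (kconj K.+1 lam) j = 0%N.
Proof.
move=> kl wd hd Kj; have [_ h] := kconj_window kl wd hd.
apply/eqP; rewrite -leqn0; apply: leq_trans (col_height_mono _ Kj) _.
have := h ord_max; have -> : Nw d (rev_ord ord_max) = 0.
  by rewrite /Nw big_pred0 // => a; rewrite /= subSS subnn.
by move=> /= [->].
Qed.

Lemma pieri_forward A m c' : m \notin A -> actw (cdesc m A) c = Some c' ->
  exists kap, [/\ kbounded K.+1 kap, sumn kap = (sumn mu + #|A|)%N,
    pieri_strip kap mu, core_state K kap = Some c' &
    forall a : 'I_K.+2, col_height kap a = (col_height mu a + (res (g a) \in A))%N].
Proof.
move=> mA Hc; have [g' w' st] := actw_cdesc_strip mA w Hc.
have [kap kk hk] := window_shape w'.
have [hL' _ _] := st.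
have hcol (a : 'I_K.+2) : col_height kap a = (col_height mu a + (res (g a) \in A))%N.
  by apply/eqP; rewrite -eqz_nat -hk hL' hL PoszD.
exists kap; split=> //; last exact: core_stateP kk w' hk.
  apply/eqP; rewrite -eqz_nat PoszD (sumn_col_ord kk) (sumn_col_ord km).
  rewrite -(card_res_window A w) -big_split /=.
  by apply/eqP/eq_bigr => a _; rewrite hcol PoszD.
have [sk hck] := kconj_window kk w' hk; have [sm hcm] := kconj_window km w hL.
have [N1 N2] := strip_Nw w w' st.
apply/andP; split.
  apply/(horizontal_stripP (kbounded_sorted kk) (kbounded_sorted km)).
  apply: col_height_ord => [a|j jk].
    by rewrite hcol; case: (_ \in _); rewrite ?addn0 ?addn1 leqnn leqnSn.
  by rewrite (col_height_ge kk) ?(col_height_ge km) // ltnW.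
apply: vertical_strip_intro => //; apply: col_height_ord => [a|j jk].
- by rewrite -lez_nat hck hcm.
- by rewrite (kconj_col_ge km w hL) // ltnW.
- case: (ltnP a.+1 K.+2) => ak; last first.
    by rewrite (kconj_col_ge kk w' hk) // ltnW.
  have := hck (Ordinal ak); rewrite -lez_nat /= => ->; rewrite hcm.
  by apply: N2 => /=; have := ltn_ord a; lia.
- by rewrite (kconj_col_ge kk w' hk) // leqW // ltnW.
Qed.

Definition strip_res kap : {set 'Z_K.+2} :=
  [set res (g a) | a : 'I_K.+2 & col_height kap a != col_height mu a].

Lemma strip_resE kap (a : 'I_K.+2) :
  (res (g a) \in strip_res kap) = (col_height kap a != col_height mu a).
Proof.
apply/imsetP/idP => [[b]|h]; last by exists a; rewrite ?inE.
by rewrite inE => h /(win_inj w) ->.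
Qed.

Lemma pieri_converse kap : kbounded K.+1 kap -> pieri_strip kap mu ->
  [/\ strip_res kap \proper [set: 'Z_K.+2],
      sumn kap = (sumn mu + #|strip_res kap|)%N &
      forall m, m \notin strip_res kap -> actw (cdesc m (strip_res kap)) c = core_state K kap].
Proof.
move=> kk /andP[/(horizontal_stripP (kbounded_sorted kk) (kbounded_sorted km)) hh vs].
have hcol (a : 'I_K.+2) : (col_height kap a)%:Z =
    (col_height mu a)%:Z + (res (g a) \in strip_res kap)%:Z.
  by rewrite strip_resE; have := hh a; case: eqP => [->|]; lia.
split.
- apply: (sub_properT (m := res (g ord_max))).
  by rewrite strip_resE (col_height_ge kk) ?(col_height_ge km).
- apply/eqP; rewrite -eqz_nat PoszD (sumn_col_ord kk) (sumn_col_ord km).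
  rewrite -(card_res_window _ w) -big_split /=.
  by apply/eqP/eq_bigr => a _; rewrite hcol.
move=> m mA; have [g' [c' [-> w' hL']]] := core_state_window kk.
apply: (strip_converse w w' (t := fun a => res (g a) \in strip_res kap)) => //.
  by move=> a; rewrite hL' hL hcol.
have [sk hck] := kconj_window kk w' hL'; have [sm hcm] := kconj_window km w hL.
case/andP: vs => /(subpartP sk sm) h _ a.
by have := h (rev_ord a); rewrite -lez_nat hck hcm rev_ordK.
Qed.

End OneStep.
End Pieri.

(** * The value of a k-Schur function on the empty core *)

Section Expansion.
Variables (K : nat) (R : comNzRingType).
Local Notation res := (@res K).
Local Notation vac := (vac K).
Local Notation ev := (@ev K R).
Local Notation pull := (@pull K R).
Local Notation core_state := (core_state K).
Implicit Types (A : {set 'Z_K.+2}) (g : 'I_K.+2 -> int) (c : state K) (kap mu lam : seq nat).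

Lemma pieri_col mu g c kap : kbounded K.+1 mu -> window g c -> kbounded K.+1 kap ->
  pieri_strip K kap mu -> forall a : 'I_K.+2,
  col_height kap a = (col_height mu a + (res (g a) \in strip_res mu g kap))%N.
Proof.
move=> km w kk /andP[/(horizontal_stripP (kbounded_sorted kk) (kbounded_sorted km)) hh _] a.
rewrite (strip_resE _ w); have := hh a.
case: eqP => [->|ne] /=; first by rewrite addn0.
by case/andP => h1 h2; apply/eqP; rewrite addn1 eqn_leq h2 ltn_neqAle h1 eq_sym; move/eqP: ne => ->.
Qed.

(** [strip_res] is a bijection from the Pieri strips over [mu] onto the sets of size [l] that do not
    kill the core of [mu]; all other sets contribute zero. *)
Lemma pieri_sum mu g c (l : nat) (F : state K -> R) : kbounded K.+1 mu -> window g c ->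
  (forall a : 'I_K.+2, Lw g a = (col_height mu a)%:Z) -> (l <= K.+1)%N ->
  \sum_(A : {set 'Z_K.+2} | #|A| == l) pull (cyc_desc (k := K.+1) A) F c =
  \sum_(kap <- kbparts K.+1 (sumn mu + l) | pieri_strip K kap mu)
    oapp F 0 (core_state kap).
Proof.
move=> km w hL lK; rewrite -[RHS]big_filter; set S := filter _ _.
have memS kap : (kap \in S) =
    [&& pieri_strip K kap mu, kbounded K.+1 kap & sumn kap == (sumn mu + l)%N].
  by rewrite mem_filter mem_kbparts.
have sizeS kap : kap \in S -> #|strip_res mu g kap| = l.
  rewrite memS => /and3P[ps kk /eqP ss].
  by have [_ e _] := pieri_converse km w hL kk ps; apply/eqP; rewrite -(eqn_add2l (sumn mu)) -e ss.
have uS : uniq [seq strip_res mu g kap | kap <- S].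
  rewrite map_inj_in_uniq ?filter_uniq ?uniq_kbparts //.
  move=> k1 k2; rewrite !memS => /and3P[p1 b1 _] /and3P[p2 b2 _] e.
  apply: (kbounded_col_inj b1 b2) => j jK.
  have jK' : (j < K.+2)%N by apply: ltnW.
  have := pieri_col km w b1 p1 (Ordinal jK'); have := pieri_col km w b2 p2 (Ordinal jK').
  by rewrite /= e => -> ->.
transitivity (\sum_(A <- [seq strip_res mu g kap | kap <- S])
    pull (cyc_desc (k := K.+1) A) F c); last first.
  rewrite big_map big_seq [RHS]big_seq; apply: eq_bigr => kap; rewrite memS => /and3P[ps kk _].
  have [pA _ hA] := pieri_converse km w hL kk ps.
  by have [m mA ->] := cyc_descE pA; rewrite /pull hA.
rewrite big_uniq // big_mkcond [RHS]big_mkcond; apply: eq_bigr => A _.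
case: (boolP (A \in _)) => [/mapP[kap kS ->]|nA]; first by rewrite sizeS // eqxx.
case: eqP => // cA.
have pA : A \proper [set: 'Z_K.+2].
  by rewrite finset.properEcard finset.subsetT /= cardsT card_ord cA.
have [m mA ->] := cyc_descE pA.
rewrite /pull; case E: (actw _ c) => [c'|] //=.
have [kap [kk ss ps _ hcol]] := pieri_forward km w hL mA E.
case/negP: nA; apply/mapP; exists kap; first by rewrite memS ps kk ss cA eqxx.
apply/setP => r; have [a <-] := win_surj w r; rewrite (strip_resE _ w) hcol.
by case: (_ \in A); rewrite ?addn0 ?eqxx // addn1 gtn_eqF.
Qed.

Lemma pieri_add_row (l : nat) mu : (0 < l)%N -> kbounded K.+1 (l :: mu) ->
  pieri_strip K (l :: mu) mu.
Proof.
move=> l0 klm; have := klm; rewrite /kbounded is_partition_cons /=.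
case/andP=> /and3P[_ al pm] /andP[lK bm].
have km : kbounded K.+1 mu by apply/andP.
have [g [c [_ w hL]]] := core_state_window km.
pose A := [set res (g a) | a : 'I_K.+2 & (a < l)%N].
have hA a : (res (g a) \in A) = (a < l)%N.
  apply/imsetP/idP => [[b]|h]; last by exists a; rewrite ?inE.
  by rewrite inE => h /(win_inj w) ->.
have lK' : (l < K.+2)%N by rewrite ltnS.
have mA : res (g (Ordinal lK')) \notin A by rewrite hA ltnn.
have := actw_add_row (l := Ordinal lK') w mA hA; case E: (actw _ c) => [c'|] // _.
have [kap [kk _ ps _ hcol]] := pieri_forward km w hL mA E.
have <- : kap = l :: mu; last by [].
apply: (kbounded_col_inj kk klm) => j jK.
have jK' : (j < K.+2)%N by apply: ltnW.
by have := hcol (Ordinal jK'); rewrite hA /= => ->; rewrite addnC.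
Qed.

(** A horizontal strip adds at most one box per column, so [kap] without its first row lies inside
    [mu]. Hence the first row has at least [l] boxes, and with exactly [l] the rest is [mu]. *)
Lemma pieri_head (l : nat) mu kap : kbounded K.+1 mu -> kbounded K.+1 kap ->
  (0 < l)%N -> sumn kap = (sumn mu + l)%N -> horizontal_strip kap mu ->
  kap <> l :: mu -> (l < head 0%N kap)%N.
Proof.
move=> km kk l0; case: kap kk => [|x kap] kk /= ss hs ne; first by lia.
have kk' : kbounded K.+1 kap.
  by move: kk; rewrite /kbounded is_partition_cons /= => /andP[/and3P[_ _ ->] /andP[_ ->]].
have /(horizontal_stripP (kbounded_sorted kk) (kbounded_sorted km)) h := hs.
have le j : (col_height kap j <= col_height mu j)%N.
  have /andP[_] := h j; rewrite /col_height /= -!/(col_height _ _).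
  case: (ltnP j x) => [_|xj _]; first by rewrite add1n ltnS.
  have -> : col_height kap j = 0%N; last by [].
  apply/eqP; rewrite -leqn0 leqNgt -(ltn_nth_col _ _ (kbounded_sorted kk')) -leqNgt.
  apply: leq_trans xj; move: kk; rewrite /kbounded is_partition_cons => /andP[/and3P[_ al _] _].
  by case: (kap) al => [|y p] //= /andP[].
have sle : (sumn kap <= sumn mu)%N.
  by rewrite (kbounded_sumn kk') (kbounded_sumn km); apply: leq_sum => i _.
rewrite ltnNge; apply/negP => xl; apply: ne.
have xE : x = l by lia.
have se : sumn kap = sumn mu by lia.
rewrite xE; congr cons; apply: (kbounded_col_inj kk' km) => j jK.
move: se; rewrite (kbounded_sumn kk') (kbounded_sumn km) => /eqP.
rewrite eq_sym.
have := leqif_sum (I := 'I_K.+1) (P := predT)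
  (E1 := fun i => col_height kap i) (E2 := fun i => col_height mu i)
  (C := fun i => col_height kap i == col_height mu i) (fun i _ => leqif_eq (le i)).
case=> _ e; rewrite eq_sym e => /forallP /(_ (Ordinal jK)) /=.
by move/eqP.
Qed.

Section KSchur.
Variables (s : seq nat -> nilcox K.+1 R) (hs : is_kSchur s).

(** Induction on the size and, within a size, downwards on the first row. In the Pieri expansion of
    [h l * s mu] all terms except [l :: mu] have a longer first row, so they cancel against the
    action of [h l] on the core of [mu]. *)
Lemma ev_kSchur lam (F : state K -> R) : kbounded K.+1 lam ->
  ev F vac (s lam) = oapp F 0 (core_state lam).
Proof.
move: {2}(sumn lam) (leqnn (sumn lam)) => N.
elim: N lam F => [|N IHN] lam F.
  case: lam => [|l mu] /=.
    move=> _ _; rewrite (kSchur_nil hs).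
    have -> : 1 = mono R [::] :> nilcox K.+1 R by rewrite /mono big_nil.
    by rewrite ev_mono.
  by rewrite leqn0 addn_eq0 => /andP[/eqP -> _]; rewrite /kbounded is_partition_cons.
have step (l : nat) mu F' : (0 < l)%N -> kbounded K.+1 (l :: mu) -> (sumn (l :: mu) <= N.+1)%N ->
    (forall kap F2, kbounded K.+1 kap -> (sumn kap <= N.+1)%N -> (l < head 0%N kap)%N ->
       ev F2 vac (s kap) = oapp F2 0 (core_state kap)) ->
    ev F' vac (s (l :: mu)) = oapp F' 0 (core_state (l :: mu)).
  move=> l0 kl hN IHk.
  have := kl; rewrite /kbounded is_partition_cons /= => /andP[/and3P[_ al pm] /andP[lK bm]].
  have km : kbounded K.+1 mu by apply/andP.
  have [g [c [ec w hL]]] := core_state_window km.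
  have sN : (sumn mu <= N)%N by move: hN => /=; lia.
  have := kSchur_pieri hs (l := l) _ km; rewrite l0 lK => /(_ isT) /(congr1 (ev F' vac)).
  have -> : ev F' vac (h K.+1 R l * s mu) =
      \sum_(kap <- kbparts K.+1 (sumn mu + l) | pieri_strip K kap mu) oapp F' 0 (core_state kap).
    (* The functional pulled back along [d_A] is applied to [s mu], whose value is known for every
       functional by induction on the size. *)
    rewrite -(pieri_sum F' km w hL lK) /h mulr_suml ev_sum; apply: eq_bigr => A _.
    by rewrite /dA ev_monoM IHN // ec.
  rewrite ev_sum => e.
  pose S := [seq kap <- kbparts K.+1 (sumn mu + l) | pieri_strip K kap mu].
  have {}e : \sum_(kap <- S) oapp F' 0 (core_state kap) = \sum_(kap <- S) ev F' vac (s kap).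
    by rewrite /S !big_filter; exact: e.
  have lin : l :: mu \in S.
    by rewrite mem_filter mem_kbparts kl pieri_add_row //= addnC eqxx.
  have uS : uniq S by rewrite filter_uniq // uniq_kbparts.
  move: e; rewrite !(bigD1_seq (l :: mu)) //=.
  have -> : \sum_(kap <- S | kap != l :: mu) ev F' vac (s kap) =
      \sum_(kap <- S | kap != l :: mu) oapp F' 0 (core_state kap).
    rewrite big_seq_cond [RHS]big_seq_cond; apply: eq_bigr => kap.
    rewrite mem_filter mem_kbparts => /andP[/and3P[/andP[hz _] kk /eqP ss] /eqP ne].
    apply: IHk => //; first by rewrite ss; move: hN => /=; lia.
    exact: pieri_head km kk l0 ss hz ne.
  by move/addIr.
have headle kap : (head 0 kap <= sumn kap)%N by case: kap => //= x kap; apply: leq_addr.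
move: {2}(N.+1 - head 0 lam)%N (leqnn (N.+1 - head 0 lam)%N) => d.
elim: d lam F => [|d IHd] [|l mu] F hd hN kl; try exact: (IHN [::]).
  have l0 : (0 < l)%N by move: kl; rewrite /kbounded is_partition_cons => /andP[/and3P[]].
  (* Here [l] is at least [N.+1], so no partition of size at most [N.+1] has a longer first row. *)
  apply: step => // kap F2 kk sk lk; move: hd => /=; have := headle kap; lia.
have l0 : (0 < l)%N by move: kl; rewrite /kbounded is_partition_cons => /andP[/and3P[]].
apply: step => // kap F2 kk sk lk; apply: IHd => //.
by move: hd => /=; have := headle kap; lia.
Qed.

(** The indicator of the core [c] created by [w] sees no other summand, since a different monomial
    creates another core or none. The nonzero coefficient of [mono R w] then shows that [s lam]
    creates [c]. *)
Lemma summand_core_state lam (w : seq 'Z_K.+2) : kbounded K.+1 lam ->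
  mono R w != 0 -> dominant0 (mono R w) -> is_summand (mono R w) (s lam) ->
  exists2 c, actw w vac = Some c & core_state lam = Some c.
Proof.
move=> kl nz dom [ys [cf [uys hys es xys]]].
have [c hc] := dominant_word nz dom; exists c => //.
pose F (d : state K) : R := (d == c)%:R.
have := ev_kSchur F kl; rewrite es ev_sum (bigD1_seq _ xys uys) /= big_seq_cond big1.
  rewrite addr0 evZ ev_mono /pull hc /= /F eqxx mulr1.
  have [_ cnz] := hys _ xys.
  case: (core_state lam) => [d|] /=; last by move=> e; rewrite e eqxx in cnz.
  by case: eqP => [->|_] // e; rewrite e eqxx in cnz.
move=> y /andP[/hys [[ynz [wy ey]] _] ne]; rewrite evZ ey ev_mono /pull.
case E: (actw wy vac) => [d|] /=; rewrite ?mulr0 // /F.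
case: eqP => [ed|_]; last by rewrite mulr0.
by rewrite ed in E; case/eqP: ne; rewrite ey; exact: (mono_uniq R E hc).
Qed.
End KSchur.

(** * The maximal factorization and the code RD *)

Section Codes.
Implicit Types As Bs : seq {set 'Z_K.+2}.

(** The carry and the resulting state do not mention the starting residue. This bridges the residue
    chosen by [cyc_desc] for a negated set and the negative of the one chosen for the set itself. *)
Lemma cdesc_indep A m m' g c : m \notin A -> m' \notin A -> window g c ->
  actw (cdesc m A) c = actw (cdesc m' A) c.
Proof.
have half m1 m2 d : m1 \notin A -> m2 \notin A -> window g c ->
    actw (cdesc m1 A) c = Some d -> actw (cdesc m2 A) c = Some d.
  move=> h1 h2 w e; have [C hC] := carry_exists c h1.
  have cond a : a \in A -> c a < C (a - 1).
    move=> aA; apply: (actw_pcdesc_cond h1 hC (leqnn K.+1)) => //; last exact: rk_le.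
    by rewrite pcdescT e.
  by rewrite -e (actw_cdesc h1 hC cond) (actw_cdesc h2 hC cond).
move=> h1 h2 w; case E: (actw (cdesc m A) c) => [d|]; first by rewrite (half _ _ _ h1 h2 w E).
by case E': (actw (cdesc m' A) c) => [d|] //; rewrite (half _ _ _ h2 h1 w E') in E.
Qed.

(** With [phi] the identity this serves [d], with negation of residues it serves [u]. Any maximal
    factorization has sizes [lam], attained by the filling by rows and, up to [phi], only by it;
    this identifies the chosen one. *)
Lemma max_factorizationE (f : {set 'Z_K.+2} -> nilcox K.+1 R) x phi lam g c :
  involutive phi -> (forall A, #|phi A| = #|A|) ->
  (forall As, is_factorization f x As <->
    strips_ok (map phi As) /\ actw (wordd (map phi As)) vac = Some c) ->
  kbounded K.+1 lam -> window g c ->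
  (forall a : 'I_K.+2, Lw g a = (col_height lam a)%:Z) ->
  max_factorization f x = map phi (row_sets K lam).
Proof.
move=> phiK cphi hf kl w hL.
have sphi As : sizes (k := K.+1) (map phi As) = sizes (k := K.+1) As.
  by rewrite /sizes -map_comp; apply: eq_map => A /=; rewrite cphi.
have mphiK : involutive (map phi) by move=> As; apply: mapK.
have le As : is_factorization f x As -> (sizes (k := K.+1) As <= (lam : seqlexi nat))%O.
  by case/hf => ok Hc; rewrite -sphi; apply: (factorization_le kl w hL).
have max0 : is_max_factorization f x (map phi (row_sets K lam)).
  split; first apply/hf; rewrite ?mphiK.
    by split; [apply: row_sets_ok|apply: (core_stateP kl w hL)].
  by move=> Bs /le; rewrite sphi sizes_row_sets.
have := xgetPex [::] (ex_intro (fun As => is_max_factorization f x As) _ max0).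
rewrite -/(max_factorization f x); set M := max_factorization f x => -[fM maxM].
have sM : sizes (k := K.+1) M = lam.
  apply: le_anti; rewrite (le _ fM) /= -{1}(sizes_row_sets kl) -sphi.
  exact: maxM (proj1 max0).
have [ok Hc] := proj1 (hf M) fM.
rewrite -(factorization_uniq kl w hL ok Hc) ?mphiK //.
by rewrite sphi.
Qed.

Lemma mono_eq_actw (w w' : seq 'Z_K.+2) c : actw w vac = Some c ->
  mono R w = mono R w' :> nilcox K.+1 R <-> actw w' vac = Some c.
Proof.
move=> h; split=> [e|h']; first by rewrite -(mono_actw vac e).
exact: (mono_uniq R h h').
Qed.

(** For RI, [lam] is the k-conjugate, given by its columns, and [lam'] the bounded partition of the
    transposed state; boundedness of [lam'] makes the last entry zero. *)
Lemma code_vectorE (alpha : 'Z_K.+2 -> nat) lam lam' : kbounded K.+1 lam' ->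
  (forall a : 'I_K.+2, alpha a = col_height lam' a) ->
  (forall a : 'I_K.+2, col_height lam a = col_height lam' a) ->
  code_vector (k := K.+1) alpha = rcons (mkseq (col_height lam) K.+1) 0%N.
Proof.
move=> kl ha hl; have -> : 0%N = col_height lam K.+1.
  by rewrite (hl ord_max) (col_height_ge kl).
rewrite -mkseqS /mkseq -val_enum_ord -map_comp /code_vector.
by apply: eq_map => a /=; rewrite ha hl.
Qed.

Lemma mem_nth_row_sets lam r (j : nat) : (j < size lam)%N ->
  (r - j%:R \in nth finset.set0 (row_sets K lam) j) = (r < nth 0 lam j)%N.
Proof. by move=> js; rewrite nth_mkseq // inE subrK. Qed.

Lemma RD_word (w : seq 'Z_K.+2) lam g c : kbounded K.+1 lam -> actw w vac = Some c ->
  window g c -> (forall a : 'I_K.+2, Lw g a = (col_height lam a)%:Z) ->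
  forall r, RD (mono R w : nilcox K.+1 R) r = col_height lam r.
Proof.
move=> kl hw wg hL r; rewrite /RD.
rewrite (max_factorizationE (phi := id) (lam := lam) (g := g) (c := c)) //; last first.
  move=> As; rewrite map_id /is_factorization /dA mono_flatten.
  by split=> -[ok /(mono_eq_actw _ hw)] //; split => //; apply/(mono_eq_actw _ hw).
rewrite map_id size_mkseq /col_height.
rewrite -[in RHS](mkseq_nth 0%N lam) count_map; apply: eq_in_count => j.
by rewrite mem_iota add0n => /andP[_ js]; rewrite mem_nth_row_sets.
Qed.

End Codes.
End Expansion.

(** * Transposition *)

Section Transposition.
Variables (K : nat) (R : comNzRingType).
Local Notation res := (@res K).
Local Notation vac := (vac K).
Implicit Types (A B : {set 'Z_K.+2}) (Bs : seq {set 'Z_K.+2}).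
Implicit Types (g : 'I_K.+2 -> int) (c : state K) (w : seq 'Z_K.+2) (m r i : 'Z_K.+2).

(** The residue of a box is its column minus its row, so transposition negates residues. *)
Lemma act_tau i c : act (- i) (tau c) = omap (@tau K) (act i c).
Proof.
rewrite /act !ffunE.
have -> : - 1 - (- i) = i - 1 by rewrite opprK addrC.
have -> : - 1 - (- i - 1) = i by rewrite opprB opprK addKr.
rewrite ltrD2l ltrN2; case: ifP => //= _; congr Some; apply/ffunP => r.
rewrite [RHS]ffunE [LHS]ffunE !ffunE.
have -> : (- 1 - r == i) = (r == - i - 1).
  apply/eqP/eqP => e; first by rewrite -e opprB opprK addrK.
  by rewrite e opprB opprK addKr.
have -> : (- 1 - r == i - 1) = (r == - i).
  by rewrite addrC (inj_eq (addIr _)) eqr_oppLR.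
have -> : - 1 - (- i) = i - 1 by rewrite opprK addrC.
have -> : - 1 - (- i - 1) = i by rewrite opprB opprK addKr.
case: (r =P - i) => [->|_].
  case: eqP => [e|_]; last by ring.
  by move/eqP: e; rewrite eq_sym Zp_subr1.
by case: eqP => _; ring.
Qed.

Lemma actw_tau w c : actw (map -%R w) (tau c) = omap (@tau K) (actw w c).
Proof.
elim: w => //= i w; rewrite -!/(actw _ _) => ->.
by case: (actw w c) => [d|] //=; rewrite act_tau.
Qed.

Lemma tau_vac : tau vac = vac.
Proof.
apply: (win_stateE _ (vac_window K)).
apply: (window_ext _ (tau_window (vac_window K))) => a.
by rewrite /wtau /=; have := ltn_ord a; lia.
Qed.

Definition negset A : {set 'Z_K.+2} := [set r | - r \in A].

Lemma negsetK : involutive negset.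
Proof. by move=> A; apply/setP => r; rewrite !inE opprK. Qed.

Lemma card_negset A : #|negset A| = #|A|.
Proof.
have -> : negset A = [set - r | r in A].
  apply/setP => r; rewrite inE; apply/idP/imsetP => [h|[x xA ->]]; last by rewrite opprK.
  by exists (- r); rewrite ?opprK.
by apply: card_imset; apply: oppr_inj.
Qed.

(** Reversal makes the word climb, and negation makes it descend again, now from [- m]. *)
Lemma rev_cdesc m A : map -%R (rev (cdesc m A)) = cdesc (- m) (negset A).
Proof.
rewrite /cdesc -filter_rev -map_rev.
have -> : rev (iota 1 K.+1) = [seq (K.+2 - j)%N | j : nat <- iota 1 K.+1].
  apply: (@eq_from_nth _ 0%N); rewrite ?size_rev ?size_map // size_iota => i iK.
  rewrite nth_rev ?size_iota // (nth_map 0%N) ?size_iota // !nth_iota //; last by lia.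
  by lia.
rewrite -map_comp.
have -> : [seq ((fun i : nat => m - i%:R) \o (fun i : nat => (K.+2 - i)%N)) j
             | j : nat <- iota 1 K.+1] =
    [seq m + j%:R | j : nat <- iota 1 K.+1].
  apply/eq_in_map => i; rewrite mem_iota add1n ltnS => /andP[_ iK] /=.
  rewrite natrB; last by apply: leqW.
  have -> : (K.+2%:R : 'Z_K.+2) = 0 by apply: (@pchar_Zp K.+2).
  by rewrite sub0r opprK.
elim: (iota 1 K.+1) => //= i s IH.
rewrite [in RHS]inE [- (_ - _)]opprB opprK [i%:R + m]addrC.
by case: ifP => _ //=; rewrite IH // opprD.
Qed.

Definition wordu Bs : seq 'Z_K.+2 :=
  flatten [seq rev (cyc_desc (k := K.+1) B) | B <- rev Bs].

Lemma strips_ok_negset Bs : strips_ok (map negset Bs) <-> strips_ok Bs.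
Proof.
have half Cs : strips_ok Cs -> strips_ok (map negset Cs).
  move=> ok _ /mapP[B BC ->]; have [B0 pB] := ok B BC.
  rewrite finset.properEcard finset.subsetT /= -card_gt0 card_negset card_gt0; split=> //.
  by move: pB; rewrite finset.properEcard => /andP[].
split; last exact: half.
by move/half; rewrite mapK //; apply: negsetK.
Qed.

Lemma wordu_tau Bs : strips_ok Bs ->
  actw (wordd (map negset Bs)) vac = omap (@tau K) (actw (wordu Bs) vac).
Proof.
move=> ok; rewrite -actw_tau tau_vac; elim/last_ind: Bs ok => [|Bs B IH] ok //.
rewrite map_rcons wordd_rcons /wordu rev_rcons /= map_cat !actw_cat.
have ok' : strips_ok Bs by move=> C CB; apply: ok; rewrite mem_rcons inE CB orbT.
rewrite -/(wordu Bs) -IH //; case E: (actw _ vac) => [d|] //=.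
have [g w _] := actw_window (vac_window K) E.
have [_ pB] : B != finset.set0 /\ B \proper [set: 'Z_K.+2].
  by apply: ok; rewrite mem_rcons mem_head.
have [m mB ->] := cyc_descE pB; rewrite rev_cdesc.
have mB' : - m \notin negset B by rewrite inE opprK.
have [m2 mB2 ->] := cyc_descE (sub_properT mB').
exact: cdesc_indep mB2 mB' w.
Qed.

Lemma RI_word w lam g c : kbounded K.+1 lam -> actw w vac = Some c ->
  window g (tau c) -> (forall a : 'I_K.+2, Lw g a = (col_height lam a)%:Z) ->
  forall r, RI (mono R w : nilcox K.+1 R) r = col_height lam r.
Proof.
move=> kl hw wg hL r; rewrite /RI.
rewrite (max_factorizationE (phi := negset) (lam := lam) (g := g) (c := tau c)) //; last first.
- move=> Bs; rewrite /is_factorization /uA mono_flatten -/(wordu Bs).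
  split=> -[ok].
    move/(mono_eq_actw _ _ hw) => e; split; first by apply/strips_ok_negset.
    by rewrite wordu_tau // e.
  have ok' : strips_ok Bs by apply/strips_ok_negset.
  rewrite wordu_tau //; case E: (actw _ vac) => [d|] //= [] /(can_inj (@tauK K)) ed.
  by split=> //; apply/(mono_eq_actw _ _ hw); rewrite E ed.
- exact: card_negset.
- exact: negsetK.
rewrite size_map size_mkseq /col_height.
rewrite -[in RHS](mkseq_nth 0%N lam) count_map; apply: eq_in_count => j.
rewrite mem_iota add0n => /andP[_ js].
rewrite (nth_map finset.set0) ?size_mkseq // inE opprB.
by rewrite mem_nth_row_sets.
Qed.

End Transposition.

Theorem proposition51
  (k : nat) (hk : (1 <= k)%N) (R : comNzRingType)
  (s : seq nat -> nilcox k R) (hs : is_kSchur s)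
  (lam : seq nat) (hlam : kbounded k lam)
  (x : nilcox k R) (hx : affine_perm x) (hdom : dominant0 x)
  (hassoc : associated s x lam) :
  code_vector (RD x) = rcons (mkseq (col_height lam) k) 0%N /\
  (forall nu : seq nat, nu = kconj k lam ->
    code_vector (RI x) = rcons (mkseq (col_height nu) k) 0%N).
Proof.
case: k hk s hs lam hlam x hx hdom hassoc => [|K] // _ s hs lam hlam x [nz [wd ex]] hdom [_ hsum].
rewrite ex in nz hdom hsum *.
have [c hc hcs] := summand_core_state hs hlam nz hdom hsum.
have [g [c' [e w hL]]] := core_state_window hlam.
have ec : c' = c by move: e; rewrite hcs => -[].
subst c'.
split; first by apply: (code_vectorE hlam) => // a; apply: (RD_word R hlam hc w hL).
move=> _ ->; have wt := tau_window w.
(* The columns of [mu] are the heights [Lw] of the transposed window, that is [Nw g] in reverse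
   order, as for the k-conjugate. *)
have [mu km hmu] := window_shape wt.
have [_ hcol] := kconj_window hlam w hL.
apply: (code_vectorE km) => a; first exact: (RI_word R km hc wt hmu).
by apply/eqP; rewrite -eqz_nat hcol -hmu (Lw_tau _ w).
Qed.
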